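(* In the collaborative variant of the concurrent interpolation search tree (IST), the insertion and deletion operations are lock-free, and the lookup operation is wait-free.
   Context: MODEL. Finitely many (at most $p$) asynchronous threads take arbitrarily interleaved atomic steps on a shared memory; nodes are freshly allocated and never reused. Atomic primitives: READ, WRITE, CAS, FETCH_AND_ADD, and $\mathrm{DCSS}(x,o,w,y,o')$, which atomically writes $w$ to address $x$ and returns SUCCESS if $x$ holds $o$ and $y$ holds $o'$, and otherwise changes nothing and returns FAILED_MAIN_ADDRESS (if $x$ did not match) or FAILED_AUX_ADDRESS (if $y$ did not match). Entries of children arrays are read atomically (primitive DCSS_READ). An operation is wait-free if every invocation completes within a finite number of the invoking thread's own steps, regardless of the other threads; operations are lock-free if, whenever threads executing them keep taking steps, some operation completes after a finite number of steps. DATA. Keys come from a totally ordered set $\mathbb{K}$. A node is one of: Empty; Single(key, val); Inner(initSize, degree $d$, keys $k_0<\dots<k_{d-2}$, children[$0..d-1$], status, count, nextMark), where status is a triple (integer, boolean, boolean), initially $[0,\bot,\bot]$, count and nextMark are initially $0$, initSize is the number of keys in the subtree at the node's creation; Rebuild(target: Inner, newTarget: node pointer, initially null, parent: Inner, index: int). Apart from children entries, status, count and nextMark, fields of an Inner node do not change once the node has been completely built. An IST $I$ has a field root, pointing to a permanent sentinel Inner node of degree 1 (no keys) whose single child is Empty in a newly created IST. An ideal IST on $n$ keys is: Empty if $n=0$, Single if $n=1$, and otherwise an Inner node of degree $\lfloor\sqrt n\rfloor$ or $\lceil\sqrt n\rceil$ whose child subtrees are ideal ISTs each with $\lfloor\sqrt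 n\rfloor$ or $\lceil\sqrt n\rceil$ keys. In each Inner node, children[$i$] is responsible for the keys in $[k_{i-1},k_i)$ (within the parent's interval). $R>0$ (rebuild threshold) and $T$ (COLLABORATION_THRESHOLD) are fixed constants. interpolationSearch($k,n$) returns the index $i$ with $k_{i-1}\le k<k_i$ in $n$'s keys (with $k_{-1}=-\infty$, $k_{d-1}=+\infty$). OPERATIONS. insert($I,k,v$): path := empty list; $n:=I.\mathrm{root}$; loop: $i:=$ interpolationSearch($k,n$); $c:=n.\mathrm{children}[i]$. If $c$ is Inner: $n:=c$ and append $(c,i)$ to path. If $c$ is Rebuild: helpRebuild($c$), then restart insert from the root. If $c$ is Empty or Single: create $r$, which is Single($k,v$) if $c$ is Empty or has key $k$, and otherwise an Inner node of degree 2, initSize 2, with the two Single children holding the key of $c$ and the key $k$ in order; execute DCSS($n$.children[$i$], $c$, $r$, $n$.status, $[0,\bot,\bot]$). On FAILED_MAIN_ADDRESS repeat the loop from the same $n$; on FAILED_AUX_ADDRESS restart from the root; on SUCCESS, FETCH_AND_ADD($m$.count, 1) for every $m$ in path, then going down the path find the first $(m,j)$ with $m.\mathrm{count}\ge R\cdot m.\mathrm{initSize}$, if any, and call rebuild($m$, parent, $j$), where parent is the predecessor of $m$ on the path ($I$.root for the first); return. delete($I,k$): the same, except that if $c$ is Empty or a Single with key $\ne k$ it returns without changing anything, and if $c$ is a Single with key $k$ then $r$ is a new Empty node. lookup($I,k$): $n:=I.\mathrm{root}$; loop: if $n$ is Inner, $n:=n.\mathrm{children}[\text{interpolationSearch}(k,n)]$;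 if $n$ is Single, return its value if its key is $k$ and null otherwise; if $n$ is Empty return null; if $n$ is Rebuild, $n:=n.\mathrm{target}$. rebuild($u,q,i$): op := new Rebuild with target $u$, parent $q$, index $i$; if DCSS($q$.children[$i$], $u$, op, $q$.status, $[0,\bot,\bot]$) succeeds then helpRebuild(op). helpRebuild(op): keyCount := markAndCountCollaborative(op.target); ideal := createIdealCollaborative(op, keyCount); $q$ := op.parent; DCSS($q$.children[op.index], op, ideal, $q$.status, $[0,\bot,\bot]$). markAndCountCollaborative($u$) [MCC]: if $u$ is Empty return 0; if Single return 1; if Rebuild return MCC($u$.target). Otherwise: CAS($u$.status, $[0,\bot,\bot]$, $[0,\bot,\top]$); if $u.\mathrm{degree}>T$, repeat: index := FETCH_AND_ADD($u$.nextMark, 1), stop repeating if index $\ge u.\mathrm{degree}$, else MCC($u$.children[index]). Then keyCount := 0; for each index read the child $c$: if $c$ is Inner, read its status $[\text{count},\text{finished},\text{started}]$ and add count if finished, else add MCC($c$); if $c$ is Rebuild add MCC($c$); if $c$ is Single add 1. Then CAS($u$.status, $[0,\bot,\top]$, $[\text{keyCount},\top,\top]$) and return keyCount. createIdeal(target, from, cnt): returns a newly allocated ideal IST on the cnt keys of ranks from, ..., from+cnt$-1$ (ranks start at 0) among the sorted keys in the subtree of target; createIdeal(target, cnt) means from $=0$. createIdealCollaborative(op, keyCount): if keyCount $<T$, newTarget := createIdeal(op.target, keyCount); else newTarget := new Inner with initSize = keyCount, degree = 0, a keys array of length $\lfloor\sqrt{\text{keyCount}}\rfloor-1$, a children array of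 $\lfloor\sqrt{\text{keyCount}}\rfloor$ null pointers, status $[0,\bot,\bot]$, count = nextMark = 0. If CAS(op.newTarget, null, newTarget) fails, newTarget := READ(op.newTarget). If keyCount $\ge T$: (a) repeat: index := READ(newTarget.degree); stop repeating if index equals the length of newTarget.children; if CAS(newTarget.degree, index, index+1) succeeds and rebuildAndSetChild(op, keyCount, index) returns false, return newTarget; (b) for each index, if newTarget.children[index] is null and rebuildAndSetChild(op, keyCount, index) returns false, return newTarget. Return newTarget. rebuildAndSetChild(op, keyCount, index): $t:=\lfloor\sqrt{\text{keyCount}}\rfloor$; $s:=\lfloor\text{keyCount}/t\rfloor$; $\rho:=\text{keyCount} \bmod t$; from $:=s\cdot\text{index}+\min(\text{index},\rho)$; cnt $:=s+1$ if index $<\rho$, else $s$; child := createIdeal(op.target, from, cnt); if index $>0$, WRITE into op.newTarget.keys[index$-1$] the key of rank from in op.target; result := DCSS(op.newTarget.children[index], null, child, op.newTarget.status, $[0,\bot,\bot]$); return (result $\ne$ FAILED_AUX_ADDRESS). *)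

(* Defs.v *)
From HB Require Import structures.
From mathcomp Require Import all_boot all_order all_algebra.
From mathcomp Require Import reals.

Set Implicit Arguments.
Unset Strict Implicit.
Unset Printing Implicit Defensive.

Import Order.TTheory GRing.Theory Num.Theory.

(* A heap is the sequence of all nodes allocated so far and  *)
(* a pointer is an index into it, so allocation never reuses a node.  A null *)
(* pointer, or an unwritten entry of a keys array, is None.                  *)

Definition ptr := nat.

(* (integer, finished, started) *)
Definition status := (nat * bool * bool)%type.

Definition clean : status := (0, false, false).
Definition started : status := (0, false, true).
Definition finished (kc : nat) : status := (kc, true, true).

(* keys and children are arrays of fixed length.  The degree is a field of  *)
(* its own: it is smaller than the length of children while a node is being  *)
(* built collaboratively.                                                    *)
Record inner (K : Type) := MkInner {
  i_initSize : nat;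
  i_degree : nat;
  i_keys : seq (option K);
  i_children : seq (option ptr);
  i_status : status;
  i_count : nat;
  i_nextMark : nat
}.

Inductive node (K V : Type) :=
| Empty
| Single of K & V
| Inner of inner K
| Rebuild (target : ptr) (newTarget : option ptr) (parent : ptr) (index : nat).

Arguments Empty {K V}.
Arguments Single {K V}.
Arguments Inner {K V}.
Arguments Rebuild {K V}.

Definition new_inner (K V : Type) (initSize degree : nat)
    (ks : seq (option K)) (cs : seq (option ptr)) : node K V :=
  Inner (MkInner initSize degree ks cs clean 0 0).

(* The kind of a node with those of its fields that never change; lengths of *)
(* arrays are fixed at allocation.                                           *)
Inductive view (K V : Type) :=
| VEmpty
| VSingle of K & V
| VInner (initSize nchildren : nat)
| VRebuild (target parent : ptr) (index : nat).

Arguments VEmpty {K V}.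
Arguments VSingle {K V}.
Arguments VInner {K V}.
Arguments VRebuild {K V}.

Definition view_of (K V : Type) (x : node K V) : view K V :=
  match x with
  | Empty => VEmpty
  | Single k v => VSingle k v
  | Inner n => VInner (i_initSize n) (size (i_children n))
  | Rebuild t _ q i => VRebuild t q i
  end.

(* Addresses of the mutable words, indexed by the type of their contents. *)
Inductive wkind := WKey | WPtr | WNat | WStatus.

Inductive loc : wkind -> Type :=
| LKey (p : ptr) (i : nat) : loc WKey
| LChild (p : ptr) (i : nat) : loc WPtr
| LNewTarget (p : ptr) : loc WPtr
| LDegree (p : ptr) : loc WNat
| LCount (p : ptr) : loc WNat
| LNextMark (p : ptr) : loc WNat
| LStatus (p : ptr) : loc WStatus.

Inductive dcss_result := Success | FailedMainAddress | FailedAuxAddress.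

Section IST.

Context {d : Order.disp_t} {K : orderType d} {V : Type}.

Definition word (w : wkind) : eqType :=
  match w return eqType with
  | WKey => option K
  | WPtr => option ptr
  | WNat => nat
  | WStatus => status
  end.

Definition heap := seq (node K V).

Definition inner_at (h : heap) (p : ptr) : option (inner K) :=
  if onth h p is Some (Inner n) then Some n else None.

Definition load (h : heap) (w : wkind) (l : loc w) : option (word w) :=
  match l in loc w return option (word w) with
  | LKey p i => obind (fun n => onth (i_keys n) i) (inner_at h p)
  | LChild p i => obind (fun n => onth (i_children n) i) (inner_at h p)
  | LNewTarget p =>
      if onth h p is Some (Rebuild _ nt _ _) then Some nt else None
  | LDegree p => omap (@i_degree K) (inner_at h p)
  | LCount p => omap (@i_count K) (inner_at h p)
  | LNextMark p => omap (@i_nextMark K) (inner_at h p)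
  | LStatus p => omap (@i_status K) (inner_at h p)
  end.

Definition update (h : heap) (p : ptr) (f : inner K -> inner K) : heap :=
  if inner_at h p is Some n then set_nth Empty h p (Inner (f n)) else h.

(* Only used at addresses where [load] is defined. *)
Definition store (h : heap) (w : wkind) (l : loc w) : word w -> heap :=
  match l in loc w return word w -> heap with
  | LKey p i => fun x => update h p (fun n =>
      MkInner (i_initSize n) (i_degree n) (set_nth None (i_keys n) i x)
              (i_children n) (i_status n) (i_count n) (i_nextMark n))
  | LChild p i => fun x => update h p (fun n =>
      MkInner (i_initSize n) (i_degree n) (i_keys n)
              (set_nth None (i_children n) i x)
              (i_status n) (i_count n) (i_nextMark n))
  | LNewTarget p => fun x =>
      if onth h p is Some (Rebuild t _ q i)
      then set_nth Empty h p (Rebuild t x q i) else h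
  | LDegree p => fun x => update h p (fun n =>
      MkInner (i_initSize n) x (i_keys n) (i_children n)
              (i_status n) (i_count n) (i_nextMark n))
  | LCount p => fun x => update h p (fun n =>
      MkInner (i_initSize n) (i_degree n) (i_keys n) (i_children n)
              (i_status n) x (i_nextMark n))
  | LNextMark p => fun x => update h p (fun n =>
      MkInner (i_initSize n) (i_degree n) (i_keys n) (i_children n)
              (i_status n) (i_count n) x)
  | LStatus p => fun x => update h p (fun n =>
      MkInner (i_initSize n) (i_degree n) (i_keys n) (i_children n)
              x (i_count n) (i_nextMark n))
  end.

(* [alloc_ideal h s r h'] says that h' is h extended with fresh *)
(* nodes that form an ideal IST with root r on the key-value pairs s, given  *)
(* in increasing order of keys; the degree and the distribution of the keys  *)
(* among the children are left open, as in the definition of an ideal IST.   *)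
(* The separating keys are the least keys of the children 1, ..., d-1.       *)

Definition sqrt_floor (n : nat) : nat := Nat.sqrt n.
Definition sqrt_ceil (n : nat) : nat :=
  if sqrt_floor n ^ 2 == n then sqrt_floor n else (sqrt_floor n).+1.

Definition near_sqrt (n m : nat) : bool :=
  (m == sqrt_floor n) || (m == sqrt_ceil n).

Definition separators (parts : seq (seq (K * V))) : seq (option K) :=
  [seq omap fst (ohead s) | s <- behead parts].

Inductive alloc_ideal : heap -> seq (K * V) -> ptr -> heap -> Prop :=
| IdealEmpty h : alloc_ideal h [::] (size h) (rcons h Empty)
| IdealSingle h k v :
    alloc_ideal h [:: (k, v)] (size h) (rcons h (Single k v))
| IdealInner h parts cs h' (n := size (flatten parts)) :
    1 < n ->
    near_sqrt n (size parts) ->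
    all (fun s => near_sqrt n (size s)) parts ->
    alloc_ideals h parts cs h' ->
    alloc_ideal h (flatten parts) (size h')
      (rcons h' (new_inner V n (size parts) (separators parts) (map some cs)))
with alloc_ideals :
    heap -> seq (seq (K * V)) -> seq ptr -> heap -> Prop :=
| IdealNil h : alloc_ideals h [::] [::] h
| IdealCons h s parts c cs h1 h2 :
    alloc_ideal h s c h1 -> alloc_ideals h1 parts cs h2 ->
    alloc_ideals h (s :: parts) (c :: cs) h2.

(* Read of a children entry stands for DCSS_READ.  Deref reads the kind and  *)
(* the constant fields of a node.  Alloc and AllocIdeal allocate nodes that  *)
(* no other thread can access before their pointer is published.             *)
Inductive prim :=
| Deref (p : ptr)
| Read (w : wkind) (l : loc w)
| Write (w : wkind) (l : loc w) (x : word w)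
| Cas (w : wkind) (l : loc w) (o x : word w)
| FetchAndAdd (l : loc WNat) (m : nat)
| Dcss (w : wkind) (l : loc w) (o x : word w)
       (w' : wkind) (l' : loc w') (o' : word w')
| Alloc (x : node K V)
| AllocIdeal (s : seq (K * V)).

Definition response (c : prim) : Type :=
  match c with
  | Deref _ => view K V
  | Read w _ => word w
  | Write _ _ _ => unit
  | Cas _ _ _ _ => bool
  | FetchAndAdd _ _ => nat
  | Dcss _ _ _ _ _ _ _ => dcss_result
  | Alloc _ => ptr
  | AllocIdeal _ => ptr
  end.

(* [prim_step h c r h']: executed in h, the primitive c may return r and     *)
(* leave h'.  There is no outcome when c accesses an invalid address.  If    *)
(* neither address matches, Dcss may report either failure.                  *)
Definition prim_step (h : heap) (c : prim) : response c -> heap -> Prop :=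
  match c return response c -> heap -> Prop with
  | Deref p => fun r h' => omap (@view_of K V) (onth h p) = Some r /\ h' = h
  | Read w l => fun r h' => load h l = Some r /\ h' = h
  | Write w l x => fun _ h' => load h l /\ h' = store h l x
  | Cas w l o x => fun r h' => exists2 y, load h l = Some y &
      r = (y == o) /\ h' = if y == o then store h l x else h
  | FetchAndAdd l m => fun r h' =>
      load h l = Some r /\ h' = @store h WNat l (r + m)%N
  | Dcss w l o x w' l' o' => fun r h' => exists y y',
      [/\ load h l = Some y, load h l' = Some y' &
          match r with
          | Success => [/\ y = o, y' = o' & h' = store h l x]
          | FailedMainAddress => y <> o /\ h' = h
          | FailedAuxAddress => y' <> o' /\ h' = h
          end]
  | Alloc x => fun r h' => r = size h /\ h' = rcons h x
  | AllocIdeal s => fun r h' => alloc_ideal h s r h'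
  end.

(* Act performs one primitive.  General recursion and unbounded   *)
(* loops go through Call, whose unfolding also takes a step of the thread.   *)
(* Crash is reached on an access that the algorithm never makes, such as     *)
(* dereferencing null; a crashed thread keeps taking steps and never         *)
(* completes its operation.                                                  *)

Inductive update_op := Ins of K & V | Del of K.

Definition update_key (u : update_op) : K :=
  match u with Ins k _ => k | Del k => k end.

(* PUpdate u n path: the loop of insert and delete at node n.                *)
(* PMark u deg: the nextMark loop of markAndCountCollaborative.              *)
(* PFill op kc nt: loop (a) of createIdealCollaborative; false means that    *)
(* rebuildAndSetChild returned false.                                        *)
(* PCollect u: the pairs in the subtree of u.                                *)
Inductive proc :=
| PUpdate (u : update_op) (n : ptr) (path : seq (ptr * nat))
| PLookup (k : K) (n : ptr)
| PMCC (u : ptr)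
| PMark (u : ptr) (deg : nat)
| PFill (op : ptr) (keyCount : nat) (nt : ptr)
| PCollect (u : ptr).

Definition proc_result (f : proc) : Type :=
  match f with
  | PUpdate _ _ _ => unit
  | PLookup _ _ => option V
  | PMCC _ => nat
  | PMark _ _ => unit
  | PFill _ _ _ => bool
  | PCollect _ => seq (K * V)
  end.

Inductive prog (A : Type) :=
| Ret of A
| Act (c : prim) of (response c -> prog A)
| Call (f : proc) of (proc_result f -> prog A)
| Crash.

Arguments Crash {A}.

Fixpoint bind (A B : Type) (m : prog A) (g : A -> prog B) : prog B :=
  match m with
  | Ret a => g a
  | Act c k => @Act B c (fun r => bind (k r) g)
  | Call f k => @Call B f (fun r => bind (k r) g)
  | Crash => Crash
  end.

Definition act (c : prim) : prog (response c) := Act (@Ret (response c)).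
Definition call (f : proc) : prog (proc_result f) :=
  Call (@Ret (proc_result f)).

Local Notation "'do' x <- m ; k" := (bind m (fun x => k))
  (at level 200, x name, m at level 100, k at level 200).
Local Notation "'run' m ; k" := (bind m (fun _ => k))
  (at level 200, m at level 100, k at level 200).

Definition deref (p : ptr) : prog (view K V) := act (Deref p).
Definition read (w : wkind) (l : loc w) : prog (word w) := act (Read l).
Definition cas (w : wkind) (l : loc w) (o x : word w) : prog bool :=
  act (Cas l o x).
Definition alloc (x : node K V) : prog ptr := act (Alloc x).

Definition read_ptr (l : loc WPtr) : prog ptr :=
  do c <- read l; if c is Some p then Ret p else Crash.

(* DCSS(n.children[i], o, x, n.status, [0,_|_,_|_]) *)
Definition dcss_child (n : ptr) (i : nat) (o x : option ptr)
    : prog dcss_result :=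
  act (@Dcss WPtr (LChild n i) o x WStatus (LStatus n) clean).

(* The index i with k_{i-1} <= k < k_i.  Keys are read one by one; how the   *)
(* search probes them has no effect on its result.                           *)
Fixpoint scan (k : K) (n : ptr) (i m : nat) : prog nat :=
  if m is m'.+1 then
    do x <- read (LKey n i);
    if x is Some ki then
      if (k < ki)%O then Ret i else scan k n i.+1 m'
    else Crash
  else Ret i.

Definition interpolation_search (k : K) (n : ptr) : prog nat :=
  do deg <- read (LDegree n); scan k n 0 deg.-1.

Definition lookup_body (k : K) (n : ptr) : prog (option V) :=
  do x <- deref n;
  match x with
  | VInner _ _ =>
      do i <- interpolation_search k n;
      do c <- read_ptr (LChild n i);
      call (PLookup k c)
  | VSingle k' v => Ret (if k' == k then Some v else None)
  | VEmpty => Ret None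
  | VRebuild target _ _ => call (PLookup k target)
  end.

Definition mark_body (u : ptr) (deg : nat) : prog unit :=
  do index <- act (FetchAndAdd (LNextMark u) 1);
  if (deg <= index)%N then Ret tt else
    do c <- read_ptr (LChild u index);
    run call (PMCC c);
    call (PMark u deg).

Definition count_child (c : ptr) : prog nat :=
  do x <- deref c;
  match x with
  | VInner _ _ =>
      do st <- read (LStatus c);
      if (st : status).1.2 then Ret (st : status).1.1 else call (PMCC c)
  | VRebuild _ _ _ => call (PMCC c)
  | VSingle _ _ => Ret 1
  | VEmpty => Ret 0
  end.

Fixpoint count_children (u : ptr) (acc : nat) (indices : seq nat)
    : prog nat :=
  if indices is i :: indices' then
    do c <- read_ptr (LChild u i);
    do m <- count_child c;
    count_children u (acc + m)%N indices'
  else Ret acc.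

(* T is COLLABORATION_THRESHOLD. *)
Definition mcc_body (T : nat) (u : ptr) : prog nat :=
  do x <- deref u;
  match x with
  | VEmpty => Ret 0
  | VSingle _ _ => Ret 1
  | VRebuild target _ _ => call (PMCC target)
  | VInner _ _ =>
      run cas (LStatus u) clean started;
      do deg <- read (LDegree u);
      run (if (T < deg)%N then call (PMark u deg) else Ret tt);
      do keyCount <- count_children u 0 (iota 0 deg);
      run cas (LStatus u) started (finished keyCount);
      Ret keyCount
  end.

Fixpoint collect_children (u : ptr) (acc : seq (K * V)) (indices : seq nat)
    : prog (seq (K * V)) :=
  if indices is i :: indices' then
    do c <- read_ptr (LChild u i);
    do s <- call (PCollect c);
    collect_children u (acc ++ s) indices'
  else Ret acc.

Definition collect_body (u : ptr) : prog (seq (K * V)) :=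
  do x <- deref u;
  match x with
  | VEmpty => Ret [::]
  | VSingle k v => Ret [:: (k, v)]
  | VRebuild target _ _ => call (PCollect target)
  | VInner _ _ =>
      do deg <- read (LDegree u); collect_children u [::] (iota 0 deg)
  end.

Definition sorted_pairs (target : ptr) : prog (seq (K * V)) :=
  do s <- call (PCollect target); Ret (sort (fun a b => (a.1 <= b.1)%O) s).

Definition create_ideal (target : ptr) (from cnt : nat) : prog ptr :=
  do s <- sorted_pairs target;
  let s' := take cnt (drop from s) in
  if size s' == cnt then act (AllocIdeal s') else Crash.

Definition key_of_rank (target : ptr) (rank : nat) : prog K :=
  do s <- sorted_pairs target;
  if onth s rank is Some (k, _) then Ret k else Crash.

Definition rebuild_and_set_child (op : ptr) (keyCount index : nat)
    : prog bool :=
  let t := sqrt_floor keyCount in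
  let s := (keyCount %/ t)%N in
  let rho := (keyCount %% t)%N in
  let from := (s * index + minn index rho)%N in
  let cnt := if (index < rho)%N then s.+1 else s in
  do x <- deref op;
  if x is VRebuild target _ _ then
    do child <- create_ideal target from cnt;
    do nt <- read_ptr (LNewTarget op);
    run (if (0 < index)%N then
           do k <- key_of_rank target from;
           act (@Write WKey (LKey nt index.-1) (Some k))
         else Ret tt);
    do res <- dcss_child nt index None (Some child);
    Ret (if res is FailedAuxAddress then false else true)
  else Crash.

Definition fill_body (op : ptr) (keyCount : nat) (nt : ptr) : prog bool :=
  do index <- read (LDegree nt);
  do x <- deref nt;
  if x is VInner _ len then
    if index == len then Ret true else
      do ok <- cas (LDegree nt) index (index : nat).+1;
      if ok then
        do go <- rebuild_and_set_child op keyCount index;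
        if go then call (PFill op keyCount nt) else Ret false
      else call (PFill op keyCount nt)
  else Crash.

Fixpoint fill_null (op : ptr) (keyCount : nat) (nt : ptr)
    (indices : seq nat) : prog unit :=
  if indices is i :: indices' then
    do c <- read (LChild nt i);
    if c is Some _ then fill_null op keyCount nt indices' else
      do go <- rebuild_and_set_child op keyCount i;
      if go then fill_null op keyCount nt indices' else Ret tt
  else Ret tt.

Definition create_ideal_collaborative (T : nat) (op : ptr) (keyCount : nat)
    : prog ptr :=
  do x <- deref op;
  if x is VRebuild target _ _ then
    let t := sqrt_floor keyCount in
    do new <-
      (if (keyCount < T)%N then create_ideal target 0 keyCount
       else alloc (new_inner V keyCount 0 (nseq t.-1 None) (nseq t None)));
    do ok <- @cas WPtr (LNewTarget op) None (Some new);
    do nt <- (if ok then Ret new else read_ptr (LNewTarget op));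
    if (keyCount < T)%N then Ret nt else
      do go <- call (PFill op keyCount nt);
      run (if go then
             do y <- deref nt;
             if y is VInner _ len
             then fill_null op keyCount nt (iota 0 len) else Crash
           else Ret tt);
      Ret nt
  else Crash.

Definition help_rebuild (T : nat) (op : ptr) : prog unit :=
  do x <- deref op;
  if x is VRebuild target q i then
    do keyCount <- call (PMCC target);
    do ideal <- create_ideal_collaborative T op keyCount;
    run dcss_child q i (Some op) (Some ideal);
    Ret tt
  else Crash.

Definition rebuild (T : nat) (u q : ptr) (i : nat) : prog unit :=
  do op <- alloc (Rebuild u None q i);
  do res <- dcss_child q i (Some u) (Some op);
  if res is Success then help_rebuild T op else Ret tt.

(* The sentinel I.root is the first node of the heap. *)
Definition ist_root : ptr := 0.

Fixpoint bump_counts (path : seq (ptr * nat)) : prog unit :=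
  if path is (m, _) :: path' then
    run act (FetchAndAdd (LCount m) 1); bump_counts path'
  else Ret tt.

(* rR is the rebuild threshold R; parent is the predecessor on the path. *)
Fixpoint rebuild_first (F : realType) (rR : F) (T : nat) (parent : ptr)
    (path : seq (ptr * nat)) : prog unit :=
  if path is (m, j) :: path' then
    do x <- deref m;
    if x is VInner initSize _ then
      do count <- read (LCount m);
      if (rR * initSize%:R <= (count : nat)%:R)%R then rebuild T m parent j
      else rebuild_first rR T m path'
    else Crash
  else Ret tt.

(* The node r that replaces a child which is Empty (cur = None) or a Single  *)
(* (cur = Some pair); None if the operation has nothing to change.           *)
Definition replacement (u : update_op) (cur : option (K * V))
    : prog (option ptr) :=
  match u, cur with
  | Ins k v, None => do r <- alloc (Single k v); Ret (Some r)
  | Ins k v, Some (k', v') =>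
      if k' == k then do r <- alloc (Single k v); Ret (Some r) else
      let: (a, b) :=
        if (k' < k)%O then ((k', v'), (k, v)) else ((k, v), (k', v')) in
      do p <- alloc (Single a.1 a.2);
      do q <- alloc (Single b.1 b.2);
      do r <- alloc (new_inner V 2 2 [:: Some b.1] [:: Some p; Some q]);
      Ret (Some r)
  | Del _, None => Ret None
  | Del k, Some (k', _) =>
      if k' == k then do r <- alloc Empty; Ret (Some r) else Ret None
  end.

Definition replace_child (F : realType) (rR : F) (T : nat) (u : update_op)
    (n : ptr) (path : seq (ptr * nat)) (i : nat) (c : ptr)
    (cur : option (K * V)) : prog unit :=
  do r <- replacement u cur;
  if r is Some r' then
    do res <- dcss_child n i (Some c) (Some r');
    match res with
    | FailedMainAddress => call (PUpdate u n path)
    | FailedAuxAddress => call (PUpdate u ist_root [::])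
    | Success => run bump_counts path; rebuild_first rR T ist_root path
    end
  else Ret tt.

Definition update_body (F : realType) (rR : F) (T : nat) (u : update_op)
    (n : ptr) (path : seq (ptr * nat)) : prog unit :=
  do i <- interpolation_search (update_key u) n;
  do c <- read_ptr (LChild n i);
  do x <- deref c;
  match x with
  | VInner _ _ => call (PUpdate u c (rcons path (c, i)))
  | VRebuild _ _ _ => run help_rebuild T c; call (PUpdate u ist_root [::])
  | VEmpty => replace_child rR T u n path i c None
  | VSingle k v => replace_child rR T u n path i c (Some (k, v))
  end.

Definition body (F : realType) (rR : F) (T : nat) (f : proc)
    : prog (proc_result f) :=
  match f return prog (proc_result f) with
  | PUpdate u n path => update_body rR T u n path
  | PLookup k n => lookup_body k n
  | PMCC u => mcc_body T u
  | PMark u deg => mark_body u deg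
  | PFill op kc nt => fill_body op kc nt
  | PCollect u => collect_body u
  end.

Inductive operation := OInsert of K & V | ODelete of K | OLookup of K.

Definition is_update (o : operation) : bool :=
  if o is OLookup _ then false else true.
Definition is_lookup (o : operation) : bool := ~~ is_update o.

Definition op_proc (o : operation) : proc :=
  match o with
  | OInsert k v => PUpdate (Ins k v) ist_root [::]
  | ODelete k => PUpdate (Del k) ist_root [::]
  | OLookup k => PLookup k ist_root
  end.

Inductive thread :=
| Idle
| Running (o : operation) of prog (proc_result (op_proc o)).

Arguments Running : clear implicits.

Definition running (P : pred operation) (x : thread) : Prop :=
  if x is Running o _ then P o : Prop else False.

(* One step of a thread.  An idle thread may invoke any operation.  The      *)
(* last two rules keep a thread that makes an invalid access busy forever.   *)
Inductive thread_step (F : realType) (rR : F) (T : nat) (h : heap) :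
    thread -> heap -> thread -> Prop :=
| SInvoke o :
    thread_step rR T h Idle h (Running o (call (op_proc o)))
| SReturn o a :
    thread_step rR T h (Running o (Ret a)) h Idle
| SCall o f k :
    thread_step rR T h (Running o (@Call _ f k))
                h (Running o (bind (body rR T f) k))
| SAct o c k r h' :
    prim_step h r h' ->
    thread_step rR T h (Running o (@Act _ c k)) h' (Running o (k r))
| SInvalid o c k :
    (forall (r : response c) h', ~ prim_step h r h') ->
    thread_step rR T h (Running o (@Act _ c k)) h (Running o Crash)
| SCrash o :
    thread_step rR T h (Running o Crash) h (Running o Crash).

Record config (p : nat) := Config { mem : heap; thr : 'I_p -> thread }.

Definition initial (p : nat) (c : config p) : Prop :=
  mem c = [:: new_inner V 0 1 [::] [:: Some 1]; Empty] /\
  forall t, thr c t = Idle.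

Definition step (F : realType) (rR : F) (T p : nat) (t : 'I_p)
    (c c' : config p) : Prop :=
  thread_step rR T (mem c) (thr c t) (mem c') (thr c' t) /\
  forall t', t' != t -> thr c' t' = thr c t'.

(* An infinite execution: thread s n takes the step from e n to e n.+1.      *)
(* No fairness is assumed.  (Finite executions are irrelevant for progress.) *)
Definition execution (F : realType) (rR : F) (T p : nat)
    (s : nat -> 'I_p) (e : nat -> config p) : Prop :=
  initial (e 0) /\ forall n, step rR T (s n) (e n) (e n.+1).

Definition infinitely_often (P : nat -> Prop) : Prop :=
  forall N, exists2 n, (N <= n)%N & P n.

(* If threads executing operations in P keep taking steps, then operations   *)
(* in P keep completing.                                                     *)
Definition lock_free (F : realType) (rR : F) (T p : nat)
    (P : pred operation) : Prop :=
  forall s e, execution rR T s e ->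
  infinitely_often (fun n => @running P (@thr p (e n) (s n))) ->
  infinitely_often (fun n => running P (thr (e n) (s n)) /\
                             thr (e n.+1) (s n) = Idle).

(* A thread t that executes an operation in P at time i, and that takes      *)
(* infinitely many steps, completes the operation.                           *)
Definition wait_free (F : realType) (rR : F) (T p : nat)
    (P : pred operation) : Prop :=
  forall s e, execution rR T s e ->
  forall (t : 'I_p) (i : nat), @running P (@thr p (e i) t) ->
  infinitely_often (fun n => s n = t) ->
  exists2 j, (i < j)%N & thr (e j) t = Idle.

End IST.

(* Main.v *)
(* Executions are annotated with ghost state: the place of every node in the  *)
(* tree, the set of replaced nodes, and for each thread t and node x the      *)
(* number wins t x of successful updates of t that passed through x.  A       *)
(* rely-guarantee argument shows that no access is invalid and that a thread  *)
(* whose count at x has reached R * initSize tries to replace x, or a node    *)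
(* above x, before its update returns.  Whether or not it succeeds, x is then *)
(* no longer reachable from the root, hence wins t x <= R * initSize + 1      *)
(* unless x is the root.                                                      *)
(* Every installation of a Rebuild node is charged to such an update, so only *)
(* finitely many nodes are ever attached below a node other than the root.    *)
(* Therefore a lookup ends: below the root it descends a bounded tree.        *)
(*   If from some time on no update completed, the updates through the root   *)
(* would be bounded as well.  Then finitely many nodes are ever in the tree,  *)
(* helping ends, and after the last replacement an update that restarts from  *)
(* the root meets only unmarked nodes and current children, so that it        *)
(* completes: a contradiction.                                                *)

Require Import Defs.
From mathcomp Require Import all_boot all_order all_algebra.
From mathcomp Require Import boolp reals zify.

Set Implicit Arguments.
Unset Strict Implicit.
Unset Printing Implicit Defensive.

Import Order.TTheory GRing.Theory Num.Theory.

Arguments Crash {d K V A}.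
Arguments Idle {d K V}.

(** * Heaps and ideal trees *)

Section Heaps.

Context {d : Order.disp_t} {K : orderType d} {V : Type}.

Local Notation node := (node K V).
Local Notation inner := (inner K).
Local Notation heap := (@heap d K V).

(** Safety and termination are proved separately. For safety, [gstep] lists the possible changes of
    the annotated heap; [gstep_invariant] shows that they preserve the invariant, and [gstep_rely]
    that they respect what other threads depend on. [wp_body] verifies each procedure under such
    interference, and [ghost_trace] annotates whole executions accordingly. It follows that no
    thread crashes, that only nodes cut off by a replacement are marked, and that all helpers of a
    rebuild count the same number of keys, because a marked subtree is frozen ([frozen_fun]).

    The position of an attached node is recorded for ever, so the nodes that are or were below a
    given node form a tree that only grows. The quantitative core is [below_bounded]: if the updates
    through [a] are bounded in number, then so are the nodes ever below [a]. For a node other than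
    the root this premise belongs to the invariant. A thread whose wins at [x] have reached the
    threshold leaves its update only when [x] is dead ([wp_rebuild_first]), and the path of a later
    update avoids all nodes that were dead when its walk started ([walking_step]). Depth in the
    bounded tree then yields a measure that decreases along children and along targets of Rebuild
    nodes, by which lookup, marking and collecting end ([term_lookup], [term_mcc], [term_collect]).
    At the root no bound is known, but a lookup leaves the root after reading one child
    ([term_lookup_root]).

    For updates, suppose that none completes from some time on. Each thread then wins at the root at
    most once more ([gsteps_root_wins]), so [below_bounded] applies to the root, and replacements
    cease. After that a failing DCSS on a live node would reveal a replacement or a mark, neither of
    which can occur there, so an update that walks from the root ends ([term_update_live]). With
    [term_update] every update ends, a contradiction. *)

Lemma onth_ltn (A : Type) (s : seq A) i x : onth s i = Some x -> i < size s.
Proof. by move=> e; rewrite -onthTE e. Qed.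

Lemma onth_set_nth (A : Type) (x0 : A) s x y i : x < size s ->
  onth (set_nth x0 s x y) i = if i == x then Some y else onth s i.
Proof.
elim: s x i => [|z s IH] [|x] [|i] //=; rewrite ltnS => h.
by rewrite IH // eqSS.
Qed.

Lemma size_set_nth_lt (A : Type) (x0 : A) s x y : x < size s ->
  size (set_nth x0 s x y) = size s.
Proof. by move=> h; rewrite size_set_nth; apply/maxn_idPr. Qed.

Lemma onth_rcons (A : Type) (s : seq A) y i :
  onth (rcons s y) i = if i == size s then Some y else onth s i.
Proof.
by elim: s i => [|z s IH] [|i] //=; rewrite ?onth0n.
Qed.

Lemma inner_atP (h : heap) x n :
  inner_at h x = Some n <-> onth h x = Some (Inner n).
Proof.
rewrite /inner_at; case: (onth h x) => [[|k v|m|t nt q i]|]; split => // -[->//].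
Qed.

Definition is_rebuild (h : heap) (x : ptr) : bool :=
  if onth h x is Some (Rebuild _ _ _ _) then true else false.

Lemma is_rebuildP h x :
  reflect (exists u nt q i, onth h x = Some (Rebuild u nt q i))
          (is_rebuild h x).
Proof.
rewrite /is_rebuild.
case: (onth h x) => [[|k v|m|t nt q i]|]; constructor;
  by [move=> [? [? [? [? ?]]]] | exists t, nt, q, i].
Qed.

(** A node built collaboratively is full before it enters the tree, so that no procedure reads a
    null child of an attached node. *)
Definition full (n : inner) : Prop :=
  i_degree n = size (i_children n) /\ all isSome (i_children n).

Definition full_at (h : heap) (x : ptr) : Prop :=
  forall n, inner_at h x = Some n -> full n.

(** The last clause records the order of the writes: the key to the left of child [i.+1] is written
    before that child, so a search in a full node never meets an unwritten key. *)
Definition wf_inner (n : inner) : Prop :=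
  [/\ 0 < size (i_children n),
      size (i_keys n) = (size (i_children n)).-1,
      i_degree n <= size (i_children n) &
      forall i c, onth (i_children n) i.+1 = Some (Some c) ->
                  exists k, onth (i_keys n) i = Some (Some k)].

(** What one may still assume about a node after interference. A child may be replaced but never
    becomes null again, and once the status has left [clean] the children are fixed. *)
Definition inner_le (n n' : inner) : Prop :=
  [/\ i_initSize n' = i_initSize n,
      size (i_children n') = size (i_children n),
      (forall i c, onth (i_children n) i = Some (Some c) ->
                   exists c', onth (i_children n') i = Some (Some c')),
      (i_status n <> clean ->
         i_status n' <> clean /\ i_children n' = i_children n) &
      [/\ (forall i k, onth (i_keys n) i = Some (Some k) ->
                   exists k', onth (i_keys n') i = Some (Some k')),
          i_count n <= i_count n', i_nextMark n <= i_nextMark n',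
          i_degree n <= i_degree n' &
          (i_degree n = size (i_children n) ->
             i_degree n' = size (i_children n'))]].

Definition node_le (x x' : node) : Prop :=
  match x, x' with
  | Inner n, Inner n' => inner_le n n'
  | Rebuild t nt q i, Rebuild t' nt' q' i' =>
      [/\ t' = t, q' = q, i' = i & forall y, nt = Some y -> nt' = Some y]
  | Inner _, _ => False
  | Rebuild _ _ _ _, _ => False
  | _, _ => x' = x
  end.

Lemma inner_le_refl n : inner_le n n.
Proof. by split=> // [i c ->|]; [exists c | split => // i k ->; exists k]. Qed.

Lemma inner_le_trans n1 n2 n3 :
  inner_le n1 n2 -> inner_le n2 n3 -> inner_le n1 n3.
Proof.
move=> [a1 b1 c1 d1 [e1 f1 g1 h1 i1]] [a2 b2 c2 d2 [e2 f2 g2 h2 i2]].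
split; [by rewrite a2 | by rewrite b2 | | | split].
- by move=> i c /c1 [c' /c2].
- by move=> /d1 [/d2 [? ->] ->].
- by move=> i c /e1 [c' /e2].
- exact: leq_trans f2.
- exact: leq_trans g2.
- exact: leq_trans h2.
- by move=> /i1 /i2.
Qed.

Lemma node_le_refl x : node_le x x.
Proof. by case: x => //= n; exact: inner_le_refl. Qed.

Lemma node_le_trans x1 x2 x3 :
  node_le x1 x2 -> node_le x2 x3 -> node_le x1 x3.
Proof.
case: x1 => [|k v|n1|t nt q i]; case: x2 => [|k' v'|n2|t' nt' q' i'] //=.
- by move=> [<- <-].
- case: x3 => //= n3; exact: inner_le_trans.
- case: x3 => //= t3 nt3 q3 i3 [-> -> -> a] [-> -> -> b].
  by split=> // y /a /b.
Qed.

Lemma inner_le_full n n' : inner_le n n' -> full n -> full n'.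
Proof.
move=> [_ sz ch _ [_ _ _ _ dg]] [d1 a1]; split; first exact: dg.
apply/(all_nthP None) => i; rewrite sz => hi.
have := all_nthP None a1 i hi.
case E: (nth None (i_children n) i) => [c|] // _.
have /ch [c' e] : onth (i_children n) i = Some (Some c).
  by rewrite onthE (nth_map None) // E.
by rewrite (onth_nth None _ _ _ e).
Qed.

Definition heap_le (h h' : heap) : Prop :=
  size h <= size h' /\
  forall x nd, onth h x = Some nd ->
    exists2 nd', onth h' x = Some nd' & node_le nd nd'.

Lemma heap_le_refl h : heap_le h h.
Proof. by split=> // x nd e; exists nd => //; exact: node_le_refl. Qed.

Lemma heap_le_trans h1 h2 h3 :
  heap_le h1 h2 -> heap_le h2 h3 -> heap_le h1 h3.
Proof.
move=> [a b] [a' b']; split; first exact: leq_trans a'.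
move=> x nd /b [nd' /b' [nd'' e l] l']; exists nd'' => //.
exact: node_le_trans l.
Qed.

Lemma heap_le_inner h h' x n : heap_le h h' -> inner_at h x = Some n ->
  exists2 n', inner_at h' x = Some n' & inner_le n n'.
Proof.
move=> [_ le] /inner_atP /le [[] // n' /inner_atP e l]; by exists n'.
Qed.

Lemma heap_le_rebuild h h' x u nt q i : heap_le h h' ->
  onth h x = Some (Rebuild u nt q i) ->
  exists2 nt', onth h' x = Some (Rebuild u nt' q i) &
               forall y, nt = Some y -> nt' = Some y.
Proof.
move=> [_ le] /le [[] // u' nt' q' i' e /= [? ? ? a]]; subst.
by exists nt'.
Qed.

Lemma heap_le_inner_inv h h' x n' : heap_le h h' -> x < size h ->
  inner_at h' x = Some n' ->
  exists2 n, inner_at h x = Some n & inner_le n n'.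
Proof.
move=> [_ le]; rewrite -onthTE => lt /inner_atP e.
case E: (onth h x) lt => [nd|] // _.
have [nd' e'] := le _ _ E; rewrite e in e'; case: e' => <-.
case: nd E => //= n /inner_atP E l; by exists n.
Qed.

Lemma heap_le_is_rebuild h h' x : heap_le h h' -> x < size h ->
  is_rebuild h' x = is_rebuild h x.
Proof.
move=> [_ le]; rewrite -onthTE /is_rebuild.
case E: (onth h x) => [nd|] // _; have [nd' -> l] := le _ _ E.
by case: nd nd' E l => [|k v|n|? ? ? ?] [] //=.
Qed.

Lemma heap_le_view h h' x nd : heap_le h h' -> onth h x = Some nd ->
  exists2 nd', onth h' x = Some nd' & view_of nd' = view_of nd.
Proof.
move=> [_ le] /le [nd' e l]; exists nd' => //.
case: nd nd' {e} l => [|k v|n|t nt q i] [|k' v'|n'|t' nt' q' i'] //=.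
- by move=> [-> ->].
- by move=> [-> -> _ _ _].
- by move=> [-> -> ->].
Qed.

Lemma heap_le_full h h' x : heap_le h h' -> x < size h ->
  full_at h x -> full_at h' x.
Proof.
move=> le lt fl n' /(heap_le_inner_inv le lt) [n e l].
exact: inner_le_full l (fl _ e).
Qed.

Lemma heap_le_set h x nd nd' : onth h x = Some nd -> node_le nd nd' ->
  heap_le h (set_nth Empty h x nd').
Proof.
move=> e l; have lt := onth_ltn e.
split; first by rewrite size_set_nth_lt.
move=> y ny; rewrite onth_set_nth //; case: eqP => [->|_] ey.
  by exists nd' => //; move: ey; rewrite e => -[<-].
by exists ny => //; exact: node_le_refl.
Qed.

Lemma heap_le_rcons h nd : heap_le h (rcons h nd).
Proof.
split; first by rewrite size_rcons.
move=> x nd' e; exists nd'; last exact: node_le_refl.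
rewrite onth_rcons ifN //; apply: contraL (onth_ltn e) => /eqP ->.
by rewrite ltnn.
Qed.

(* The subtree of x, seen through the targets of Rebuild nodes, contains k   *)
(* keys and can no longer change.                                            *)
Inductive frozen (h : heap) : ptr -> nat -> Prop :=
| FrEmpty x : onth h x = Some Empty -> frozen h x 0
| FrSingle x k v : onth h x = Some (Single k v) -> frozen h x 1
| FrInner x n (f : nat -> nat) :
    onth h x = Some (Inner n) -> i_status n <> clean -> full n ->
    (forall i c, onth (i_children n) i = Some (Some c) -> frozen h c (f i)) ->
    frozen h x (sumn [seq f i | i <- iota 0 (i_degree n)])
| FrRebuild x u nt q i k :
    onth h x = Some (Rebuild u nt q i) -> frozen h u k -> frozen h x k.

(** The Inner nodes of a frozen subtree are marked, so [heap_le] preserves their children and the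
    derivation can be replayed in the later heap. *)
Lemma frozen_le h h' x k : heap_le h h' -> frozen h x k -> frozen h' x k.
Proof.
move=> le; elim=> {x k}.
- by move=> x e; apply: FrEmpty; have [[] // ] := le.2 _ _ e.
- move=> x k v e; have [[] // k' v' e' _] := le.2 _ _ e.
  exact: FrSingle e'.
- move=> x n f e st fl _ IH.
  have [[] // n' e' l] := le.2 _ _ e.
  have [_ _ _ /(_ st) [st' ch] _] := l.
  have fl' := inner_le_full l fl.
  have -> : i_degree n = i_degree n' by rewrite fl.1 fl'.1 ch.
  apply: FrInner e' st' fl' _ => i c; rewrite ch; exact: IH.
- move=> x u nt q i k e _ IH.
  have [nt' e' _] := heap_le_rebuild le e; exact: FrRebuild e' IH.
Qed.

Lemma full_child n i : full n -> i < i_degree n ->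
  exists c, onth (i_children n) i = Some (Some c).
Proof.
move=> [-> /(all_nthP None) al] lt; have := al i lt.
case E: (nth None (i_children n) i) => [c|] // _; exists c.
by rewrite onthE (nth_map None) // E.
Qed.

(** Helpers count at different times; this is why they agree on the number of keys, hence on whether
    to build collaboratively and on the length of the new children array. *)
Lemma frozen_fun h x k k' : frozen h x k -> frozen h x k' -> k = k'.
Proof.
move=> H; elim: H k' => {x k}.
- by move=> x e k' H; case: H e => // [y k v ->|y n f -> |y u nt q i k ->].
- by move=> x k v e k' H; case: H e => // [y ->|y n f -> |y u nt q i k1 ->].
- move=> x n f e st fl H IH k' H'.
  case: H' e => // [y ->|y k v -> |y n' f' -> _ _ H' [?]|y u nt q i k ->] //.
  subst n'; congr sumn; apply/eq_in_map => i; rewrite mem_iota add0n /= => lt.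
  have [c ec] := full_child fl lt.
  exact: IH ec _ (H' _ _ ec).
- move=> x u nt q i k e _ IH k' H'.
  case: H' e => // [y ->|y k1 v -> |y n' f' ->|y u' nt' q' i' k1 -> H [? _ _ _]] //.
  by subst u'; exact: IH.
Qed.

(** * Existence of ideal trees *)

Lemma sqrt_floor_spec n :
  sqrt_floor n * sqrt_floor n <= n < (sqrt_floor n).+1 * (sqrt_floor n).+1.
Proof.
rewrite /sqrt_floor; have [h1 h2] := PeanoNat.Nat.sqrt_spec' n.
by apply/andP; split; [apply/ssrnat.leP | apply/ssrnat.ltP].
Qed.

Lemma sqrt_floor_gt0 n : 0 < n -> 0 < sqrt_floor n.
Proof. by have := sqrt_floor_spec n; case: (sqrt_floor n) => //; lia. Qed.

Lemma near_sqrt_gt0 n m : 0 < n -> near_sqrt n m -> 0 < m.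
Proof.
move=> /sqrt_floor_gt0 n0 /orP [/eqP ->//|/eqP ->].
by rewrite /sqrt_ceil; case: ifP.
Qed.

Lemma alloc_ideals_size (h : heap) parts cs h' :
  alloc_ideals h parts cs h' -> size cs = size parts.
Proof. by elim=> //= *; congr S. Qed.

Lemma wf_new_ideal n (parts : seq (seq (K * V))) (cs : seq ptr) : 0 < n ->
  size cs = size parts -> 0 < size parts ->
  all (fun l => near_sqrt n (size l)) parts ->
  let x := MkInner n (size parts) (separators parts) (map some cs) clean 0 0 in
  wf_inner x /\ full x.
Proof.
move=> n0 sz p0 al x.
have E : size (i_children x) = size parts by rewrite size_map.
split; split; rewrite ?E //; first by rewrite size_map size_behead.
  move=> i c; rewrite /x [i_children _]/= onth_map; case ec: (onth cs i.+1) => [c'|] // _.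
  rewrite /separators onth_map.
  have lt : i.+1 < size parts by rewrite -sz; exact: onth_ltn ec.
  case: (parts) al lt => //= l ls /andP [_ al]; rewrite ltnS -onthTE.
  case el: (onth ls i) => [l'|] // _ /=.
  have := all_nthP [::] al i (onth_ltn el); rewrite (onth_nth _ _ _ _ el).
  by case: l' {el} => [/(near_sqrt_gt0 n0)|a l' _] //=; exists a.1.
by apply/allP => c /mapP [c' _ ->].
Qed.

Lemma split_parts (A : Type) (l : seq A) k a b : a <= b <= a.+1 ->
  k * a <= size l <= k * b ->
  exists parts, [/\ flatten parts = l, size parts = k &
                    all (fun x => a <= size x <= b) parts].
Proof.
move=> hab; elim: k l => [|k IH] l hl.
  by exists [::]; case: l hl.
(* The first part is small if the other [k] parts can absorb the rest, and large otherwise;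
   [b <= a.+1] preserves the lower bound in the second case. *)
pose c := if size l - a <= k * b then a else b.
have hc : [&& a <= c <= b, c <= size l & k * a <= size l - c <= k * b].
  by rewrite /c; case: ifP; nia.
have [h1 h2 h3] := and3P hc.
have [|parts [e s al]] := IH (drop c l); first by rewrite size_drop.
exists (take c l :: parts); split=> /=; first by rewrite e cat_take_drop.
  by rewrite s.
by rewrite al andbT size_takel.
Qed.

(** The last clause makes the recursive construction of ideal trees well-founded. *)
Lemma ideal_parts (A : Type) (l : seq A) : 1 < size l ->
  exists parts, [/\ flatten parts = l, near_sqrt (size l) (size parts),
    all (fun x => near_sqrt (size l) (size x)) parts &
    all (fun x => size x < size l) parts].
Proof.
move=> n1; set n := size l in n1 *.
have sp := sqrt_floor_spec n.
set m := sqrt_floor n in sp.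
have m0 : 0 < m by apply: sqrt_floor_gt0; exact: ltnW.
have [k [a [b [hab hk kn hn lt]]]] : exists k a b, [/\ a <= b <= a.+1,
    k * a <= n <= k * b, near_sqrt n k,
    forall x, a <= x <= b -> near_sqrt n x & b < n].
  rewrite /near_sqrt /sqrt_ceil -/m.
  have [E|/eqP nE] := eqVneq (m ^ 2) n.
    exists m, m, m; rewrite -mulnn in E.
    by split=> //; [lia|lia|rewrite eqxx|move=> x; lia|nia].
  rewrite -mulnn in nE.
  (* With two keys the general choice below would admit a part of size 2, which is no smaller than
     the whole. *)
  have [n2|n2] := eqVneq n 2.
    exists 2, 1, 1; rewrite n2 in sp *.
    have -> : m = 1 by nia.
    by split=> // x; lia.
  (* Between two squares, sizes [m] and [m.+1] suit [m] parts below [m * m.+1] and [m.+1] parts from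
     there on. *)
  have [h|h] := ltnP n (m * m.+1); [exists m, m, m.+1|exists m.+1, m, m.+1];
    split=> //; try nia; rewrite ?eqxx ?orbT // => x; lia.
have [parts [e s al]] := split_parts hab hk.
exists parts; split=> //; first by rewrite s.
  by apply: sub_all al => x; exact: hn.
by apply: sub_all al => x; lia.
Qed.

(** Without an outcome, executing [AllocIdeal] would count as an invalid access. *)
Lemma alloc_ideal_exists (h : heap) l : exists r h', alloc_ideal h l r h'.
Proof.
elim: {l}(size l).+1 h {-2}l (ltnSn (size l)) => // n IH h l; rewrite ltnS => le.
have [l1|l1] := ltnP 1 (size l); last first.
  case: l l1 {le} => [|[k v] []] // _; do 2!eexists; [exact: IdealEmpty|].
  exact: IdealSingle.
have [parts [e np al lt]] := ideal_parts l1.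
have [cs [h' H]] : exists cs h', alloc_ideals h parts cs h'.
  have {}lt : all (fun x => size x < n) parts.
    by apply: sub_all lt => x; lia.
  elim: parts h lt {e np al} => [|x parts IH2] h /=.
    by move=> _; exists [::], h; exact: IdealNil.
  move=> /andP [lt /IH2 H].
  have [c [h1 H1]] := IH h x lt; have [cs [h2 H2]] := H h1.
  by exists (c :: cs), h2; exact: IdealCons H1 H2.
by rewrite -e in l1 np al *; do 2!eexists; exact: IdealInner l1 np al H.
Qed.

End Heaps.

(** * Ghost state *)

(* The whereabouts of a node: not in use, the sentinel, a node that only the *)
(* given thread can access, the newTarget of a Rebuild node that is not yet  *)
(* in the tree, or a present or former content of children entry i of q.     *)
Inductive mark (p : nat) :=
| Free
| Root
| Own of 'I_p
| Res of ptr
| At of ptr & nat.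

Arguments Free {p}.
Arguments Root {p}.
Arguments Res {p}.
Arguments At {p}.

(** * The tree of present and former positions *)

Section Marks.

Variable p : nat.
Implicit Type m : ptr -> mark p.

(** [At] marks are never revised, so former children stay in this tree beside the present ones. The
    distance [k] later serves as a termination measure. *)
Inductive bel m (a : ptr) : nat -> ptr -> Prop :=
| Bel0 : bel m a 0 a
| BelS k q i x : m x = At q i -> bel m a k q -> bel m a k.+1 x.

Definition below m a x := exists k, bel m a k x.

Lemma below_refl m a : below m a a.
Proof. by exists 0; exact: Bel0. Qed.

Lemma below_step m a q i x : m x = At q i -> below m a q -> below m a x.
Proof. by move=> e [k b]; exists k.+1; exact: BelS e b. Qed.

Lemma bel_trans m a b k l x : bel m a k b -> bel m b l x -> bel m a (l + k) x.
Proof.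
move=> B; elim=> {x l} // l q i x e _ IH; rewrite addSn; exact: BelS e IH.
Qed.

Lemma below_trans m a b x : below m a b -> below m b x -> below m a x.
Proof. by move=> [k B] [l B']; exists (l + k); exact: bel_trans B'. Qed.

Lemma below_inv m a q i x : m x = At q i -> below m a x ->
  x = a \/ below m a q.
Proof.
move=> e [k B]; case: B e => [|l q' i' y e' B]; first by left.
by rewrite e' => -[<- _]; right; exists l.
Qed.

Lemma bel_root_fun m a k l x : (forall q i, m a <> At q i) ->
  bel m a k x -> bel m a l x -> k = l.
Proof.
move=> na B; elim: B l => {x k} [|k q i x e B IH] l B'.
  by case: B' na => // l' q i x e _ /(_ _ _ e).
case: B' e => [/na //|l' q' i' y e' B']; rewrite e' => -[? _]; subst q'.
by rewrite (IH _ B').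
Qed.

Lemma bel_le m m' a k x :
  (forall y q i, m y = At q i -> m' y = At q i) ->
  bel m a k x -> bel m' a k x.
Proof.
move=> le; elim=> {x k} [|k q i x e _ IH]; first exact: Bel0.
exact: BelS (le _ _ _ e) IH.
Qed.

Lemma below_le m m' a x :
  (forall y q i, m y = At q i -> m' y = At q i) ->
  below m a x -> below m' a x.
Proof. by move=> le [k B]; exists k; exact: bel_le le B. Qed.

(* path lists the nodes that lead from q, excluded, down to n. *)
Fixpoint chain m (q : ptr) (path : seq (ptr * nat)) (n : ptr) : Prop :=
  if path is (x, j) :: path' then m x = At q j /\ chain m x path' n
  else q = n.

Lemma chain_cat m q p1 p2 n :
  chain m q (p1 ++ p2) n <-> exists2 x, chain m q p1 x & chain m x p2 n.
Proof.
elim: p1 q => [|[x j] p1 IH] q /=.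
  by split=> [c|[x -> //]]; exists q.
split=> [[e /IH [y c c']]|[y [e c] c']]; first by exists y.
by split=> //; apply/IH; exists y.
Qed.

Lemma chain_rcons m q path c i :
  chain m q (rcons path (c, i)) c <-> exists2 n, chain m q path n & m c = At n i.
Proof.
rewrite -cats1; split.
  by move=> /chain_cat [y ? /= [? _]]; exists y.
by move=> [y ? ?]; apply/chain_cat; exists y.
Qed.

Lemma chain_le m m' q path n :
  (forall y q i, m y = At q i -> m' y = At q i) ->
  chain m q path n -> chain m' q path n.
Proof.
by move=> le; elim: path q => [|[x j] path IH] q //= [/le ? /IH].
Qed.

Lemma chain_bel m a path n : chain m a path n -> bel m a (size path) n.
Proof.
elim: path a => [|[x j] path IH] a /=; first by move=> ->; exact: Bel0.
move=> [e /IH B]; have := bel_trans (BelS e (Bel0 m a)) B.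
by rewrite addn1.
Qed.

Lemma chain_head_below m a path n x :
  chain m a path n -> x \in a :: unzip1 path -> below m a x.
Proof.
elim: path a => [|[z j] path IH] a.
  by rewrite inE => _ /eqP ->; exact: below_refl.
move=> [mz cz]; rewrite inE => /orP [/eqP ->|xz]; first exact: below_refl.
exact: below_trans (below_step mz (below_refl _ _)) (IH _ cz xz).
Qed.

(** A node has at most one parent, so the ancestors of [n] up to the parentless [a] are exactly the
    nodes of the path. *)
Lemma chain_below_mem m a path n x : (forall q i, m a <> At q i) ->
  chain m a path n -> below m x n -> x \in a :: unzip1 path.
Proof.
move=> na; elim/last_ind: path n => [|path [c j] IH] n.
  move=> /= <- [k B]; case: B na => [|k' q i y e _ /(_ _ _ e)] // _.
  exact: mem_head.
rewrite -cats1 => /chain_cat [y C /= [e ?]] B; subst n.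
rewrite [unzip1 _]map_cat -cat_cons mem_cat /=.
case: (below_inv e B) => [->|B']; first by rewrite mem_head orbT.
by rewrite (IH _ C B').
Qed.

End Marks.

Section Progress.

Context {d : Order.disp_t} {K : orderType d} {V : Type} {F : realType}.
Variables (rR : F) (T p : nat).
Hypotheses (hR : (0 < rR)%R) (hT : 0 < T).

Local Notation node := (node K V).
Local Notation inner := (inner K).
Local Notation heap := (@heap d K V).
Local Notation prog := (@prog d K V).
Local Notation proc := (@proc d K V).
Local Notation prim := (@prim d K V).
Local Notation thread := (@thread d K V).
Local Notation operation := (@operation d K V).
Local Notation update_op := (@update_op d K V).
Local Notation config := (@config d K V p).
Local Notation body := (@body d K V F rR T).

Lemma bind_assoc A B C (m : prog A) (f : A -> prog B) (h : B -> prog C) :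
  bind (bind m f) h = bind m (fun a => bind (f a) h).
Proof.
elim: m => [a|c k IH|f' k IH|] //.
  by congr Act; apply: funext => r; exact: IH.
by congr Call; apply: funext => r; exact: IH.
Qed.

Lemma bind_ret A (m : prog A) : bind m (@Ret d K V A) = m.
Proof.
by elim: m => [a|c k IH|f k IH|] //=; [congr Act | congr Call]; apply: funext.
Qed.

(* past x says that x has been replaced in the children entry mk x.          *)
(* wins t x counts the successful updates of thread t whose path contains x, *)
(* bumps t x those of them that have incremented x.count, inst t x the       *)
(* Rebuild nodes that t has put into the tree below x.  fin t says that the  *)
(* current update of t has already changed the tree.                         *)
Record state := St {
  hp : heap;
  mk : ptr -> mark p;
  past : ptr -> bool;
  wins : 'I_p -> ptr -> nat;
  bumps : 'I_p -> ptr -> nat;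
  inst : 'I_p -> ptr -> nat;
  fin : 'I_p -> bool
}.

Implicit Types (s : state) (t : 'I_p).

(** Death is inherited by descendants and never revoked ([mono_dead]). A dead node may still be
    visited by threads that reached it earlier, or through the target of a Rebuild node. *)
Definition dead (s : state) x := exists2 y, past s y & below (mk s) y x.

Lemma dead_past s x : past s x -> dead s x.
Proof. by exists x => //; exact: below_refl. Qed.

Lemma dead_step s q i x : mk s x = At q i -> dead s q -> dead s x.
Proof. by move=> e [y a b]; exists y => //; exact: below_step e b. Qed.

Lemma dead_below s x y : below (mk s) x y -> dead s x -> dead s y.
Proof. by move=> b [z a b']; exists z => //; exact: below_trans b. Qed.

Lemma dead_inv s q i x : mk s x = At q i -> dead s x -> past s x \/ dead s q.
Proof.
move=> e [y a b]; case: (below_inv e b) => [->|b']; first by left.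
by right; exists y.
Qed.

Definition slot (h : heap) q i : option (option ptr) :=
  obind (fun n => onth (i_children n) i) (inner_at h q).

Lemma slotP h q i c : slot h q i = Some c <->
  exists2 n, inner_at h q = Some n & onth (i_children n) i = Some c.
Proof.
rewrite /slot; case: (inner_at h q) => [n|] /=; last by split=> // -[].
by split=> [e|[n' [<-] //]]; exists n.
Qed.

(* What a helper of a Rebuild node with target u may install as newTarget. *)
Definition ideal_shape (h : heap) (u nt : ptr) : Prop :=
  exists kc, [/\ frozen h u kc, ~~ is_rebuild h nt, nt < size h &
    if kc < T then full_at h nt
    else exists2 n, inner_at h nt = Some n &
                    size (i_children n) = sqrt_floor kc].

Lemma ideal_shape_le h h' u nt : heap_le h h' ->
  ideal_shape h u nt -> ideal_shape h' u nt.
Proof.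
move=> le [kc [f nr lt fl]]; exists kc; split.
- exact: frozen_le le f.
- by rewrite (heap_le_is_rebuild le).
- exact: leq_trans le.1.
- case: ifP fl => _ => [|[n e sz]]; first exact: heap_le_full.
  have [n' e' [_ sz' _ _ _]] := heap_le_inner le e.
  by exists n' => //; rewrite sz'.
Qed.

(** [inv_status] confines marks to replaced subtrees, so a DCSS that fails at the status reveals a
    dead node. [inv_rebuild] gives a Rebuild node and its target the same position. [inv_wins] is
    the source of finiteness below the root; it exceeds the threshold by one because the last
    permitted win starts strictly below it. *)
Record invariant (s : state) : Prop := MkInv {
  inv_root : mk s 0 = Root /\ exists n, inner_at (hp s) 0 = Some n;
  inv_unique_root x : mk s x = Root -> x = 0;
  inv_alloc x : size (hp s) <= x ->
    mk s x = Free /\ forall t, wins s t x = 0 /\ bumps s t x = 0;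
  inv_past x : past s x -> exists q i, mk s x = At q i;
  inv_slot q i c : slot (hp s) q i = Some (Some c) ->
    mk s c = At q i /\ ~~ past s c;
  inv_cur q i c : mk s c = At q i ->
    exists2 c', slot (hp s) q i = Some (Some c') & past s c \/ c' = c;
  inv_wf x n : inner_at (hp s) x = Some n -> wf_inner n;
  inv_full x q i : mk s x = Root \/ mk s x = At q i -> full_at (hp s) x;
  inv_status x n : inner_at (hp s) x = Some n -> i_status n <> clean ->
    dead s x;
  inv_finished x n : inner_at (hp s) x = Some n -> (i_status n).1.2 ->
    frozen (hp s) x (i_status n).1.1;
  inv_rebuild x u nt q i : onth (hp s) x = Some (Rebuild u nt q i) ->
    [/\ exists n, inner_at (hp s) u = Some n,
        mk s u = At q i,
        forall q' i', mk s x = At q' i' ->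
          [/\ q' = q, i' = i, past s u & below (mk s) 0 x] &
        forall y, nt = Some y ->
          ideal_shape (hp s) u y /\
          (mk s y = Res x \/ mk s y = At q i /\ past s x)];
  inv_count t x n : inner_at (hp s) x = Some n -> bumps s t x <= i_count n;
  inv_wins t x n : x != 0 -> inner_at (hp s) x = Some n ->
    ((wins s t x)%:R <= rR * (i_initSize n)%:R + 1)%R;
  inv_inst t x : inst s t x <= wins s t x
}.

(** A node reserved as [newTarget] can only become attached. Nothing is required of private nodes,
    which are protected by [rely_own] instead. *)
Definition mark_le (m m' : mark p) : Prop :=
  match m with
  | At q i => m' = At q i
  | Root => m' = Root
  | Res x => m' = Res x \/ exists q i, m' = At q i
  | _ => True
  end.

Record mono (s s' : state) : Prop := MkMono {
  mono_heap : heap_le (hp s) (hp s');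
  mono_mark x : mark_le (mk s x) (mk s' x);
  mono_past x : past s x -> past s' x
}.

(* What the steps of the other threads preserve for thread t. *)
Record rely (t : 'I_p) (s s' : state) : Prop := MkRely {
  rely_mono : mono s s';
  rely_own x : mk s x = Own t -> mk s' x = Own t;
  rely_wins x : wins s' t x = wins s t x;
  rely_bumps x : bumps s' t x = bumps s t x;
  rely_inst x : inst s' t x = inst s t x;
  rely_fin : fin s' t = fin s t
}.

Coercion mono_heap : mono >-> heap_le.
Coercion rely_mono : rely >-> mono.

Lemma mono_size s s' : mono s s' -> size (hp s) <= size (hp s').
Proof. by case=> -[]. Qed.

Lemma mark_le_refl m : mark_le m m.
Proof. by case: m => //= x; left. Qed.

Lemma mark_le_trans m1 m2 m3 :
  mark_le m1 m2 -> mark_le m2 m3 -> mark_le m1 m3.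
Proof.
case: m1 => //= [-> //|x|q i -> //].
by move=> [->//|[q [i ->]] /= ->]; right; exists q, i.
Qed.

Lemma mono_refl s : mono s s.
Proof. by split=> // [|x]; [exact: heap_le_refl | exact: mark_le_refl]. Qed.

Lemma mono_trans s1 s2 s3 : mono s1 s2 -> mono s2 s3 -> mono s1 s3.
Proof.
move=> [a b c] [a' b' c']; split.
- exact: heap_le_trans a'.
- by move=> x; exact: mark_le_trans (b' x).
- by move=> x /c /c'.
Qed.

Lemma rely_refl t s : rely t s s.
Proof. by split=> //; exact: mono_refl. Qed.

Lemma rely_trans t s1 s2 s3 : rely t s1 s2 -> rely t s2 s3 -> rely t s1 s3.
Proof.
move=> [a b c d1 e f] [a' b' c' d1' e' f']; split.
- exact: mono_trans a'.
- by move=> x /b /b'.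
- by move=> x; rewrite c'.
- by move=> x; rewrite d1'.
- by move=> x; rewrite e'.
- by rewrite f'.
Qed.

Lemma mono_at s s' x q i : mono s s' -> mk s x = At q i -> mk s' x = At q i.
Proof. by move=> [_ /(_ x) h _] e; move: h; rewrite e. Qed.

Lemma mono_below s s' x y : mono s s' ->
  below (mk s) x y -> below (mk s') x y.
Proof. by move=> M; apply: below_le => z q i; exact: mono_at. Qed.

Lemma mono_dead s s' x : mono s s' -> dead s x -> dead s' x.
Proof.
move=> M [y a b]; exists y; first exact: (mono_past M).
exact: mono_below b.
Qed.

Lemma root_not_at s q i : invariant s -> mk s 0 <> At q i.
Proof. by move=> I; rewrite (inv_root I).1. Qed.

Lemma inv_allocated s x : invariant s -> mk s x <> Free -> x < size (hp s).
Proof.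
move=> I nf; rewrite ltnNge; apply/negP => le.
by case: (inv_alloc I le) => /nf.
Qed.

Lemma at_allocated s x q i : invariant s -> mk s x = At q i -> x < size (hp s).
Proof. by move=> I e; apply: inv_allocated => //; rewrite e. Qed.

Lemma inner_lt (h : heap) x n : inner_at h x = Some n -> x < size h.
Proof. by move=> /inner_atP e; exact: onth_ltn e. Qed.

(** * Ghost steps *)

Definition upd_ok s x (n n' : inner) : Prop :=
  [/\ inner_le n n', wf_inner n', i_children n' = i_children n &
      i_status n' = i_status n \/
      [/\ dead s x, i_status n' <> clean &
          ((i_status n').1.2 -> frozen (hp s) x (i_status n').1.1)]].

(* cs are private nodes that become the children of the new node. *)
Definition alloc_ok (t : 'I_p) s (nd : node) (cs : seq ptr) : Prop :=
  [/\ uniq cs, forall c, c \in cs -> mk s c = Own t /\ full_at (hp s) c &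
  [/\ forall c, c \in cs -> ~~ is_rebuild (hp s) c &
  match nd with
  | Inner n => [/\ wf_inner n, i_status n = clean &
                   i_children n = map some cs \/
                   cs = [::] /\ forall i c, onth (i_children n) i <> Some (Some c)]
  | Rebuild u nt q i =>
      [/\ cs = [::], nt = None, mk s u = At q i &
          exists n, inner_at (hp s) u = Some n]
  | _ => cs = [::]
  end]].

Definition upd1 (A : Type) (f : ptr -> A) x a : ptr -> A :=
  fun y => if y == x then a else f y.

Definition incr (f : 'I_p -> ptr -> nat) (t : 'I_p) (l : seq ptr) :
    'I_p -> ptr -> nat :=
  fun t' x => f t' x + ((t' == t) && (x \in l)).

(** The three reasons for replacing a child: an update, the installation of a Rebuild node, and its
    completion. The premises do the accounting. An update may pass only through nodes where the
    thread has no win yet or is below the threshold; an installation is paid for by a win not yet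
    spent at each node of the path; a completion changes no counter. *)
Inductive swap_kind (t : 'I_p) (s : state) (q c r : ptr) :
    ('I_p -> ptr -> nat) -> ('I_p -> ptr -> nat) -> ('I_p -> bool) -> Prop :=
| SwapUpdate path :
    chain (mk s) 0 path q ->
    (forall x n, x \in unzip1 path -> inner_at (hp s) x = Some n ->
       0 < wins s t x -> ((wins s t x)%:R < rR * (i_initSize n)%:R)%R) ->
    fin s t = false -> ~~ is_rebuild (hp s) r -> mk s r = Own t ->
    swap_kind t s q c r (incr (wins s) t (0 :: unzip1 path)) (inst s)
      (fun t' => if t' == t then true else fin s t')
| SwapInstall path nt i :
    chain (mk s) 0 path q ->
    (forall x, x \in 0 :: unzip1 path -> inst s t x < wins s t x) ->
    onth (hp s) r = Some (Rebuild c nt q i) -> mk s r = Own t ->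
    mk s c = At q i ->
    swap_kind t s q c r (wins s) (incr (inst s) t (0 :: unzip1 path)) (fin s)
| SwapComplete u i :
    onth (hp s) c = Some (Rebuild u (Some r) q i) ->
    swap_kind t s q c r (wins s) (inst s) (fin s).

Definition set_field s x n' b : state :=
  St (set_nth Empty (hp s) x (Inner n')) (mk s) (past s) (wins s) b (inst s) (fin s).

Definition push_node t s nd cs : state :=
  St (rcons (hp s) nd)
     (fun x => if x == size (hp s) then Own t
               else if x \in cs then At (size (hp s)) (index x cs)
               else mk s x)
     (past s) (wins s) (bumps s) (inst s) (fin s).

Definition attach s q i r pst w ins f : state :=
  St (@store d K V (hp s) WPtr (LChild q i) (Some r))
     (upd1 (mk s) r (At q i)) pst w (bumps s) ins f.

Definition set_newTarget s op r : state :=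
  St (@store d K V (hp s) WPtr (LNewTarget op) (Some r))
     (upd1 (mk s) r (Res op)) (past s) (wins s) (bumps s) (inst s) (fin s).

(** [GFill] demands a reserved parent: null children are filled only before the node enters the
    tree, so filling never enlarges the subtree of an attached node. *)
Inductive gstep (t : 'I_p) (s : state) : state -> Prop :=
| GField x n n' b :
    inner_at (hp s) x = Some n -> upd_ok s x n n' ->
    (forall t' y, t' != t -> b t' y = bumps s t' y) ->
    (forall t' y, b t' y <=
       bumps s t' y + (if y == x then i_count n' - i_count n else 0)) ->
    gstep t s (set_field s x n' b)
| GAlloc nd cs :
    alloc_ok t s nd cs ->
    gstep t s (push_node t s nd cs)
| GSwap q i c r n w' i' f' :
    inner_at (hp s) q = Some n -> onth (i_children n) i = Some (Some c) ->
    i_status n = clean -> full_at (hp s) r ->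
    swap_kind t s q c r w' i' f' ->
    gstep t s (attach s q i r (upd1 (past s) c true) w' i' f')
| GNewTarget op u q i r :
    onth (hp s) op = Some (Rebuild u None q i) -> mk s op = At q i ->
    mk s r = Own t -> ideal_shape (hp s) u r ->
    gstep t s (set_newTarget s op r)
| GFill q i n r x :
    inner_at (hp s) q = Some n -> onth (i_children n) i = Some None ->
    i_status n = clean -> full_at (hp s) r -> ~~ is_rebuild (hp s) r ->
    mk s r = Own t -> mk s q = Res x ->
    (0 < i -> exists k, onth (i_keys n) i.-1 = Some (Some k)) ->
    gstep t s (attach s q i r (past s) (wins s) (inst s) (fin s)).

Definition set_child (n : inner) i c : inner :=
  MkInner (i_initSize n) (i_degree n) (i_keys n)
          (set_nth None (i_children n) i c)
          (i_status n) (i_count n) (i_nextMark n).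

Lemma inner_at_set (h : heap) x n0 n y : inner_at h x = Some n0 ->
  inner_at (set_nth Empty h x (Inner n)) y =
  if y == x then Some n else inner_at h y.
Proof.
by move=> /inner_lt lt; rewrite /inner_at onth_set_nth //; case: ifP.
Qed.

Lemma onth_set_rebuild (h : heap) x n0 n y u nt q i :
  inner_at h x = Some n0 ->
  onth (set_nth Empty h x (Inner n)) y = Some (Rebuild u nt q i) ->
  onth h y = Some (Rebuild u nt q i).
Proof. by move=> /inner_lt lt; rewrite onth_set_nth //; case: ifP. Qed.

Lemma slot_set_child (h : heap) q n i c q' i' :
  inner_at h q = Some n -> i < size (i_children n) ->
  slot (set_nth Empty h q (Inner (set_child n i c))) q' i' =
  if (q' == q) && (i' == i) then Some c else slot h q' i'.
Proof.
move=> e lt; rewrite /slot (inner_at_set _ _ e).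
by case: eqP => //= ->; rewrite /set_child /= onth_set_nth // e.
Qed.

Lemma inner_le_set_child (n : inner) i c : i < size (i_children n) ->
  i_status n = clean -> inner_le n (set_child n i (Some c)).
Proof.
move=> lt st; split=> //=.
- by rewrite size_set_nth_lt.
- move=> j c' e; rewrite onth_set_nth //.
  by case: eqP => _; [exists c | exists c'].
- by split=> // [j k e|->]; [exists k | rewrite size_set_nth_lt].
Qed.

Lemma wf_set_child (n : inner) i c : i < size (i_children n) ->
  (0 < i -> exists k, onth (i_keys n) i.-1 = Some (Some k)) ->
  wf_inner n -> wf_inner (set_child n i c).
Proof.
have E1 : i_children (set_child n i c) = set_nth None (i_children n) i c by [].
move=> lt hk [a b e f]; split=> //; rewrite E1 ?size_set_nth_lt //.
move=> j c'; rewrite onth_set_nth //; case: eqP => [E _|_]; last exact: f.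
by move: hk; rewrite -E /=; apply.
Qed.

Lemma chain_mem_at (s : state) a path q x : chain (mk s) a path q ->
  x \in unzip1 path -> exists q i, mk s x = At q i.
Proof.
elim: path a => [|[y j] path IH] a //= [e c].
by rewrite inE => /orP [/eqP ->|/(IH _ c)] //; exists a, j.
Qed.

(** In a completion the Rebuild node is still current, hence its [newTarget] is still reserved and
    not yet attached. *)
Lemma swap_mark t s q i c r w' i' f' : invariant s ->
  slot (hp s) q i = Some (Some c) -> swap_kind t s q c r w' i' f' ->
  mk s r = Own t \/
  mk s r = Res c /\ ~~ is_rebuild (hp s) r /\
  exists u, onth (hp s) c = Some (Rebuild u (Some r) q i).
Proof.
move=> I sl [] //; try by left.
move=> u i0 e; right.
have [mc np] := inv_slot I sl.
have [_ _ at_c nt] := inv_rebuild I e.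
have [[kc [_ nr _ _]] [mr|[_ pc]]] := nt _ erefl; last by rewrite pc in np.
by have [_ ei _ _] := at_c _ _ mc; subst i0; split=> //; split=> //; exists u.
Qed.

Lemma gstep_mono t s s' : invariant s -> gstep t s s' -> mono s s'.
Proof.
move=> I; case.
- move=> x n n' b e [le _ _ _] _ _; split=> //=; last by move=> y; exact: mark_le_refl.
  by move/inner_atP: e => e; exact: heap_le_set e _.
- move=> nd cs [uc ow [_ _]]; split=> //=; first exact: heap_le_rcons.
  move=> x; case: eqP => [->|_]; first by rewrite (inv_alloc I (leqnn _)).1.
  by case: ifP => [/ow [-> _] //|_]; exact: mark_le_refl.
- move=> q i c r n w' i' f' e ec st fl sk; split=> /=.
  + have lt := onth_ltn ec; rewrite /update e.
    by move/inner_atP: e => e; apply: heap_le_set e _; exact: inner_le_set_child.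
  + move=> x; rewrite /upd1; case: eqP => [->|_]; last exact: mark_le_refl.
    have sl : slot (hp s) q i = Some (Some c) by apply/slotP; exists n.
    case: (swap_mark I sl sk) => [->//|[-> _]] /=.
    by right; exists q, i.
  + by move=> x; rewrite /upd1; case: ifP.
- move=> op u q i r e m mr sh; split=> //=.
  + by rewrite e; apply: heap_le_set e _.
  + move=> x; rewrite /upd1; case: eqP => [->|_]; last exact: mark_le_refl.
    by rewrite mr.
- move=> q i n r x e ec st fl nr mr mq hk; split=> //=.
  + have lt := onth_ltn ec; rewrite /update e.
    by move/inner_atP: e => e; apply: heap_le_set e _; exact: inner_le_set_child.
  + move=> y; rewrite /upd1; case: eqP => [->|_]; last exact: mark_le_refl.
    by rewrite mr.
Qed.

(** A step of [t] changes the marks of fresh nodes, of its own nodes and of reserved nodes only, and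
    the counters of [t] only. *)
Lemma gstep_rely t t' s s' : invariant s -> gstep t s s' -> t' != t -> rely t' s s'.
Proof.
move=> I G tt'; have M := gstep_mono I G.
have ne (x : ptr) (t0 : 'I_p) : mk s x = Own t' -> mk s x = Own t -> False.
  by move=> -> [E]; rewrite E eqxx in tt'.
case: G M.
- by move=> x n n' b e _ hb _ M; split=> //= y; exact: hb.
- move=> nd cs [uc ow _] M; split=> //= x mx.
  case: eqP => [E|_].
    by move: (inv_alloc I (leqnn _)).1; rewrite -E mx.
  by case: ifP => // /ow [/(ne _ t mx)].
- move=> q i c r n w' i' f' e ec st fl sk M.
  have sl : slot (hp s) q i = Some (Some c) by apply/slotP; exists n.
  split=> //=.
  + move=> x mx; rewrite /upd1; case: eqP => [E|//]; subst x.
    by case: (swap_mark I sl sk) => [/(ne _ t mx)//|[]]; rewrite mx.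
  + by case: sk => // path *; rewrite /incr (negbTE tt') addn0.
  + by case: sk => // path *; rewrite /incr (negbTE tt') addn0.
  + by case: sk => // path *; rewrite (negbTE tt').
- move=> op u q i r e m mr sh M; split=> //= x mx.
  by rewrite /upd1; case: eqP => [E|//]; subst x; case: (ne _ t mx).
- move=> q i n r x e ec st fl nr mr mq hk M; split=> //= y my.
  by rewrite /upd1; case: eqP => [E|//]; subst y; case: (ne _ t my).
Qed.

(** * Preservation of the invariant *)

Lemma field_invariant (t : 'I_p) s x n n' b :
  invariant s -> inner_at (hp s) x = Some n -> upd_ok s x n n' ->
  (forall t' y, t' != t -> b t' y = bumps s t' y) ->
  (forall t' y, b t' y <=
     bumps s t' y + (if y == x then i_count n' - i_count n else 0)) ->
  invariant (set_field s x n' b).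
Proof.
move=> I e ok bt hb; have M := gstep_mono I (GField e ok bt hb).
case: ok => le wf ch st; have lt := inner_lt e.
have H := mono_heap M; rewrite /= in H.
have E := inner_at_set n' _ e.
have S q i : slot (set_nth Empty (hp s) x (Inner n')) q i = slot (hp s) q i.
  by rewrite /slot E; case: eqP => // ->; rewrite e /= ch.
split=> /=.
- split; first by case: (inv_root I).
  rewrite E; case: ifP => _; first by exists n'.
  by case: (inv_root I).
- by eapply (inv_unique_root I).
- move=> y; rewrite size_set_nth_lt // => le1.
  have [m wb] := inv_alloc I le1; split=> // t'.
  have [w0 b0] := wb t'; split=> //; have := hb t' y.
  case: eqP => [E1|_]; first by move: lt; rewrite -E1 ltnNge le1.
  by rewrite b0; lia.
- by eapply (inv_past I).
- move=> q i c; rewrite S => sl; by eapply (inv_slot I sl).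
- move=> q i c mc; rewrite S; by eapply (inv_cur I mc).
- move=> y ny; rewrite E; case: ifP => [_ [<-] //|_]; by eapply (inv_wf I).
- move=> y q i m ny; rewrite E; case: eqP => [E1 [<-]|_]; last by eapply (inv_full I m).
  by subst y; apply: inner_le_full le _; by eapply (inv_full I m e).
- move=> y ny; rewrite E; case: eqP => [-> [<-]|_]; last by eapply (inv_status I).
  by case: st => [->|[]] //; by eapply (inv_status I e).
- move=> y ny; rewrite E; case: eqP => [-> [<-]|_ ey fy].
    case: st => [-> f|[_ _ f] /f]; last exact: frozen_le.
    by apply: frozen_le H _; by eapply (inv_finished I e f).
  by apply: frozen_le H _; by eapply (inv_finished I ey fy).
- move=> y u nt q i /(onth_set_rebuild e) ey.
  have [[nu eu] mu ma hn] := inv_rebuild I ey; split=> //.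
    by have [n1 -> _] := heap_le_inner H eu; exists n1.
  by move=> z /hn [sh mz]; split=> //; exact: ideal_shape_le sh.
- move=> t' y ny; rewrite E; have := hb t' y.
  case: eqP => [-> + [<-]|_ + ey].
    have := inv_count I t' e; case: le => _ _ _ _ [_ + _ _ _]; lia.
  by have := inv_count I t' ey; lia.
- move=> t' y ny y0; rewrite E; case: eqP => [E1 [<-]|_ ey].
    by case: le => [-> _ _ _ _]; apply: (inv_wins I) => //; rewrite E1.
  by eapply (inv_wins I).
- by eapply (inv_inst I).
Qed.

Lemma inner_at_rcons (h : heap) nd y : inner_at (rcons h nd) y =
  if y == size h then (if nd is Inner n then Some n else None)
  else inner_at h y.
Proof. by rewrite /inner_at onth_rcons; case: ifP. Qed.

Lemma alloc_invariant (t : 'I_p) s nd cs :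
  invariant s -> alloc_ok t s nd cs ->
  invariant (push_node t s nd cs).
Proof.
move=> I ok; have M := gstep_mono I (GAlloc ok).
have H := mono_heap M; rewrite /= in H.
have HM := mono_at M; rewrite /= in HM.
case: ok => uc ow [nr okn].
have ncs x : (forall t', mk s x <> Own t') -> x \in cs = false.
  by move=> h; apply/negP => /ow [/h].
have lcs x : x \in cs -> x < size (hp s).
  by move=> /ow [mx _]; apply: inv_allocated I _; rewrite mx.
have [fm wb0] := inv_alloc I (leqnn _).
have inn x n : inner_at (hp s) x = Some n -> (x == size (hp s)) = false.
  by move=> /inner_lt lt; rewrite ltn_eqF.
have npast : past s (size (hp s)) = false.
  by apply/negP => /(inv_past I) [q [i]]; rewrite fm.
split=> /=.
- have [r [n e]] := inv_root I; rewrite (inn _ _ e) ncs ?r //; split=> //.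
  by exists n; rewrite inner_at_rcons (inn _ _ e).
- move=> x; case: ifP => // _; case: ifP => // _; by eapply (inv_unique_root I).
- move=> x; rewrite size_rcons => lt.
  have [m wb] := inv_alloc I (ltnW lt); rewrite gtn_eqF //; split=> //.
  by rewrite ncs ?m.
- move=> x px; have [q [i e]] := inv_past I px; exists q, i.
  exact: HM e.
- move=> q i c; rewrite /slot inner_at_rcons; case: eqP => [->|nq].
    case: (nd) okn => //= n [_ _ [-> |[_ ne] /ne] //].
    rewrite onth_map; case ec: (onth cs i) => [c'|] //= [E]; subst c'.
    have inc : c \in cs by apply/onthP; exists i.
    rewrite ltn_eqF ?lcs // inc; split; last first.
      by apply/negP => /(inv_past I) [q' [i']]; rewrite (ow _ inc).1.
    congr At; rewrite -[X in index X](onth_nth c c cs i ec).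
    by rewrite index_uniq // (onth_ltn ec).
  by move=> /(inv_slot I) [m np]; split=> //; exact: HM.
- move=> q i c; case: ifP => // nc; case: ifP => [inc [<- <-]|_ mc].
    exists c; last by right.
    rewrite /slot inner_at_rcons eqxx; case: (nd) okn => [| | n|].
    + by move=> E; move: inc; rewrite E.
    + by move=> ? ? E; move: inc; rewrite E.
    + move=> [_ _ /=]; case=> [->|[E _]]; last by move: inc; rewrite E.
      rewrite /= onth_map onthE (nth_map c) ?index_mem //= nth_index //.
    + by move=> ? ? ? ? [E]; move: inc; rewrite E.
  have [c' sl pc] := inv_cur I mc; exists c' => //.
  rewrite /slot inner_at_rcons; case: ifP => // /eqP eq.
  by move/slotP: sl => [n /inn]; rewrite eq eqxx.
- move=> x n; rewrite inner_at_rcons; case: ifP => [_|_]; last by eapply (inv_wf I).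
  by case: (nd) okn => // n' [wf _ _] [<-].
- move=> x q i; case: eqP => [_ []//|nx].
  case: ifP => [inx _|_ m n].
    by apply: heap_le_full H (lcs _ inx) _; case: (ow _ inx).
  rewrite inner_at_rcons (introF eqP nx); by eapply (inv_full I m).
- move=> x n; rewrite inner_at_rcons; case: eqP => [->|_ e st].
    by case: (nd) okn => // n' [_ st _] [<-] /(_ st).
  by apply: (mono_dead M); by eapply (inv_status I e st).
- move=> x n; rewrite inner_at_rcons; case: eqP => [->|_ e st].
    by case: (nd) okn => // n' [_ st _] [<-]; rewrite st.
  by apply: frozen_le H _; by eapply (inv_finished I e st).
- move=> x u nt q i; rewrite onth_rcons; case: eqP => [-> [end_]|nx e].
    subst nd; case: okn => ecs nt0 mu [n e].
    split=> //; last by rewrite nt0.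
      by exists n; rewrite inner_at_rcons (inn _ _ e).
    exact: HM.
  have [[nu eu] mu ma hn] := inv_rebuild I e; split.
  + by exists nu; rewrite inner_at_rcons (inn _ _ eu).
  + exact: HM.
  + move=> q' i'; case: ifP => [inx [_ _]|_ mx].
      by have := nr _ inx; rewrite /is_rebuild e.
    have [? ? pu b] := ma _ _ mx; split=> //.
    exact: (mono_below M).
  + move=> y /hn [sh my]; split; first exact: ideal_shape_le sh.
    case: my => [my|[my px]]; last by right; split=> //; exact: HM.
    left; rewrite ncs ?my // ltn_eqF //.
    by apply: inv_allocated I _; rewrite my.
- move=> t' x n; rewrite inner_at_rcons; case: eqP => [-> _|_]; last by eapply (inv_count I).
  by case: (wb0 t') => _ ->.
- move=> t' x n x0; rewrite inner_at_rcons.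
  case: eqP => [-> _|_]; last by eapply (inv_wins I).
  by case: (wb0 t') => -> _; rewrite addr_ge0 // mulr_ge0 // ?ler0n // ltW.
- by eapply (inv_inst I).
Qed.

Lemma newtarget_invariant (t : 'I_p) s op u q i r :
  invariant s ->
  onth (hp s) op = Some (Rebuild u None q i) -> mk s op = At q i ->
  mk s r = Own t -> ideal_shape (hp s) u r ->
  invariant (set_newTarget s op r).
Proof.
move=> I e m mr sh; have M := gstep_mono I (GNewTarget e m mr sh).
have H := mono_heap M; rewrite /= e in H.
have HM := mono_at M; rewrite /= in HM.
have lt := onth_ltn e.
have E x : inner_at (set_nth Empty (hp s) op (Rebuild u (Some r) q i)) x =
           inner_at (hp s) x.
  by rewrite /inner_at onth_set_nth //; case: eqP => // ->; rewrite e.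
have S q' i' : slot (set_nth Empty (hp s) op (Rebuild u (Some r) q i)) q' i' =
               slot (hp s) q' i' by rewrite /slot E.
have npr : past s r = false.
  by apply/negP => /(inv_past I) [q' [i']]; rewrite mr.
split=> /=; rewrite ?e.
- rewrite E /upd1; have [r0 n0] := inv_root I; split=> //.
  by case: eqP => // E0; move: mr; rewrite -E0 r0.
- by move=> x; rewrite /upd1; case: eqP => // _; by eapply (inv_unique_root I).
- move=> x; rewrite size_set_nth_lt // => lex; have [mx wb] := inv_alloc I lex.
  by split=> //; rewrite /upd1; case: eqP => // E0; move: mr; rewrite -E0 mx.
- by move=> x /(inv_past I) [q' [i' ex]]; exists q', i'; exact: HM.
- by move=> q' i' c; rewrite S => /(inv_slot I) [mc np]; split=> //; exact: HM.
- move=> q' i' c; rewrite /upd1; case: eqP => // _ mc; rewrite S; by eapply (inv_cur I mc).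
- move=> x n; rewrite E; by eapply (inv_wf I).
- move=> x q' i'; rewrite /upd1; case: eqP => [_ []//|_ mx n].
  rewrite E; by eapply (inv_full I mx).
- move=> x n; rewrite E => ex st; apply: (mono_dead M).
  by eapply (inv_status I ex st).
- move=> x n; rewrite E => ex st; apply: frozen_le H _.
  by eapply (inv_finished I ex st).
- move=> x u' nt q' i' ex.
  have [nt0 ex0 hnt] : exists2 nt0, onth (hp s) x = Some (Rebuild u' nt0 q' i') &
      nt = nt0 \/ x = op /\ nt = Some r.
    move: ex; rewrite onth_set_nth //; case: eqP => [-> [<- <- <- <-]|_ ->].
      by exists None => //; right.
    by exists nt => //; left.
  have [[nu eu] mu ma hn] := inv_rebuild I ex0; split.
  + by exists nu; rewrite E.
  + exact: HM.
  + move=> q1 i1; rewrite /upd1; case: eqP => // _ /ma [? ? ? b]; split=> //.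
    exact: (mono_below M).
  + move=> y ey; case: hnt => [E0|[E0 E1]].
      rewrite E0 in ey; have [shy my] := hn _ ey; split; first exact: ideal_shape_le shy.
      case: my => [my|[my px]]; last by right; split=> //; exact: HM.
      by left; rewrite /upd1; case: eqP my => // ->; rewrite mr.
    move: ey; rewrite E1 => -[<-]; split; last by left; rewrite /upd1 eqxx E0.
    move: ex0; rewrite E0 e => -[<- _ _ _]; exact: ideal_shape_le sh.
- move=> t' x n; rewrite E; by eapply (inv_count I).
- move=> t' x n; rewrite E; by eapply (inv_wins I).
- by eapply (inv_inst I).
Qed.

Lemma fill_invariant (t : 'I_p) s q i n r x :
  invariant s ->
  inner_at (hp s) q = Some n -> onth (i_children n) i = Some None ->
  i_status n = clean -> full_at (hp s) r -> ~~ is_rebuild (hp s) r ->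
  mk s r = Own t -> mk s q = Res x ->
  (0 < i -> exists k, onth (i_keys n) i.-1 = Some (Some k)) ->
  invariant (attach s q i r (past s) (wins s) (inst s) (fin s)).
Proof.
move=> I e ec st fl nr mr mq hk.
have M := gstep_mono I (GFill e ec st fl nr mr mq hk).
have H := mono_heap M; rewrite /= /update e in H.
have HM := mono_at M; rewrite /= in HM.
have lt := inner_lt e; have lti := onth_ltn ec.
have E := inner_at_set _ _ e.
have S := slot_set_child _ _ _ e lti.
have npr : past s r = false.
  by apply/negP => /(inv_past I) [q' [i']]; rewrite mr.
have ltr : r < size (hp s) by apply: inv_allocated I _; rewrite mr.
have nslot c : slot (hp s) q i <> Some (Some c).
  by rewrite /slot e /= ec.
split=> /=; rewrite ?/update ?e.
- have [r0 [n0 e0]] := inv_root I; split.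
    by rewrite /upd1; case: eqP => // E0; move: mr; rewrite -E0 r0.
  by have [n1 -> _] := heap_le_inner H e0; exists n1.
- by move=> y; rewrite /upd1; case: eqP => // _; by eapply (inv_unique_root I).
- move=> y; rewrite size_set_nth_lt // => lex; have [mx wb] := inv_alloc I lex.
  by split=> //; rewrite /upd1; case: eqP => // E0; move: mr; rewrite -E0 mx.
- by move=> y /(inv_past I) [q' [i' ex]]; exists q', i'; exact: HM.
- move=> q' i' c; rewrite S; case: andP => [[/eqP -> /eqP ->] [<-]|_].
    by rewrite /upd1 eqxx npr.
  by move=> /(inv_slot I) [mc np]; split=> //; exact: HM.
- move=> q' i' c; rewrite /upd1; case: eqP => [-> [<- <-]|_ mc].
    by exists r; [rewrite S !eqxx | right].
  have [c' sl pc] := inv_cur I mc; exists c' => //.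
  by rewrite S; case: andP => // -[/eqP E1 /eqP E2]; move: sl; rewrite E1 E2 => /nslot.
- move=> y ny; rewrite E; case: ifP => [_ [<-]|_]; last by eapply (inv_wf I).
  by apply: wf_set_child => //; by eapply (inv_wf I e).
- move=> y q' i'; rewrite /upd1; case: eqP => [-> _|_ my].
    exact: heap_le_full H ltr fl.
  apply: heap_le_full H _ _; last by eapply (inv_full I my).
  by apply: inv_allocated I _; case: my => ->.
- move=> y ny; rewrite E; case: eqP => [-> [<-] /=|_ ey sy]; first by rewrite st.
  apply: (mono_dead M); by eapply (inv_status I ey sy).
- move=> y ny; rewrite E; case: eqP => [-> [<-] /=|_ ey sy]; first by rewrite st.
  apply: frozen_le H _; by eapply (inv_finished I ey sy).
- move=> y u nt q' i' /(onth_set_rebuild e) ey.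
  have [[nu eu] mu ma hn] := inv_rebuild I ey; split.
  + by have [n1 -> _] := heap_le_inner H eu; exists n1.
  + exact: HM.
  + move=> q1 i1; rewrite /upd1; case: eqP => [E0|_ /ma [? ? ? b]]; last first.
      by split=> //; exact: (mono_below M).
    by move: nr; rewrite /is_rebuild -E0 ey.
  + move=> z /hn [shz mz]; split; first exact: ideal_shape_le shz.
    case: mz => [mz|[mz px]]; last by right; split=> //; exact: HM.
    by left; rewrite /upd1; case: eqP mz => // ->; rewrite mr.
- move=> t' y ny; rewrite E; case: eqP => [-> [<-] /=|_]; by eapply (inv_count I).
- move=> t' y ny y0; rewrite E; case: eqP => [E1 [<-] /=|_].
    by apply: (inv_wins I) => //; rewrite E1.
  by eapply (inv_wins I).
- by eapply (inv_inst I).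
Qed.

(** The new child has no position yet, so it differs from the old one and is not past; this settles
    the clauses on entries. The premises of [swap_kind] are made for the clauses on counters. *)
Lemma swap_invariant (t : 'I_p) s q i c r n w' i' f' :
  invariant s ->
  inner_at (hp s) q = Some n -> onth (i_children n) i = Some (Some c) ->
  i_status n = clean -> full_at (hp s) r ->
  swap_kind t s q c r w' i' f' ->
  invariant (attach s q i r (upd1 (past s) c true) w' i' f').
Proof.
move=> I e ec st fl sk.
have M := gstep_mono I (GSwap e ec st fl sk).
have H := mono_heap M; rewrite /= /update e in H.
have HM := mono_at M; rewrite /= in HM.
have lt := inner_lt e; have lti := onth_ltn ec.
have E := inner_at_set _ _ e.
have S := slot_set_child _ _ _ e lti.
have sl : slot (hp s) q i = Some (Some c) by apply/slotP; exists n.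
have [mc npc] := inv_slot I sl.
have SM := swap_mark I sl sk.
have notat q1 i1 : mk s r <> At q1 i1 by case: SM => [|[]] ->.
have npr : past s r = false.
  by apply/negP => /(inv_past I) [q' [i1]]; exact: notat.
have nrc : r <> c by move=> E0; apply: (notat q i); rewrite E0.
have ltr : r < size (hp s) by apply: inv_allocated I _; case: SM => [|[]] ->.
have path_lt path : chain (mk s) 0 path q ->
    forall x, x \in 0 :: unzip1 path -> x < size (hp s).
  move=> ch x; rewrite inE => /orP [/eqP ->|/(chain_mem_at ch) [q1 [i1]]].
    by have [_ [n0 /inner_lt]] := inv_root I.
  by move=> mx; exact: at_allocated I mx.
split=> /=; rewrite ?/update ?e.
- have [r0 [n0 e0]] := inv_root I; split.
    rewrite /upd1; case: eqP => // E0; move: SM; rewrite -E0 r0.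
    by case=> [|[]].
  by have [n1 -> _] := heap_le_inner H e0; exists n1.
- by move=> y; rewrite /upd1; case: eqP => // _; by eapply (inv_unique_root I).
- move=> y; rewrite size_set_nth_lt // => ley; have [my wb] := inv_alloc I ley.
  split.
    by rewrite /upd1; case: eqP => // E0; move: ley; rewrite leqNgt E0 ltr.
  move=> t'; case: (wb t') => wy by_; split=> //.
  case: sk => // path ch _ _ _ _; rewrite /incr wy.
  case: (boolP (y \in _)) => [/(path_lt _ ch)|_]; last by rewrite andbF.
  by rewrite ltnNge ley.
- move=> y; rewrite /upd1; case: eqP => [-> _|_ /(inv_past I) [q' [j my]]].
    by exists q, i; rewrite ifN //; apply/eqP => E0; exact: nrc.
  by exists q', j; exact: HM.
- move=> q' j y; rewrite S; case: andP => [[/eqP -> /eqP ->] [<-]|nq].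
    by rewrite /upd1 eqxx npr; case: eqP.
  move=> /(inv_slot I) [my npy]; split; first exact: HM.
  rewrite /upd1; case: eqP => // E0; case: nq; move: my.
  by rewrite E0 mc => -[-> ->].
- move=> q' j y; rewrite {1}/upd1; case: eqP => [-> [<- <-]|_ my].
    by exists r; [rewrite S !eqxx | right].
  have [y' sy py] := inv_cur I my.
  rewrite S /upd1; case: andP => [[/eqP E1 /eqP E2]|_]; last first.
    by exists y' => //; case: py => [->|]; [left; case: eqP | right].
  exists r => //; left; case: eqP => // ny.
  by case: py => // E3; move: sy; rewrite E1 E2 sl E3 => -[/esym].
- move=> y ny; rewrite E; case: ifP => [_ [<-]|_]; last by eapply (inv_wf I).
  apply: wf_set_child => //; last by eapply (inv_wf I e).
  have [_ _ _ hk] := inv_wf I e.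
  by case: i ec {E S sl mc notat npr nrc SM M H HM sk lti} => // i /hk.
- move=> y q' j; rewrite /upd1; case: eqP => [-> _|_ my].
    exact: heap_le_full H ltr fl.
  apply: heap_le_full H _ _; last by eapply (inv_full I my).
  by apply: inv_allocated I _; case: my => ->.
- move=> y ny; rewrite E; case: eqP => [-> [<-] /=|_ ey sy]; first by rewrite st.
  apply: (mono_dead M); by eapply (inv_status I ey sy).
- move=> y ny; rewrite E; case: eqP => [-> [<-] /=|_ ey sy]; first by rewrite st.
  apply: frozen_le H _; by eapply (inv_finished I ey sy).
- move=> y u nt q' j /(onth_set_rebuild e) ey.
  have [[nu eu] mu ma hn] := inv_rebuild I ey; split.
  + by have [n1 -> _] := heap_le_inner H eu; exists n1.
  + exact: HM.
  + move=> q1 i1; rewrite {1}/upd1; case: eqP => [E0|_ /ma [? ? pu b]]; last first.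
      split=> //; last exact: (mono_below M).
      exact: (mono_past M).
    have ry : is_rebuild (hp s) r by rewrite /is_rebuild -E0 ey.
    case=> <- <-.
    case: sk M {SM} => [path _ _ _ nrr _|path nt' j' ch _ er _ mc'|u' j' ec'] M.
    * by rewrite ry in nrr.
    * move: er; rewrite -E0 ey => -[? _ ? ?]; subst u q' j'.
      move: mc'; rewrite mc => -[?]; subst j.
      split=> //; first by rewrite /upd1 eqxx.
      apply: (@below_step _ _ _ q i); first by rewrite E0 /upd1 eqxx.
      by rewrite E0; apply: (mono_below M); exists (size path); exact: chain_bel.
    * have [_ _ _ /(_ _ erefl) [[kc [_ nrr _ _]] _]] := inv_rebuild I ec'.
      by rewrite ry in nrr.
  + move=> z ez; have [shz mz] := hn _ ez; split; first exact: ideal_shape_le shz.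
    case: mz => [mz|[mz px]]; last first.
      by right; split; [exact: HM | exact: (mono_past M)].
    (* The reserved node gets attached in the very step in which the Rebuild node that reserves it
       becomes past. *)
    rewrite /upd1; case: eqP => [E0|_]; last by left.
    right; move: SM; rewrite -E0 mz => -[//|[[E1] [_ [u' ec']]]].
    by move: ey; rewrite E1 ec' => -[_ _ -> ->]; rewrite eqxx.
- move=> t' y ny; rewrite E; case: eqP => [-> [<-] /=|_]; by eapply (inv_count I).
- move=> t' y ny y0; rewrite E => ey.
  have {ny ey}[ny' ey <-] : exists2 ny', inner_at (hp s) y = Some ny' &
      i_initSize ny' = i_initSize ny.
    by move: ey; case: eqP => [-> [<-]|_]; [exists n | exists ny].
  case: sk => [path ch hw _ _ _|path nt' j' *|*]; [|by eapply (inv_wins I _ y0 ey)..].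
  rewrite /incr; case: eqP => [->|_]; last by rewrite addn0; by eapply (inv_wins I _ y0 ey).
  (* A win at [y] starts from zero or from less than [rR * initSize]; in both cases one more stays
     within the bound. *)
  rewrite inE (negbTE y0) /=; case: (boolP (y \in _)) => iny.
    rewrite natrD lerD2r; case: (posnP (wins s t y)) => [->|/(hw _ _ iny ey)/ltW //].
    by rewrite mulr_ge0 // ?ler0n // ltW.
  by rewrite addn0; by eapply (inv_wins I _ y0 ey).
- move=> t' y; case: sk => [path *|path nt' j' _ hi *|*]; rewrite ?/incr.
  + by apply: leq_trans (inv_inst I _ _) _; rewrite leq_addr.
  + case: (boolP ((t' == t) && (y \in 0 :: unzip1 path))) => [/andP[/eqP -> /hi]|_].
      by rewrite addn1.
    by rewrite addn0; by eapply (inv_inst I).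
  + by eapply (inv_inst I).
Qed.

Lemma gstep_invariant (t : 'I_p) s s' : invariant s -> gstep t s s' -> invariant s'.
Proof.
move=> I; case.
- by move=> *; eapply field_invariant; eassumption.
- by move=> *; eapply alloc_invariant; eassumption.
- by move=> *; eapply swap_invariant; eassumption.
- by move=> *; eapply newtarget_invariant; eassumption.
- by move=> *; eapply fill_invariant; eassumption.
Qed.

(** One primitive may need many ghost steps, as [AllocIdeal] creates a whole tree, or none, as a
    read does. *)
Inductive gsteps t : state -> state -> Prop :=
| GRefl s : gsteps t s s
| GTrans s1 s2 s3 : gstep t s1 s2 -> gsteps t s2 s3 -> gsteps t s1 s3.

Lemma gsteps1 t s s' : gstep t s s' -> gsteps t s s'.
Proof. by move=> G; apply: GTrans G (GRefl _ _). Qed.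

Lemma gsteps_trans t s1 s2 s3 :
  gsteps t s1 s2 -> gsteps t s2 s3 -> gsteps t s1 s3.
Proof.
by move=> G; elim: G s3 => // a b c G _ IH s3 /IH; exact: GTrans.
Qed.

Lemma gsteps_invariant t s s' : invariant s -> gsteps t s s' -> invariant s'.
Proof.
move=> I G; elim: G I => // a b c G _ IH I.
by apply: IH; exact: (gstep_invariant I G).
Qed.

Lemma gsteps_mono t s s' : invariant s -> gsteps t s s' -> mono s s'.
Proof.
move=> I G; elim: G I => [a _|a b c G _ IH I]; first exact: mono_refl.
exact: mono_trans (gstep_mono I G) (IH (gstep_invariant I G)).
Qed.

Lemma gsteps_rely t t' s s' : invariant s -> gsteps t s s' -> t' != t ->
  rely t' s s'.
Proof.
move=> I G ne; elim: G I => [a _|a b c G _ IH I]; first exact: rely_refl.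
exact: rely_trans (gstep_rely I G ne) (IH (gstep_invariant I G)).
Qed.

(* A node that is attached to the tree, or was so in the past. *)
Definition att s x := exists q i, mk s x = At q i.

Lemma att_mono s s' x : mono s s' -> att s x -> att s' x.
Proof. by move=> M [q [i e]]; exists q, i; exact: mono_at M e. Qed.

Lemma dead_att s x : invariant s -> dead s x -> att s x.
Proof.
move=> I [y py [k b]]; case: b => [|k' q i z e _]; last by exists q, i.
exact: (inv_past I py).
Qed.

Lemma dead_cases s x : dead s x ->
  past s x \/ exists q i, mk s x = At q i /\ dead s q.
Proof.
move=> [y py [k b]]; case: b => [|k' q i z e b]; first by left.
by right; exists q, i; split=> //; exists y => //; exists k'.
Qed.

Lemma root_not_dead s : invariant s -> ~ dead s 0.
Proof. by move=> I /(dead_att I) [q [i e]]; case: (root_not_at I e). Qed.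

Lemma inner_att_full s x n : invariant s -> x = 0 \/ att s x ->
  inner_at (hp s) x = Some n -> full n.
Proof.
move=> I [->|[q [i m]]] e.
  exact: (inv_full (q := 0) (i := 0) I (or_introl (inv_root I).1) e).
exact: (inv_full I (or_intror m) e).
Qed.

(** * Ghost steps that match the primitives *)

Lemma step_field t s x n n' :
  invariant s -> inner_at (hp s) x = Some n -> upd_ok s x n n' ->
  i_count n' = i_count n ->
  exists s', [/\ hp s' = set_nth Empty (hp s) x (Inner n'), gsteps t s s' &
                 rely t s s'].
Proof.
move=> I e ok cnt.
have G : gstep t s (set_field s x n' (bumps s)).
  by apply: (GField e ok) => // t' y; exact: leq_addr.
eexists; split; [|exact: gsteps1 G|] => //.
by split=> //; exact: gstep_mono I G.
Qed.

Lemma step_status t s u n st :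
  invariant s -> inner_at (hp s) u = Some n -> dead s u -> st <> clean ->
  (st.1.2 -> frozen (hp s) u st.1.1) ->
  exists s', [/\ hp s' = @store d K V (hp s) WStatus (LStatus u) st,
                 gsteps t s s' & rely t s s'].
Proof.
move=> I e dd ns fr; rewrite /= /update e; apply: (step_field _ I e) => //.
split=> //; last by right.
  split=> //; [by move=> i c ec; exists c | split=> // i k ek; by exists k].
by case: (inv_wf I e).
Qed.

Lemma step_nextMark t s u n v :
  invariant s -> inner_at (hp s) u = Some n -> i_nextMark n <= v ->
  exists s', [/\ hp s' = @store d K V (hp s) WNat (LNextMark u) v,
                 gsteps t s s' & rely t s s'].
Proof.
move=> I e le; rewrite /= /update e; apply: (step_field _ I e) => //.
split=> //; last by left.
  by split=> // [i c ec|]; [exists c | split=> // i k ek; exists k].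
by case: (inv_wf I e).
Qed.

Lemma step_degree t s u n v :
  invariant s -> inner_at (hp s) u = Some n -> i_degree n <= v ->
  v <= size (i_children n) ->
  exists s', [/\ hp s' = @store d K V (hp s) WNat (LDegree u) v,
                 gsteps t s s' & rely t s s'].
Proof.
move=> I e le le'; rewrite /= /update e; apply: (step_field _ I e) => //.
have [wf1 wf2 wf3 wf4] := inv_wf I e.
split=> //; last by left.
split=> // [i c ec|]; first by exists c.
split=> //= [i k ek|E]; first by exists k.
by apply/eqP; rewrite eqn_leq le' -{1}E.
Qed.

Lemma step_key t s u n j k :
  invariant s -> inner_at (hp s) u = Some n -> j < size (i_keys n) ->
  exists s', [/\ hp s' = @store d K V (hp s) WKey (LKey u j) (Some k),
                 gsteps t s s' & rely t s s'].
Proof.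
move=> I e lt; rewrite /= /update e; apply: (step_field _ I e) => //.
have [wf1 wf2 wf3 wf4] := inv_wf I e.
split=> //; last by left.
- split=> // [i c ec|]; first by exists c.
  split=> //= i k' ek; rewrite onth_set_nth //.
  by case: eqP => _; [exists k | exists k'].
- split=> //=; first by rewrite size_set_nth_lt.
  move=> i c /wf4 [k' ek]; rewrite onth_set_nth //.
  by case: eqP => _; [exists k | exists k'].
Qed.

(** The counter [bumps] of [t] itself changes, so the exact effect is reported in place of
    [rely]. *)
Lemma step_count t s u n :
  invariant s -> inner_at (hp s) u = Some n ->
  exists s', [/\ hp s' = @store d K V (hp s) WNat (LCount u) (i_count n + 1),
    gsteps t s s', mk s' = mk s &
    [/\ past s' = past s, wins s' = wins s, inst s' = inst s, fin s' = fin s &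
        forall x, bumps s' t x = bumps s t x + (x == u)]].
Proof.
move=> I e; rewrite /= /update e.
set n' := MkInner _ _ _ _ _ _ _.
pose b t' x := bumps s t' x + ((t' == t) && (x == u)).
have G : gstep t s (set_field s u n' b).
  apply: (GField e).
  - split=> //; last by left.
      split=> //; first by move=> i c ec; exists c.
      by split=> //= [i k ek|]; [exists k | rewrite leq_addr].
    by case: (inv_wf I e).
  - by move=> t' y /negbTE ne; rewrite /b ne addn0.
  - move=> t' y; rewrite /b /= leq_add2l; case: (y == u); last by rewrite andbF.
    by rewrite addKn andbT leq_b1.
eexists; split; [|exact: gsteps1 G| |split] => //=.
by move=> x; rewrite /b eqxx.
Qed.

Lemma step_alloc t s nd :
  invariant s -> alloc_ok t s nd [::] ->
  exists s', [/\ hp s' = rcons (hp s) nd, gsteps t s s', rely t s s' &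
                 mk s' (size (hp s)) = Own t].
Proof.
move=> I ok; have G := GAlloc ok.
eexists; split; [|exact: gsteps1 G| |] => //=; last by rewrite eqxx.
split=> //=; first exact: gstep_mono I G.
by move=> x e; case: eqP.
Qed.

Lemma step_alloc_children t s n cs :
  invariant s -> uniq cs ->
  (forall c, c \in cs -> [/\ mk s c = Own t, full_at (hp s) c &
                             ~~ is_rebuild (hp s) c]) ->
  wf_inner n -> i_status n = clean -> i_children n = map some cs ->
  exists s', [/\ hp s' = rcons (hp s) (Inner n), gsteps t s s', mono s s',
                 mk s' (size (hp s)) = Own t &
    [/\ forall x, x \notin cs -> mk s x = Own t -> mk s' x = Own t,
        wins s' = wins s, bumps s' = bumps s, inst s' = inst s &
        fin s' = fin s]].
Proof.
move=> I uc hc wf st ch.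
have ok : alloc_ok t s (Inner n) cs.
  split=> //; first by move=> c /hc [].
  by split=> [c /hc []|] //; split=> //; left.
have G := GAlloc ok.
eexists; split; [|exact: gsteps1 G|exact: gstep_mono I G| |split] => //=.
  by rewrite eqxx.
by move=> x /negbTE -> mx; case: ifP.
Qed.

Scheme alloc_ideal_ind2 := Induction for alloc_ideal Sort Prop
  with alloc_ideals_ind2 := Induction for alloc_ideals Sort Prop.

Definition new_ideal t s s' (r : ptr) :=
  [/\ gsteps t s s', rely t s s', size (hp s) <= r &
      [/\ mk s' r = Own t, full_at (hp s') r & ~~ is_rebuild (hp s') r]].

Definition new_ideals t s s' (cs : seq ptr) :=
  [/\ gsteps t s s', rely t s s', uniq cs &
      forall c, c \in cs -> [/\ size (hp s) <= c, mk s' c = Own t,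
        full_at (hp s') c & ~~ is_rebuild (hp s') c]].

(** The tree is allocated bottom-up, each parent adopting private roots. These are all newer than
    [s], so [t] gives away no node that it owned in [s]. *)
Lemma new_ideal_alloc t (h : heap) l r h' : alloc_ideal h l r h' ->
  forall s, invariant s -> hp s = h ->
  exists2 s', hp s' = h' & new_ideal t s s' r.
Proof.
move: h l r h'.
apply: (alloc_ideal_ind2
  (P := fun h l r h' _ => forall s, invariant s -> hp s = h ->
        exists2 s', hp s' = h' & new_ideal t s s' r)
  (P0 := fun h ls cs h' _ => forall s, invariant s -> hp s = h ->
        exists2 s', hp s' = h' & new_ideals t s s' cs)).
- move=> h s I <-.
  have [|s' [e G R m]] := @step_alloc t s Empty I; first by split.
  exists s' => //; split=> //; split=> //; last first.
    by rewrite /is_rebuild e onth_rcons eqxx.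
  by move=> n; rewrite e inner_at_rcons eqxx.
- move=> h k v s I <-.
  have [|s' [e G R m]] := @step_alloc t s (Single k v) I; first by split.
  exists s' => //; split=> //; split=> //; last first.
    by rewrite /is_rebuild e onth_rcons eqxx.
  by move=> n; rewrite e inner_at_rcons eqxx.
- move=> h parts cs h' n n1 np al H IH s I eh.
  have [s1 e1 [G1 R1 uc hc]] := IH s I eh.
  have I1 := gsteps_invariant I G1.
  have n0 : 0 < n by apply: ltnW.
  have [wf fl] := wf_new_ideal n0 (alloc_ideals_size H) (near_sqrt_gt0 n0 np) al.
  have [|s2 [e2 G2 M2 m2 [ow w2 b2 i2 f2]]] :=
    @step_alloc_children t s1 _ cs I1 uc _ wf erefl erefl.
    by move=> c /hc [].
  exists s2; first by rewrite e2 e1.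
  split; [exact: gsteps_trans G2| | |split].
  + have [Ma Mb Mc Md Me Mf] := R1; split.
    * exact: mono_trans M2.
    * move=> x mx; apply: ow; last exact: Mb.
      apply/negP => /hc [le _ _ _].
      by case: (inv_alloc I le); rewrite mx.
    * by move=> x; rewrite w2.
    * by move=> x; rewrite b2.
    * by move=> x; rewrite i2.
    * by rewrite f2.
  + by rewrite -e1; exact: mono_size R1.
  + by rewrite -e1.
  + by move=> nn; rewrite e2 inner_at_rcons -e1 eqxx => -[<-].
  + by rewrite /is_rebuild e2 onth_rcons -e1 eqxx.
- by move=> h s I <-; exists s => //; split=> //; [exact: GRefl|exact: rely_refl].
- move=> h l parts c cs h1 h2 H1 IH1 H2 IH2 s I eh.
  have [s1 e1 [G1 R1 le1 [o1 f1 r1]]] := IH1 s I eh.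
  have I1 := gsteps_invariant I G1.
  have [s2 e2 [G2 R2 uc hc]] := IH2 s1 I1 e1.
  have lt1 : c < size (hp s1) by apply: inv_allocated I1 _; rewrite o1.
  have le2 := mono_heap R2.
  exists s2 => //; split.
  + exact: gsteps_trans G2.
  + exact: rely_trans R2.
  + rewrite /= uc andbT; apply/negP => /hc [].
    by rewrite leqNgt lt1.
  + move=> x; rewrite inE => /orP [/eqP ->|/hc [lex ox fx rx]].
      split=> //; [exact: (rely_own R2) | exact: heap_le_full le2 lt1 f1 |].
      by rewrite (heap_le_is_rebuild le2 lt1).
    split=> //; apply: leq_trans lex.
    exact: mono_size R1.
Qed.

Lemma step_update t s q i c r n path :
  invariant s ->
  inner_at (hp s) q = Some n -> onth (i_children n) i = Some (Some c) ->
  i_status n = clean -> full_at (hp s) r -> ~~ is_rebuild (hp s) r ->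
  mk s r = Own t -> chain (mk s) 0 path q ->
  (forall x n, x \in unzip1 path -> inner_at (hp s) x = Some n ->
     0 < wins s t x -> ((wins s t x)%:R < rR * (i_initSize n)%:R)%R) ->
  fin s t = false ->
  exists s', [/\ hp s' = @store d K V (hp s) WPtr (LChild q i) (Some r),
    gsteps t s s', mono s s', bumps s' = bumps s &
    inst s' = inst s /\
    forall x, wins s' t x = wins s t x + (x \in 0 :: unzip1 path)].
Proof.
move=> I e ec st fl nr mr ch hw hf.
have sk := SwapUpdate c ch hw hf nr mr.
have G := GSwap e ec st fl sk.
eexists; split; [|exact: gsteps1 G|exact: gstep_mono I G| |split] => //= x.
by rewrite /incr eqxx.
Qed.

Lemma step_install t s q i c op nt n path :
  invariant s ->
  inner_at (hp s) q = Some n -> onth (i_children n) i = Some (Some c) ->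
  i_status n = clean -> onth (hp s) op = Some (Rebuild c nt q i) ->
  mk s op = Own t -> chain (mk s) 0 path q ->
  (forall x, x \in 0 :: unzip1 path -> inst s t x < wins s t x) ->
  exists s', [/\ hp s' = @store d K V (hp s) WPtr (LChild q i) (Some op),
    gsteps t s s', mono s s', past s' c &
    [/\ mk s' op = At q i, wins s' = wins s & bumps s' = bumps s]].
Proof.
move=> I e ec st eop mop ch hi.
have [mc _] : mk s c = At q i /\ ~~ past s c.
  by apply: (inv_slot I); apply/slotP; exists n.
have sk := SwapInstall ch hi eop mop mc.
have fl : full_at (hp s) op by move=> n' /inner_atP; rewrite eop.
have G := GSwap e ec st fl sk.
eexists; split; [|exact: gsteps1 G|exact: gstep_mono I G| |split] => //=.
  by rewrite /upd1 eqxx.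
by rewrite /upd1 eqxx.
Qed.

Lemma step_complete t s q i op u r n :
  invariant s ->
  inner_at (hp s) q = Some n -> onth (i_children n) i = Some (Some op) ->
  i_status n = clean -> onth (hp s) op = Some (Rebuild u (Some r) q i) ->
  full_at (hp s) r ->
  exists s', [/\ hp s' = @store d K V (hp s) WPtr (LChild q i) (Some r),
    gsteps t s s' & rely t s s'].
Proof.
move=> I e ec st eop fl.
have sk := SwapComplete t eop.
have G := GSwap e ec st fl sk.
have sl : slot (hp s) q i = Some (Some op) by apply/slotP; exists n.
have mr : mk s r = Res op.
  have [mop np] := inv_slot I sl.
  have [_ _ _ /(_ _ erefl) [_ [//|[_ pop]]]] := inv_rebuild I eop.
  by rewrite pop in np.
eexists; split; [|exact: gsteps1 G|] => //=.
split=> //=; first exact: gstep_mono I G.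
by move=> x; rewrite /upd1; case: eqP => // ->; rewrite mr.
Qed.

(** [rely] from [s0] protects only nodes owned in [s0]; publishing a node created later is invisible
    to it. *)
Lemma rely_new t s0 s s' r : invariant s0 -> rely t s0 s -> mono s s' ->
  size (hp s0) <= r ->
  (forall x, x != r -> mk s x = Own t -> mk s' x = Own t) ->
  [/\ wins s' = wins s, bumps s' = bumps s, inst s' = inst s & fin s' = fin s] ->
  rely t s0 s'.
Proof.
move=> I [M ow w b i f] M' le hx [ew eb ei ef].
split=> [|x mx|x|x|x|]; rewrite ?ew ?eb ?ei ?ef //.
  exact: mono_trans M'.
apply: hx; last exact: ow.
apply/eqP => E; subst x; by case: (inv_alloc I le); rewrite mx.
Qed.

Lemma step_newTarget t s0 s op u q i r :
  invariant s0 -> rely t s0 s -> size (hp s0) <= r ->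
  invariant s -> onth (hp s) op = Some (Rebuild u None q i) ->
  mk s op = At q i -> mk s r = Own t -> ideal_shape (hp s) u r ->
  exists s', [/\ hp s' = @store d K V (hp s) WPtr (LNewTarget op) (Some r),
    gsteps t s s' & rely t s0 s'].
Proof.
move=> I0 R le I e m mr sh.
have G := GNewTarget e m mr sh.
eexists; split; [|exact: gsteps1 G|] => //=.
apply: (rely_new I0 R (gstep_mono I G) le) => //= x ne mx.
by rewrite /upd1 (negbTE ne).
Qed.

Lemma step_fill t s0 s q i n r x :
  invariant s0 -> rely t s0 s -> size (hp s0) <= r ->
  invariant s -> inner_at (hp s) q = Some n ->
  onth (i_children n) i = Some None ->
  i_status n = clean -> full_at (hp s) r -> ~~ is_rebuild (hp s) r ->
  mk s r = Own t -> mk s q = Res x ->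
  (0 < i -> exists k, onth (i_keys n) i.-1 = Some (Some k)) ->
  exists s', [/\ hp s' = @store d K V (hp s) WPtr (LChild q i) (Some r),
    gsteps t s s' & rely t s0 s'].
Proof.
move=> I0 R le I e ec st fl nr mr mq hk.
have G := GFill e ec st fl nr mr mq hk.
eexists; split; [|exact: gsteps1 G|] => //=.
apply: (rely_new I0 R (gstep_mono I G) le) => //= y ne my.
by rewrite /upd1 (negbTE ne).
Qed.

(** * Rely-guarantee logic *)

(* Between two updates, t has rebuilt every node for which it has counted    *)
(* enough updates; such a node is no longer reachable from the root.         *)
Definition ready t s :=
  (forall x n, x != 0 -> inner_at (hp s) x = Some n -> 0 < wins s t x ->
     (rR * (i_initSize n)%:R <= (wins s t x)%:R)%R -> dead s x) /\
  (forall x, x != 0 -> wins s t x <= bumps s t x).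

(** A node with a win of [t] was allocated in [s] already, so its threshold can be compared across
    interference. *)
Lemma wins_inner t s s' x n : invariant s -> rely t s s' ->
  0 < wins s' t x -> inner_at (hp s') x = Some n ->
  exists2 n0, inner_at (hp s) x = Some n0 & i_initSize n0 = i_initSize n.
Proof.
move=> I R; rewrite (rely_wins R) => w0.
have lt : x < size (hp s).
  rewrite ltnNge; apply/negP => le; case: (inv_alloc I le) => _ /(_ t) [E _].
  by rewrite E in w0.
move=> /(heap_le_inner_inv R lt) [n0 e [E _ _ _ _]].
by exists n0.
Qed.

Lemma ready_rely t s s' : invariant s -> rely t s s' -> ready t s -> ready t s'.
Proof.
move=> I R [h1 h2]; split=> [x n x0 e w0|x].
  have [n0 e0 <-] := wins_inner I R w0 e; rewrite (rely_wins R) in w0 *.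
  move=> le; apply: (mono_dead R); exact: h1 e0 w0 le.
by rewrite (rely_wins R) (rely_bumps R); exact: h2.
Qed.

(* D contains the nodes that were dead when the update last started from the *)
(* root; as the nodes of path have been read afterwards, none is in D.       *)
Definition walking t s (n : ptr) (path : seq (ptr * nat)) :=
  [/\ chain (mk s) 0 path n, exists nn, inner_at (hp s) n = Some nn,
      forall x, x \in unzip1 path -> exists nx, inner_at (hp s) x = Some nx,
      fin s t = false &
  [/\ forall x, x != 0 -> wins s t x <= bumps s t x &
  exists D : ptr -> Prop,
   [/\ forall x, D x -> dead s x,
       forall x n, x != 0 -> inner_at (hp s) x = Some n -> 0 < wins s t x ->
         (rR * (i_initSize n)%:R <= (wins s t x)%:R)%R -> D x,
       forall x, D x -> past s x \/ exists q i, mk s x = At q i /\ D q &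
       forall x, x \in 0 :: unzip1 path -> ~ D x]]].

Lemma ready_walking t s : invariant s -> ready t s -> fin s t = false ->
  walking t s 0 [::].
Proof.
move=> I [h1 h2] f0; split=> //; first by case: (inv_root I).
split=> //; exists (dead s); split=> //; first by move=> x /dead_cases.
by move=> x; rewrite inE => /eqP ->; exact: root_not_dead I.
Qed.

Lemma walking_rely t s s' n path : invariant s -> rely t s s' ->
  walking t s n path -> walking t s' n path.
Proof.
move=> I R [ch [nn en] hi hf [wb [D [h0 h1 h2 h3]]]].
have M := rely_mono R; have H := mono_heap M.
split.
- by apply: chain_le ch => y q i; exact: mono_at.
- by have [n' e' _] := heap_le_inner H en; exists n'.
- by move=> x /hi [nx ex]; have [n' e' _] := heap_le_inner H ex; exists n'.
- by rewrite (rely_fin R).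
- split=> [x|]; first by rewrite (rely_wins R) (rely_bumps R); exact: wb.
  exists D; split=> // [x /h0|x m x0 e w0|x /h2 [px|[q [i [mx Dq]]]]].
  + exact: mono_dead.
  + have [n0 e0 <-] := wins_inner I R w0 e; rewrite (rely_wins R) in w0 *.
    exact: h1.
  + by left; exact: (mono_past M).
  + by right; exists q, i; split=> //; exact: mono_at M mx.
Qed.

(** A node of [D] is past or has its parent in [D]. The child just read is current, hence not past,
    and its parent lies on the path, hence outside [D]. *)
Lemma walking_step t s n path i c nc : invariant s -> walking t s n path ->
  slot (hp s) n i = Some (Some c) -> inner_at (hp s) c = Some nc ->
  walking t s c (rcons path (c, i)).
Proof.
move=> I [ch [nn en] hi hf [wb [D [h0 h1 h2 h3]]]] sl ec.
have [mc np] := inv_slot I sl.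
split=> //.
- by apply/chain_rcons; exists n.
- by exists nc.
- move=> x; rewrite /unzip1 map_rcons mem_rcons inE => /orP [/eqP ->|/hi//].
  by exists nc.
- split=> //; exists D; split=> // x.
  rewrite /unzip1 map_rcons -rcons_cons mem_rcons inE => /orP [/eqP ->|/h3//].
  move=> /h2 [pc|[q [j [mc' Dq]]]]; first by rewrite pc in np.
  move: mc'; rewrite mc => -[? _]; subst q.
  apply: h3 Dq; apply: chain_below_mem ch (below_refl _ _) => q' j'.
  exact: (root_not_at I).
Qed.

Definition building s (op : ptr) kc (nt : ptr) :=
  T <= kc /\ exists u q i,
    [/\ onth (hp s) op = Some (Rebuild u (Some nt) q i), mk s op = At q i &
        frozen (hp s) u kc].

Lemma building_mono s s' op kc nt : mono s s' ->
  building s op kc nt -> building s' op kc nt.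
Proof.
move=> M [le [u [q [i [e m f]]]]]; split=> //; exists u, q, i.
have [nt' e' /(_ _ erefl) E] := heap_le_rebuild M e; subst nt'.
split=> //; first exact: mono_at M m.
exact: frozen_le M f.
Qed.

Lemma building_inner s op kc nt : invariant s -> building s op kc nt ->
  exists2 n, inner_at (hp s) nt = Some n &
    size (i_children n) = sqrt_floor kc /\
    (mk s nt = Res op \/ att s nt).
Proof.
move=> I [le [u [q [i [e m f]]]]].
have [_ _ _ /(_ _ erefl) [[kc' [f' _ _ sh]] mnt]] := inv_rebuild I e.
move: sh; rewrite -(frozen_fun f f') ltnNge le /= => -[n en sz].
exists n => //; split=> //.
by case: mnt => [->|[mnt _]]; [left | right; exists q, i].
Qed.

(** A lookup may run through dead nodes, whereas marking and counting presuppose them, since only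
    dead nodes may be marked. *)
Definition pre t (f : proc) s : Prop :=
  match f with
  | PUpdate _ n path => walking t s n path
  | PLookup _ n => n = 0 \/ att s n
  | PMCC u => dead s u
  | PMark u deg => dead s u /\
      exists2 n, inner_at (hp s) u = Some n & deg <= size (i_children n)
  | PFill op kc nt => building s op kc nt
  | PCollect u => exists k, frozen (hp s) u k
  end.

(** An update changes the counters of its own thread, so it promises [mono] and [ready] instead of
    [rely]. *)
Definition post t (f : proc) s0 s : proc_result f -> Prop :=
  match f return proc_result f -> Prop with
  | PUpdate _ _ _ => fun _ => mono s0 s /\ ready t s
  | PLookup _ _ => fun _ => rely t s0 s
  | PMCC u => fun r => rely t s0 s /\ frozen (hp s) u r
  | PMark _ _ => fun _ => rely t s0 s
  | PFill _ _ nt => fun go => rely t s0 s /\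
      (if go then exists2 n, inner_at (hp s) nt = Some n &
                             i_degree n = size (i_children n)
       else full_at (hp s) nt)
  | PCollect u => fun l => rely t s0 s /\ frozen (hp s) u (size l)
  end.

Lemma pre_rely t f s s' : invariant s -> rely t s s' -> pre t f s -> pre t f s'.
Proof.
move=> I R; have M := rely_mono R; have H := mono_heap M.
case: f => [u n path|k n|u|u deg|op kc nt|u] /=.
- exact: walking_rely.
- by move=> [->|a]; [left | right; exact: att_mono M a].
- exact: mono_dead.
- move=> [dd [n e le]]; split; first exact: mono_dead dd.
  have [n' e' [_ sz _ _ _]] := heap_le_inner H e.
  by exists n' => //; rewrite sz.
- exact: building_mono.
- by move=> [k f]; exists k; exact: frozen_le f.
Qed.

Lemma post_mono t f s s' r : @post t f s s' r -> mono s s'.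
Proof.
by case: f r => [u n path|k n|u|u deg|op kc nt|u] r /= => [[]|/rely_mono|
  [/rely_mono]|/rely_mono|[/rely_mono]|[/rely_mono]].
Qed.

(* Thread t, running m from s on, interleaved with steps of the other        *)
(* threads, maintains the invariant, never crashes and establishes Q.        *)
Fixpoint wp t A (m : prog A) (Q : state -> A -> Prop) s : Prop :=
  match m with
  | Ret a => Q s a
  | Act c k => forall s1, rely t s s1 -> invariant s1 ->
      (exists r h', @prim_step d K V (hp s1) c r h') /\
      forall r h', prim_step (hp s1) r h' ->
        exists s2, [/\ hp s2 = h', gsteps t s1 s2 & wp t (k r) Q s2]
  | Call f k => forall s1, rely t s s1 -> invariant s1 ->
      pre t f s1 /\
      forall s2 r, invariant s2 -> @post t f s1 s2 r -> wp t (k r) Q s2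
  | Crash => False
  end.

Lemma wp_bind t A B (m : prog A) (g : A -> prog B) Q s :
  wp t m (fun s' a => wp t (g a) Q s') s -> wp t (bind m g) Q s.
Proof.
elim: m s => [a|c k IH|f k IH|] s //= H s1 R I.
  have [H1 H2] := H s1 R I; split=> // r h' /H2 [s2 [e G w]].
  by exists s2; split=> //; exact: IH.
have [H1 H2] := H s1 R I; split=> // s2 r I2 /(H2 _ _ I2); exact: IH.
Qed.

Lemma wp_weaken t A (m : prog A) (Q Q' : state -> A -> Prop) s :
  invariant s ->
  (forall s' a, invariant s' -> mono s s' -> Q s' a -> Q' s' a) ->
  wp t m Q s -> wp t m Q' s.
Proof.
elim: m s => [a|c k IH|f k IH|] s //= I HQ H.
- exact: HQ (mono_refl _) H.
- move=> s1 R I1; have [H1 H2] := H s1 R I1; split=> // r h' /H2 [s2 [e G w]].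
  exists s2; split=> //; apply: IH w; first exact: gsteps_invariant _ _ _ I1 G.
  move=> s' a I' M; apply: HQ => //; apply: mono_trans R _.
  exact: mono_trans (gsteps_mono I1 G) M.
- move=> s1 R I1; have [H1 H2] := H s1 R I1; split=> // s2 r I2 po.
  apply: IH (H2 _ _ I2 po) => // s' a I' M; apply: HQ => //.
  apply: mono_trans R (mono_trans _ M); exact: post_mono po.
Qed.

(** Interference is already quantified over before every action and call, so only an immediate [Ret]
    requires [Q] to be stable. *)
Lemma wp_rely t A (m : prog A) (Q : state -> A -> Prop) s s' :
  (forall a, Q s a -> Q s' a) -> rely t s s' -> wp t m Q s -> wp t m Q s'.
Proof.
case: m => [a|c k|f k|] //= HQ R; first exact: HQ.
  by move=> H s1 R1; apply: H; exact: rely_trans R R1.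
by move=> H s1 R1; apply: H; exact: rely_trans R R1.
Qed.

Lemma wp_act t A (c : prim) (g : response c -> prog A) Q s :
  (forall s1, rely t s s1 -> invariant s1 ->
     (exists r h', @prim_step d K V (hp s1) c r h') /\
     forall r h', prim_step (hp s1) r h' ->
       exists s2, [/\ hp s2 = h', gsteps t s1 s2 &
                      invariant s2 -> wp t (g r) Q s2]) ->
  wp t (bind (act c) g) Q s.
Proof.
move=> H s1 R I; have [H1 H2] := H s1 R I; split=> // r h' /H2 [s2 [e G w]].
exists s2; split=> //; apply: w; exact: gsteps_invariant _ _ _ I G.
Qed.

Lemma wp_deref t A x (g : view K V -> prog A) Q s :
  (forall s1, rely t s s1 -> invariant s1 ->
     exists2 nd, onth (hp s1) x = Some nd & wp t (g (view_of nd)) Q s1) ->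
  wp t (bind (deref x) g) Q s.
Proof.
move=> H; apply: wp_act => s1 R I; have [nd e w] := H s1 R I.
split; first by exists (view_of nd), (hp s1); rewrite /= e.
move=> r h' /= [+ ->]; rewrite e => -[<-].
by exists s1; split=> //; exact: GRefl.
Qed.

Lemma wp_read t A w (l : loc w) (g : word w -> prog A) Q s :
  (forall s1, rely t s s1 -> invariant s1 ->
     exists2 v, load (hp s1) l = Some v & wp t (g v) Q s1) ->
  wp t (bind (read l) g) Q s.
Proof.
move=> H; apply: wp_act => s1 R I; have [v e wv] := H s1 R I.
split; first by exists v, (hp s1).
move=> r h' /= [+ ->]; rewrite e => -[<-].
by exists s1; split=> //; exact: GRefl.
Qed.

Lemma wp_bindA A B C (m : prog A) (g : A -> prog B) (h : B -> prog C) Q t s :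
  wp t (bind m (fun a => bind (g a) h)) Q s -> wp t (bind (bind m g) h) Q s.
Proof. by rewrite bind_assoc. Qed.

Lemma wp_read_ptr t A (l : loc WPtr) (g : ptr -> prog A) Q s :
  (forall s1, rely t s s1 -> invariant s1 ->
     exists2 c, load (hp s1) l = Some (Some c) & wp t (g c) Q s1) ->
  wp t (bind (read_ptr l) g) Q s.
Proof.
move=> H; apply: wp_bindA; apply: wp_read => s1 R I.
by have [c e w] := H s1 R I; exists (Some c).
Qed.

Lemma wp_call t A (f : proc) (g : proc_result f -> prog A) Q s :
  (forall s1, rely t s s1 -> invariant s1 -> pre t f s1 /\
     forall s2 r, invariant s2 -> @post t f s1 s2 r -> wp t (g r) Q s2) ->
  wp t (bind (call f) g) Q s.
Proof. by []. Qed.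

Lemma wp_cas t A w (l : loc w) o x (g : bool -> prog A) Q s :
  (forall s1, rely t s s1 -> invariant s1 ->
     exists2 y, load (hp s1) l = Some y &
       (y != o -> wp t (g false) Q s1) /\
       (y = o -> exists s2, [/\ hp s2 = store (hp s1) l x, gsteps t s1 s2 &
                                invariant s2 -> wp t (g true) Q s2])) ->
  wp t (bind (cas l o x) g) Q s.
Proof.
move=> H; apply: wp_act => s1 R I; have [y e [w1 w2]] := H s1 R I.
split; first by exists (y == o), (if y == o then store (hp s1) l x else hp s1), y.
move=> r h' /= [y']; rewrite e => -[<-] [-> ->]; case: eqP => [/w2 //|/eqP/w1 w1'].
by exists s1; split=> //; exact: GRefl.
Qed.

Lemma wp_dcss t A q i o x (g : dcss_result -> prog A) Q s :
  (forall s1, rely t s s1 -> invariant s1 ->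
     exists n c, [/\ inner_at (hp s1) q = Some n,
       onth (i_children n) i = Some c &
       [/\ c <> o -> wp t (g FailedMainAddress) Q s1,
           i_status n <> clean -> wp t (g FailedAuxAddress) Q s1 &
           c = o -> i_status n = clean ->
           exists s2, [/\ hp s2 = @store d K V (hp s1) WPtr (LChild q i) x,
             gsteps t s1 s2 & invariant s2 -> wp t (g Success) Q s2]]]) ->
  wp t (bind (dcss_child q i o x) g) Q s.
Proof.
move=> H; apply: wp_act => s1 R I; have [n [c [e ec [w1 w2 w3]]]] := H s1 R I.
have e1 : @load d K V (hp s1) WPtr (LChild q i) = Some c by rewrite /= e.
have e2 : @load d K V (hp s1) WStatus (LStatus q) = Some (i_status n).
  by rewrite /= e.
split.
  have [E|E] := eqVneq c o; last first.
    by exists FailedMainAddress, (hp s1), c, (i_status n); split=> //; split=> //; exact/eqP.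
  have [E'|E'] := eqVneq (i_status n) clean.
    by eexists Success, _, c, (i_status n); split=> //.
  by exists FailedAuxAddress, (hp s1), c, (i_status n); split=> //; split=> //; exact/eqP.
move=> r h' [y [y' []]]; rewrite e1 e2 => -[<-] [<-].
case: r => [[E E' ->]|[E ->]|[E ->]].
- exact: w3.
- by exists s1; split=> //; [exact: GRefl | move=> _; exact: w1].
- by exists s1; split=> //; [exact: GRefl | move=> _; exact: w2].
Qed.

Lemma wp_alloc t A x (g : ptr -> prog A) Q s :
  (forall s1, rely t s s1 -> invariant s1 ->
     exists s2, [/\ hp s2 = rcons (hp s1) x, gsteps t s1 s2 &
                    invariant s2 -> wp t (g (size (hp s1))) Q s2]) ->
  wp t (bind (alloc x) g) Q s.
Proof.
move=> H; apply: wp_act => s1 R I; have [s2 [e G w]] := H s1 R I.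
split; first by exists (size (hp s1)), (rcons (hp s1) x).
by move=> r h' /= [-> ->]; exists s2.
Qed.

Arguments wp : simpl never.
Arguments bind : simpl never.

Lemma wp_tailcall t (f : proc) Q s :
  (forall s1, rely t s s1 -> invariant s1 -> pre t f s1 /\
     forall s2 r, invariant s2 -> @post t f s1 s2 r -> Q s2 r) ->
  wp t (call f) Q s.
Proof. by []. Qed.

(** * Verification of the procedures *)

Lemma att_node s x : invariant s -> x = 0 \/ att s x ->
  exists nd, onth (hp s) x = Some nd.
Proof.
move=> I [->|[q [i e]]].
  by have [_ [n /inner_atP e]] := inv_root I; exists (Inner n).
have := at_allocated I e; rewrite -onthTE.
by case: (onth (hp s) x) => [nd|] // _; exists nd.
Qed.

Lemma visible_rely t s s' x : rely t s s' ->
  x = 0 \/ att s x -> x = 0 \/ att s' x.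
Proof.
by move=> R [->|a]; [left | right; exact: att_mono R a].
Qed.

Definition sized s x N := exists2 n : inner, inner_at (hp s) x = Some n &
  size (i_children n) = N.

Lemma sized_mono s s' x N : mono s s' -> sized s x N -> sized s' x N.
Proof.
move=> M [n e sz]; have [n' e' [_ sz' _ _ _]] := heap_le_inner M e.
by exists n' => //; rewrite sz'.
Qed.

Lemma full_child_slot s x n i : invariant s -> x = 0 \/ att s x ->
  inner_at (hp s) x = Some n -> i < size (i_children n) ->
  exists2 c, slot (hp s) x i = Some (Some c) & mk s c = At x i.
Proof.
move=> I vx e lt; have fl := inner_att_full I vx e.
have [|c ec] := full_child (i := i) fl; first by rewrite fl.1.
have sl : slot (hp s) x i = Some (Some c) by apply/slotP; exists n.
by exists c => //; case: (inv_slot I sl).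
Qed.

Lemma wp_scan t A k n N m i (g : nat -> prog A) Q s :
  n = 0 \/ att s n -> sized s n N -> i + m < N -> invariant s ->
  (forall s' j, rely t s s' -> invariant s' -> j < N -> wp t (g j) Q s') ->
  wp t (bind (scan k n i m) g) Q s.
Proof.
elim: m i s => [|m IH] i s vn sn lt I H.
  by apply: H => //; [exact: rely_refl | rewrite addn0 in lt].
apply: wp_bindA; apply: wp_read => s1 R1 I1.
have vn1 := visible_rely R1 vn; have sn1 := sized_mono R1 sn.
have [n1 e1 sz1] := sn1; have [wf1 wf2 wf3 wf4] := inv_wf I1 e1.
have fl := inner_att_full I1 vn1 e1.
(* Key [i] is written because child [i.+1], which exists by the bound on [i], is not null. *)
have [|c ec] := full_child (i := i.+1) fl; first by rewrite fl.1; lia.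
have [ki ek] := wf4 _ _ ec.
exists (Some ki); first by rewrite /= e1.
case: ifP => _; first by apply: H => //; lia.
by apply: IH => // [|s' j R' I' lj]; [lia | apply: H => //; exact: rely_trans R'].
Qed.

Lemma wp_search t A k n N (g : nat -> prog A) Q s :
  n = 0 \/ att s n -> sized s n N ->
  (forall s' j, rely t s s' -> invariant s' -> j < N -> wp t (g j) Q s') ->
  wp t (bind (interpolation_search k n) g) Q s.
Proof.
move=> vn sn H; apply: wp_bindA; apply: wp_read => s1 R1 I1.
have vn1 := visible_rely R1 vn; have sn1 := sized_mono R1 sn.
have [n1 e1 sz1] := sn1; have [wf1 wf2 wf3 wf4] := inv_wf I1 e1.
exists (i_degree n1); first by rewrite /= e1.
apply: (wp_scan k vn1 sn1) => // [|s' j R' I' lj]; first by lia.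
by apply: H => //; exact: rely_trans R'.
Qed.

Lemma wp_lookup t k n s : invariant s -> n = 0 \/ att s n ->
  wp t (lookup_body k n) (fun s' _ => rely t s s') s.
Proof.
move=> I vn; apply: wp_deref => // s1 R1 I1; have vn1 := visible_rely R1 vn.
have [nd e1] := att_node I1 vn1; exists nd => //.
case: nd e1 => [|k' v|nn|u nt q i] e1 //=.
- move/inner_atP: e1 => e1.
  have sn1 : sized s1 n (size (i_children nn)) by exists nn.
  apply: (wp_search k vn1 sn1) => s2 j R2 I2 lj.
  apply: wp_read_ptr => // s3 R3 I3.
  have vn3 := visible_rely R3 (visible_rely R2 vn1).
  have [n3 e3 sz3] := sized_mono R3 (sized_mono R2 sn1).
  have [|c sl m] := full_child_slot (i := j) I3 vn3 e3; first by rewrite sz3.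
  exists c => //; apply: wp_tailcall => s4 R4 I4; split.
    by right; exists n, j; exact: mono_at R4 m.
  move=> s5 r I5 R5.
  exact: rely_trans R1 (rely_trans R2 (rely_trans R3 (rely_trans R4 R5))).
- move=> s4 R4 I4; split.
    have [_ m _ _] := inv_rebuild I1 e1.
    by right; exists q, i; exact: mono_at R4 m.
  by move=> s5 r I5 R5; exact: rely_trans R1 (rely_trans R4 R5).
Qed.

Lemma frozen_inv (h : heap) x k : frozen h x k ->
  match onth h x with
  | Some Empty => k = 0
  | Some (Single _ _) => k = 1
  | Some (Inner n) => [/\ i_status n <> clean, full n & exists2 f,
      forall i c, onth (i_children n) i = Some (Some c) -> frozen h c (f i) &
      k = sumn [seq f i | i <- iota 0 (i_degree n)]]
  | Some (Rebuild u _ _ _) => frozen h u k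
  | None => False
  end.
Proof.
case=> {x k} [x ->|x k v ->|x n f -> st fl H|x u nt q i k ->] //.
by split=> //; exists f.
Qed.

(* u is an Inner node that is marked, so that its children are cs for ever. *)
Definition closed s u (cs : seq (option ptr)) :=
  exists2 n : inner, inner_at (hp s) u = Some n &
    [/\ i_status n <> clean, full n & i_children n = cs].

Lemma closed_mono s s' u cs : mono s s' -> closed s u cs -> closed s' u cs.
Proof.
move=> M [n e [st fl ch]]; have [n' e' le] := heap_le_inner M e.
exists n' => //; have [_ _ _ /(_ st) [st' ch'] _] := le.
by split=> //; [exact: inner_le_full le fl | rewrite ch'].
Qed.

Lemma wp_collect_children t u cs f acc l s :
  invariant s -> closed s u cs ->
  (forall i c, onth cs i = Some (Some c) -> frozen (hp s) c (f i)) ->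
  all (fun i => i < size cs) l ->
  wp t (collect_children u acc l)
     (fun s' r => rely t s s' /\ size r = size acc + sumn [seq f i | i <- l]) s.
Proof.
elim: l acc s => [|i l IH] acc s I cl fr /= al.
  by split; [exact: rely_refl | rewrite addn0].
have [lt al'] := andP al.
apply: wp_read_ptr => // s1 R1 I1.
have [n1 e1 [st1 fl1 ch1]] := closed_mono R1 cl.
have [|c ec] := full_child (i := i) fl1; first by rewrite fl1.1 ch1.
exists c; first by rewrite /= e1.
rewrite ch1 in ec; apply: wp_call => s2 R2 I2.
have R12 := rely_trans R1 R2; split.
  by exists (f i); exact: frozen_le R12 (fr _ _ ec).
move=> s3 r I3 [R3 f3]; have R13 := rely_trans R12 R3.
have H13 := mono_heap R13.
apply: wp_weaken (IH _ s3 I3 _ _ al') => //.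
- move=> s4 r4 I4 _ [R4 ->]; split; first exact: rely_trans R4.
  rewrite size_cat (frozen_fun f3 (frozen_le H13 (fr _ _ ec))); lia.
- exact: closed_mono R13 cl.
- by move=> j c' /fr; exact: frozen_le.
Qed.

Lemma wp_collect t u s : invariant s -> (exists k, frozen (hp s) u k) ->
  wp t (collect_body u)
     (fun s' l => rely t s s' /\ frozen (hp s') u (size l)) s.
Proof.
move=> I [k fr]; apply: wp_deref => // s1 R1 I1.
have fr1 := frozen_le R1 fr.
move: (frozen_inv fr1).
case e1: (onth (hp s1) u) => [nd|] // H; exists nd => //.
case: nd e1 H => [|k' v|n|u' nt q i] e1 H.
- by split=> //; exact: FrEmpty.
- by split=> //; exact: FrSingle e1.
- case: H => st fl [f H ek].
  apply: wp_read => // s2 R2 I2.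
  have cl1 : closed s1 u (i_children n).
    by exists n => //; apply/inner_atP.
  have H2 := mono_heap R2.
  have cl2 := closed_mono R2 cl1.
  have [n2 e2 [st2 fl2 ch2]] := cl2.
  exists (i_degree n2); first by rewrite /= e2.
  apply: wp_weaken (wp_collect_children t (f := f) [::] I2 cl2 _ _) => //.
  + move=> s3 r I3 M3 [R3 sz].
    have R13 := rely_trans R1 (rely_trans R2 R3); split=> //.
    rewrite sz add0n fl2.1 ch2 -fl.1 -ek.
    exact: frozen_le R13 fr.
  + by move=> j c ec; exact: frozen_le H2 (H _ _ ec).
  + by apply/allP => j; rewrite mem_iota fl2.1 ch2.
- apply: wp_tailcall => s2 R2 I2; split.
    by exists k; exact: frozen_le R2 H.
  move=> s3 r I3 [R3 f3]; have R13 := rely_trans R1 (rely_trans R2 R3).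
  split=> //.
  have [nt' e' _] := heap_le_rebuild (rely_trans R2 R3) e1.
  exact: FrRebuild e' f3.
Qed.

Lemma wp_faa t A l m (g : nat -> prog A) Q s :
  (forall s1, rely t s s1 -> invariant s1 ->
     exists2 v, @load d K V (hp s1) WNat l = Some v &
     exists s2, [/\ hp s2 = @store d K V (hp s1) WNat l (v + m), gsteps t s1 s2 &
                    invariant s2 -> wp t (g v) Q s2]) ->
  wp t (bind (act (FetchAndAdd l m)) g) Q s.
Proof.
move=> H; apply: wp_act => // s1 R I; have [v e [s2 [e2 G w]]] := H s1 R I.
split; first by exists v, (@store d K V (hp s1) WNat l (v + m)).
by move=> r h' /= [+ ->]; rewrite e => -[<-]; exists s2.
Qed.

Lemma wp_mark t u deg s : invariant s -> pre t (PMark u deg) s ->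
  wp t (mark_body u deg) (fun s' _ => rely t s s') s.
Proof.
move=> I pr; apply: wp_faa => s1 R1 I1.
have [dd1 [n1 e1 le1]] := pre_rely I R1 pr.
exists (i_nextMark n1); first by rewrite /= e1.
have [|s2 [e2 G2 R2]] := @step_nextMark t s1 u n1
  (i_nextMark n1 + 1) I1 e1; first exact: leq_addr.
exists s2; split=> // I2.
have R02 := rely_trans R1 R2; have pr2 := pre_rely I R02 pr.
case: (leqP deg (i_nextMark n1)) => [//|lt].
apply: wp_read_ptr => // s3 R3 I3.
have [dd3 [n3 e3 le3]] := pre_rely I2 R3 pr2.
have vu : u = 0 \/ att s3 u by right; exact: dead_att I3 dd3.
have [c sl mc] := full_child_slot I3 vu e3 (leq_trans lt le3).
exists c => //; apply: wp_call => s4 R4 I4; split.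
  by apply: (mono_dead R4); exact: dead_step mc dd3.
move=> s5 r5 I5 [R5 _]; apply: wp_tailcall => s6 R6 I6.
have R26 := rely_trans R3 (rely_trans R4 (rely_trans R5 R6)).
split; first exact: pre_rely I2 R26 pr2.
by move=> s7 r7 I7 R7; exact: rely_trans R02 (rely_trans R26 R7).
Qed.

(** The count in a finished status can be trusted without recounting, by [inv_finished]. *)
Lemma wp_count_child t A c (g : nat -> prog A) Q s : invariant s -> dead s c ->
  (forall s' k, rely t s s' -> invariant s' -> frozen (hp s') c k ->
     wp t (g k) Q s') ->
  wp t (bind (count_child c) g) Q s.
Proof.
move=> I dd H; apply: wp_bindA; apply: wp_deref => // s1 R1 I1.
have dd1 := mono_dead R1 dd.
have [nd e1] := att_node I1 (or_intror (dead_att I1 dd1)); exists nd => //.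
have CALL : wp t (bind (call (PMCC c)) g) Q s1.
  apply: wp_call => s2 R2 I2; split; first exact: mono_dead R2 dd1.
  move=> s3 r I3 [R3 f3]; apply: H => //.
  exact: rely_trans R1 (rely_trans R2 R3).
case: nd e1 => [|k' v|n|u' nt q i] e1 //.
- by apply: H => //; exact: FrEmpty.
- by apply: H => //; exact: FrSingle e1.
- apply: wp_bindA; apply: wp_read => // s2 R2 I2.
  move/inner_atP: e1 => e1.
  have [n2 e2 _] := heap_le_inner R2 e1.
  exists (i_status n2); first by rewrite /= e2.
  case: ifP => fi; last first.
    by move=> s3 R3 I3; exact: (CALL s3 (rely_trans R2 R3) I3).
  by apply: H => //; [exact: rely_trans R2 | exact (inv_finished I2 e2 fi)].
Qed.

Lemma wp_count_children t A u cs (g : nat -> prog A) Q i m acc s :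
  invariant s -> closed s u cs -> dead s u -> i + m <= size cs ->
  (forall s' ms, rely t s s' -> invariant s' -> size ms = m ->
     (forall j c, j < m -> onth cs (i + j) = Some (Some c) ->
        frozen (hp s') c (nth 0 ms j)) ->
     wp t (g (acc + sumn ms)) Q s') ->
  wp t (bind (count_children u acc (iota i m)) g) Q s.
Proof.
elim: m i acc s => [|m IH] i acc s I cl dd le H.
  have := H s [::]; rewrite /= addn0; apply => //; exact: rely_refl.
apply: wp_bindA; apply: wp_read_ptr => // s1 R1 I1.
have [n1 e1 [st1 fl1 ch1]] := closed_mono R1 cl.
have dd1 := mono_dead R1 dd.
have [|c sl mc] := full_child_slot (i := i) I1 (or_intror (dead_att I1 dd1)) e1.
  by rewrite ch1; lia.
exists c => //; apply: wp_bindA.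
apply: wp_count_child (dead_step mc dd1) _ => // s2 k R2 I2 f2.
have R02 := rely_trans R1 R2.
apply: IH.
- by [].
- exact: closed_mono R02 cl.
- exact: mono_dead R02 dd.
- by lia.
move=> s3 ms R3 I3 sz Hm; have R03 := rely_trans R02 R3.
rewrite -addnA; apply: (H s3 (k :: ms)) => //; first by rewrite /= sz.
move=> [|j] c'; last by rewrite addnS -addSn ltnS => lt /Hm; apply.
rewrite addn0 => _; move/slotP: sl => [n1' e1' ec].
move: e1'; rewrite e1 => -[E]; subst n1'; rewrite -ch1 ec => -[<-].
exact: frozen_le R3 f2.
Qed.

(** After the first CAS the node is marked, whoever marked it. Its children are then fixed and their
    subtrees get frozen in turn, so counts taken at different times add up to a single frozen
    number. *)
Lemma wp_mcc t u s : invariant s -> dead s u ->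
  wp t (mcc_body T u) (fun s' k => rely t s s' /\ frozen (hp s') u k) s.
Proof.
move=> I dd; apply: wp_deref => // s1 R1 I1.
have dd1 := mono_dead R1 dd.
have [nd e1] := att_node I1 (or_intror (dead_att I1 dd1)); exists nd => //.
case: nd e1 => [|k v|n1|u' nt q i] e1.
- by split=> //; exact: FrEmpty.
- by split=> //; exact: FrSingle e1.
- move/inner_atP: e1 => e1.
  pose cont := bind (read (LDegree u)) (fun deg =>
    bind (if (T < deg)%N then call (PMark u deg) else Ret tt) (fun _ =>
    bind (count_children u 0 (iota 0 deg)) (fun kc =>
    bind (@cas d K V WStatus (LStatus u) started (finished kc)) (fun _ =>
    Ret kc)))).
  have CONT s2 : rely t s s2 -> invariant s2 ->
      (exists2 n2, inner_at (hp s2) u = Some n2 & i_status n2 <> clean) ->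
      wp t cont (fun s' k => rely t s s' /\ frozen (hp s') u k) s2.
    move=> R2 I2 [n2 e2 st2].
    have dd2 := mono_dead R2 dd.
    have cl2 : closed s2 u (i_children n2).
      exists n2 => //; split=> //.
      exact: inner_att_full I2 (or_intror (dead_att I2 dd2)) e2.
    apply: wp_read => // s3 R3 I3.
    have cl3 := closed_mono R3 cl2.
    have [n3 e3 [st3 fl3 ch3]] := cl3.
    have dd3 := mono_dead R3 dd2.
    exists (i_degree n3); first by rewrite /= e3.
    have REST s4 : rely t s3 s4 -> invariant s4 ->
        wp t (bind (count_children u 0 (iota 0 (i_degree n3))) (fun kc =>
          bind (@cas d K V WStatus (LStatus u) started (finished kc)) (fun _ =>
          Ret kc))) (fun s' k => rely t s s' /\ frozen (hp s') u k) s4.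
      move=> R4 I4.
      apply: (wp_count_children (cs := i_children n2)) => //.
      - exact: closed_mono R4 cl3.
      - exact: mono_dead R4 dd3.
      - by rewrite fl3.1 ch3.
      move=> s5 ms R5 I5 sz Hm.
      apply: wp_cas => // s6 R6 I6.
      have R36 := rely_trans R4 (rely_trans R5 R6).
      have R06 := rely_trans R2 (rely_trans R3 R36).
      have [n6 e6 [st6 fl6 ch6]] := closed_mono R36 cl3.
      have deg36 : i_degree n3 = i_degree n6 by rewrite fl3.1 fl6.1 ch6 ch3.
      have fr : frozen (hp s6) u (0 + sumn ms).
        have -> : 0 + sumn ms = sumn [seq nth 0 ms j | j <- iota 0 (i_degree n6)].
          by rewrite -deg36 -sz map_nth_iota0 // take_size.
        apply: (FrInner (n := n6)) => //; first exact/inner_atP.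
        rewrite ch6 => j c ec; apply: frozen_le R6 _.
        apply: Hm => //; rewrite deg36 fl6.1 ch6; exact: onth_ltn ec.
      exists (i_status n6); first by rewrite /= e6.
      split=> // est.
      have dd6 := mono_dead (rely_trans R3 R36) dd2.
      have nc : finished (0 + sumn ms) <> clean by case.
      have [s7 [e7 G7 R7]] := step_status t I6 e6 dd6 nc (fun _ => fr).
      exists s7; split=> // I7; split; first exact: rely_trans R7.
      exact: frozen_le R7 fr.
    case: ifP => _; last exact: REST (rely_refl _ _) I3.
    apply: wp_call => s4 R4 I4; split.
      split; first exact: mono_dead R4 dd3.
      have [n4 e4 [st4 fl4 ch4]] := closed_mono R4 cl3.
      by exists n4 => //; rewrite fl3.1 ch3 ch4.
    by move=> s5 r I5 R5; apply: REST => //; exact: rely_trans R5.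
  apply: wp_cas => // s2 R2 I2.
  have [n2 e2 _] := heap_le_inner R2 e1.
  exists (i_status n2); first by rewrite /= e2.
  have R02 := rely_trans R1 R2.
  split=> [/eqP st2|st2]; first by apply: CONT => //; exists n2.
  have dd2 := mono_dead R02 dd.
  have nc : started <> clean by case.
  have [//|s3 [e3 G3 R3]] := step_status t I2 e2 dd2 nc _.
  exists s3; split=> // I3; apply: CONT => //; first exact: rely_trans R3.
  by rewrite e3 /= /update e2 (inner_at_set _ _ e2) eqxx; eexists.
- apply: wp_tailcall => s2 R2 I2; split.
    have [q' [i' m]] := dead_att I1 dd1.
    have [_ _ /(_ _ _ m) [_ _ pu _] _] := inv_rebuild I1 e1.
    by apply: (mono_dead R2); exact: dead_past.
  move=> s3 r I3 [R3 f3]; split; first exact: rely_trans R1 (rely_trans R2 R3).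
  have [nt' e' _] := heap_le_rebuild (rely_trans R2 R3) e1.
  exact: FrRebuild e' f3.
Qed.

Lemma wp_sorted_pairs t A u k (g : seq (K * V) -> prog A) Q s :
  frozen (hp s) u k ->
  (forall s' l, rely t s s' -> invariant s' -> size l = k -> wp t (g l) Q s') ->
  wp t (bind (sorted_pairs u) g) Q s.
Proof.
move=> fr H; apply: wp_bindA; apply: wp_call => s1 R1 I1; split.
  by exists k; exact: frozen_le R1 fr.
move=> s2 l I2 [R2 f2]; have R02 := rely_trans R1 R2.
apply: H => //; rewrite size_sort.
exact: frozen_fun f2 (frozen_le R02 fr).
Qed.

Lemma wp_create_ideal t A u k from cnt (g : ptr -> prog A) Q s :
  invariant s -> frozen (hp s) u k -> from + cnt <= k ->
  (forall s' r, rely t s s' -> invariant s' -> size (hp s) <= r ->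
     mk s' r = Own t -> full_at (hp s') r -> ~~ is_rebuild (hp s') r ->
     wp t (g r) Q s') ->
  wp t (bind (create_ideal u from cnt) g) Q s.
Proof.
move=> I fr le H; apply: wp_bindA; apply: wp_sorted_pairs fr _ => s1 l R1 I1 sz.
cbv zeta; rewrite size_takel; last by rewrite size_drop sz; lia.
rewrite eqxx; apply: wp_act => s2 R2 I2.
have [r0 [h0 a0]] := alloc_ideal_exists (hp s2) (take cnt (drop from l)).
split; first by exists r0, h0.
move=> r h' al.
have [s3 e3 [G3 R3 le3 [o3 f3 n3]]] := new_ideal_alloc t al I2 erefl.
exists s3; split=> // I3; apply: H => //.
  exact: rely_trans R1 (rely_trans R2 R3).
apply: leq_trans le3.
exact: mono_size (rely_trans R1 R2).
Qed.

Lemma wp_key_of_rank t A u k rank (g : K -> prog A) Q s :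
  frozen (hp s) u k -> rank < k ->
  (forall s' x, rely t s s' -> invariant s' -> wp t (g x) Q s') ->
  wp t (bind (key_of_rank u rank) g) Q s.
Proof.
move=> fr lt H; apply: wp_bindA; apply: wp_sorted_pairs fr _ => s1 l R1 I1 sz.
move: lt; rewrite -sz -onthTE.
by case: (onth l rank) => [[x v]|] // _; exact: H.
Qed.

Definition child_set s x i := exists n c,
  inner_at (hp s) x = Some n /\ onth (i_children n) i = Some (Some c).

Lemma child_set_mono s s' x i : mono s s' -> child_set s x i -> child_set s' x i.
Proof.
move=> M [n [c [e ec]]].
have [n' e' [_ _ /(_ _ _ ec) [c' ec'] _ _]] := heap_le_inner M e.
by exists n', c'.
Qed.

Lemma full_at_mono s s' x : mono s s' -> x < size (hp s) ->
  full_at (hp s) x -> full_at (hp s') x.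
Proof. by move=> M lt; apply: heap_le_full lt; exact: mono_heap M. Qed.

(** The interval of ranks given to a child stays below [kc], which excludes the [Crash] branches of
    [create_ideal] and [key_of_rank]. *)
Lemma division_bounds kc index (t := sqrt_floor kc) (q := kc %/ t)
    (rho := kc %% t) (from := q * index + minn index rho)
    (cnt := if index < rho then q.+1 else q) :
  0 < kc -> index < t -> from + cnt <= kc /\ from < kc.
Proof.
move=> kc0 lt.
have t0 : 0 < t by exact: sqrt_floor_gt0.
have tk : t <= kc by have := sqrt_floor_spec kc; rewrite -/t; nia.
have q0 : 0 < q by rewrite divn_gt0.
have E : kc = q * t + rho by exact: divn_eq.
have rt : rho < t by rewrite ltn_mod.
have : from + cnt <= kc.
  by rewrite /from /cnt; case: ltnP => h; nia.
split=> //; have : 0 < cnt by rewrite /cnt; case: ifP.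
lia.
Qed.

(* A node that is still being built is not yet in the tree, so it has not    *)
(* been marked.                                                              *)
Lemma nonclean_full s x n : invariant s -> inner_at (hp s) x = Some n ->
  i_status n <> clean -> full n.
Proof.
move=> I e st; have dd := inv_status I e st.
exact: inner_att_full I (or_intror (dead_att I dd)) e.
Qed.

(** Failure at the main address means that another helper has set the child. Failure at the status
    means that the node is marked, hence dead, attached and already full: nothing is left to build,
    and the result is false. *)
Lemma wp_set_child t A op kc nt index (g : bool -> prog A) Q s :
  invariant s -> building s op kc nt -> index < sqrt_floor kc ->
  (forall s' b, rely t s s' -> invariant s' ->
     (if b then child_set s' nt index else full_at (hp s') nt) ->
     wp t (g b) Q s') ->
  wp t (bind (rebuild_and_set_child op kc index) g) Q s.
Proof.
move=> I bl lt H; apply: wp_bindA; apply: wp_deref => s1 R1 I1.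
have bl1 := building_mono R1 bl.
have [le1 [u [q [i [e1 m1 f1]]]]] := bl1.
eexists; first exact: e1.
have [b1 b2] := division_bounds (leq_trans hT le1) lt.
apply: wp_bindA; apply: (wp_create_ideal I1 f1 b1) => s2 r R2 I2 lr o2 fl2 nr2.
apply: wp_bindA; apply: wp_read_ptr => s3 R3 I3.
have R13 := rely_trans R2 R3.
have [nto3 e3 /(_ _ erefl) E3] := heap_le_rebuild R13 e1.
subst nto3; exists nt; first by rewrite /= e3.
have lr2 : r < size (hp s2) by apply: inv_allocated I2 _; rewrite o2.
have FIN s4 : rely t s3 s4 -> invariant s4 ->
    (0 < index -> exists n k, inner_at (hp s4) nt = Some n /\
       onth (i_keys n) index.-1 = Some (Some k)) ->
    wp t (bind (bind (dcss_child nt index None (Some r)) (fun res =>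
      Ret (if res is FailedAuxAddress then false else true))) g) Q s4.
  move=> R4 I4 hk; apply: wp_bindA; apply: wp_dcss => s5 R5 I5.
  have R15 := rely_trans R13 (rely_trans R4 R5).
  have [n5 e5 [sz5 m5]] := building_inner I5 (building_mono R15 bl1).
  case ec5: (onth (i_children n5) index) => [c5|]; last first.
    by move: lt; rewrite -sz5 -onthTE ec5.
  exists n5, c5; split=> //; split.
  - case: c5 ec5 => // c5 ec5 _; apply: (H s5 true) => //.
      exact: rely_trans R1 R15.
    by exists n5, c5.
  - move=> st; apply: (H s5 false) => //; first exact: rely_trans R1 R15.
    by move=> n; rewrite e5 => -[<-]; exact: nonclean_full I5 e5 st.
  - move=> E st; subst c5.
    (* An attached node would be full, but this one still has a null entry. *)
    have mn5 : mk s5 nt = Res op.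
      case: m5 => // a5.
      have [_ /all_nthP al] := inner_att_full I5 (or_intror a5) e5.
      have := al None index (onth_ltn ec5).
      by rewrite (onth_nth _ _ _ _ ec5).
    have R25 := rely_trans R3 (rely_trans R4 R5).
    have lr0 : size (hp s) <= r.
      by apply: leq_trans lr; exact: mono_size R1.
    have nr5 : ~~ is_rebuild (hp s5) r.
      by rewrite (heap_le_is_rebuild R25 lr2).
    have hk5 : 0 < index -> exists k, onth (i_keys n5) index.-1 = Some (Some k).
      move=> /hk [n4 [k [e4 ek]]].
      have [n5' e5' [_ _ _ _ [h5 _ _ _ _]]] :=
        heap_le_inner R5 e4.
      by move: e5'; rewrite e5 => -[E]; subst n5'; exact: h5 ek.
    have [s6 [e6 G6 R6]] := step_fill I (rely_trans R1 R15) lr0 I5 e5 ec5 st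
      (full_at_mono R25 lr2 fl2) nr5 (rely_own R25 o2) mn5 hk5.
    exists s6; split=> // I6; apply: (H s6 true) => //.
    rewrite /child_set e6 /= /update e5.
    do 2!eexists; rewrite (inner_at_set _ _ e5) eqxx; split=> //=.
    by rewrite onth_set_nth ?eqxx // (onth_ltn ec5).
case: ifP => [i0|/negbT i0]; last first.
  by apply: FIN => //; [exact: rely_refl | rewrite (negbTE i0)].
apply: wp_bindA; apply: wp_bindA.
have f3 := frozen_le R13 f1.
apply: (wp_key_of_rank f3 b2) => s4 x R4 I4.
apply: wp_act => s5 R5 I5.
have R15 := rely_trans R13 (rely_trans R4 R5).
have [n5 e5 [sz5 _]] := building_inner I5 (building_mono R15 bl1).
have [_ ks _ _] := inv_wf I5 e5.
have lk : index.-1 < size (i_keys n5) by rewrite ks sz5; lia.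
split.
  exists tt; eexists; split; last by reflexivity.
  by rewrite /= e5 /= onthTE.
move=> [] h' [_ ->].
have [s6 [e6 G6 R6]] := step_key t x I5 e5 lk.
exists s6; split=> // I6; apply: FIN => //.
  exact: rely_trans R4 (rely_trans R5 R6).
move=> _; rewrite e6 /= /update e5; do 2!eexists.
rewrite (inner_at_set _ _ e5) eqxx; split=> //=.
by rewrite onth_set_nth ?eqxx.
Qed.

Lemma wp_fill t op kc nt s : invariant s -> building s op kc nt ->
  wp t (fill_body op kc nt) (fun s' r => @post t (PFill op kc nt) s s' r) s.
Proof.
move=> I bl; apply: wp_read => s1 R1 I1.
have [n1 e1 [sz1 _]] := building_inner I1 (building_mono R1 bl).
exists (i_degree n1); first by rewrite /= e1.
apply: wp_deref => s2 R2 I2.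
have R02 := rely_trans R1 R2.
have [n2 e2 [sz2 _]] := building_inner I2 (building_mono R02 bl).
exists (Inner n2); first exact/inner_atP.
rewrite /= sz2; case: eqP => [E|ne].
  split=> //; exists n2 => //.
  have [n2' e2' [_ sz' _ _ [_ _ _ _ dg]]] := heap_le_inner R2 e1.
  move: e2'; rewrite e2 => -[E2]; subst n2'.
  by apply: dg; rewrite E sz1.
have LOOP s' : rely t s s' -> invariant s' ->
    wp t (call (PFill op kc nt)) (fun s' r => @post t (PFill op kc nt) s s' r) s'.
  move=> R' I'; apply: wp_tailcall => s'' R'' I''.
  have R := rely_trans R' R''; split; first exact: building_mono R bl.
  move=> s3 r I3 [R3 h3]; split=> //; exact: rely_trans R3.
apply: wp_cas => s3 R3 I3.
have R03 := rely_trans R02 R3.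
have [n3 e3 [sz3 _]] := building_inner I3 (building_mono R03 bl).
exists (i_degree n3); first by rewrite /= e3.
split=> [_|E]; first exact: LOOP.
have [_ _ dle _] := inv_wf I3 e3.
have lt : i_degree n1 < sqrt_floor kc.
  by move: dle; rewrite sz3 E; lia.
have [||s4 [e4 G4 R4]] := step_degree t (v := (i_degree n1).+1) I3 e3.
- by rewrite E.
- by rewrite sz3.
exists s4; split=> // I4.
have R04 := rely_trans R03 R4.
apply: (wp_set_child I4 (building_mono R04 bl) lt) => s5 b R5 I5 h5.
have R05 := rely_trans R04 R5.
by case: b h5 => h5; [exact: LOOP | split].
Qed.

Lemma wp_fill_null t A op kc nt i m (g : unit -> prog A) Q s :
  invariant s -> building s op kc nt -> i + m <= sqrt_floor kc ->
  (forall s' x, rely t s s' -> invariant s' ->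
     full_at (hp s') nt \/
     (forall j, i <= j < i + m -> child_set s' nt j) -> wp t (g x) Q s') ->
  wp t (bind (fill_null op kc nt (iota i m)) g) Q s.
Proof.
elim: m i s => [|m IH] i s I bl le H.
  apply: H => //; first exact: rely_refl.
  by right=> j; lia.
apply: wp_bindA; apply: wp_read => s1 R1 I1.
have [n1 e1 [sz1 _]] := building_inner I1 (building_mono R1 bl).
case ec: (onth (i_children n1) i) => [c|]; last first.
  by have : i < size (i_children n1); [rewrite sz1; lia | rewrite -onthTE ec].
exists c; first by rewrite /= e1.
have NEXT s2 : rely t s s2 -> invariant s2 -> child_set s2 nt i ->
    wp t (bind (fill_null op kc nt (iota i.+1 m)) g) Q s2.
  move=> R2 I2 cs2; apply: IH => //; first exact: building_mono R2 bl.
    by lia.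
  move=> s3 x R3 I3 h3; apply: H => //; first exact: rely_trans R3.
  case: h3 => [fl|h3]; [by left | right=> j hj].
  have [->|ne] := eqVneq j i; first exact: child_set_mono R3 cs2.
  by apply: h3; move/eqP: ne; lia.
case: c ec => [c|] ec; first by apply: NEXT => //; exists n1, c.
apply: wp_bindA.
have lt : i < sqrt_floor kc by lia.
apply: (wp_set_child I1 (building_mono R1 bl) lt) => s2 b R2 I2 h2.
have R02 := rely_trans R1 R2.
by case: b h2 => h2; [exact: NEXT | apply: H => //; left].
Qed.

(** The code is regrouped around the publication of [newTarget], the point from which all helpers
    work on the same node. *)
Definition fill_ideal op kc nt : prog ptr :=
  if kc < T then Ret nt else
  bind (call (PFill op kc nt)) (fun go =>
  bind (if go then bind (deref nt) (fun y =>
          if y is VInner _ len then fill_null op kc nt (iota 0 len) else Crash)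
        else Ret tt) (fun _ => Ret nt)).

Definition publish_ideal op kc new : prog ptr :=
  bind (@cas d K V WPtr (LNewTarget op) None (Some new)) (fun ok =>
  bind (if ok then Ret new else read_ptr (LNewTarget op)) (fill_ideal op kc)).

Lemma create_ideal_collaborativeE op kc :
  create_ideal_collaborative T op kc = bind (deref op) (fun x =>
    if x is VRebuild u _ _ then
      bind (if kc < T then create_ideal u 0 kc else
            alloc (new_inner V kc 0 (nseq (sqrt_floor kc).-1 None)
                               (nseq (sqrt_floor kc) None)))
           (publish_ideal op kc)
    else Crash).
Proof. by []. Qed.

Lemma wp_create_collaborative t A op u nto q i kc (g : ptr -> prog A) Q s :
  invariant s -> onth (hp s) op = Some (Rebuild u nto q i) ->
  mk s op = At q i -> frozen (hp s) u kc ->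
  (forall s' r, rely t s s' -> invariant s' ->
     onth (hp s') op = Some (Rebuild u (Some r) q i) ->
     full_at (hp s') r -> wp t (g r) Q s') ->
  wp t (bind (create_ideal_collaborative T op kc) g) Q s.
Proof.
rewrite create_ideal_collaborativeE => I eop mop fr H.
apply: wp_bindA; apply: wp_deref => s1 R1 I1.
have [nto1 e1 _] := heap_le_rebuild R1 eop.
eexists; first exact: e1.
have fr1 := frozen_le R1 fr.
have m1 := mono_at R1 mop.
rewrite [view_of _]/=.
have READY s2 nt : rely t s1 s2 -> invariant s2 ->
    onth (hp s2) op = Some (Rebuild u (Some nt) q i) ->
    wp t (bind (fill_ideal op kc nt) g) Q s2.
  rewrite /fill_ideal => R2 I2 e2; have R02 := rely_trans R1 R2.
  have fr2 := frozen_le R2 fr1.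
  have RET s3 : rely t s2 s3 -> invariant s3 -> full_at (hp s3) nt ->
      wp t (g nt) Q s3.
    move=> R3 I3 fl; apply: H => //; first exact: rely_trans R3.
    by have [nt' e3 /(_ _ erefl) <-] := heap_le_rebuild R3 e2.
  case: ltnP => [lt|ge].
    apply: (RET s2) => //; first exact: rely_refl.
    have [_ _ _ /(_ _ erefl) [[kc' [f' _ _ sh]] _]] := inv_rebuild I2 e2.
    by move: sh; rewrite -(frozen_fun fr2 f') lt.
  have bl2 : building s2 op kc nt.
    by split=> //; exists u, q, i; split=> //; exact: mono_at R2 m1.
  apply: wp_bindA; apply: wp_call => s3 R3 I3.
  split; first exact: building_mono R3 bl2.
  move=> s4 go I4 [R4 h4]; have R24 := rely_trans R3 R4.
  apply: wp_bindA.
  case: go h4 => h4; last by apply: (RET s4).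
  have {h4}[n4 e4 dg4] := h4.
  apply: wp_bindA; apply: wp_deref => s5 R5 I5.
  have R25 := rely_trans R24 R5; have bl5 := building_mono R25 bl2.
  have [n5 e5 [sz5 _]] := building_inner I5 bl5.
  exists (Inner n5); first exact/inner_atP.
  rewrite /= sz5.
  apply: (wp_fill_null I5 bl5) => // s6 _ R6 I6 h6.
  apply: (RET s6) => //; first exact: rely_trans R6.
  case: h6 => // h6 n6 e6.
  have [n6' e6' [_ sz6 _ _ [_ _ _ _ dg6]]] :=
    heap_le_inner (rely_trans R5 R6) e4.
  move: e6'; rewrite e6 => -[E]; subst n6'.
  split; first exact: dg6.
  have [n6' e6' [sz6' _]] := building_inner I6 (building_mono R6 bl5).
  move: e6'; rewrite e6 => -[E]; subst n6'.
  apply/(all_nthP None) => j; rewrite sz6' => lt.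
  have [|n7 [c [e7 ec]]] := h6 j; first by rewrite lt.
  by move: e7; rewrite e6 => -[E]; subst n7; rewrite (onth_nth _ _ _ _ ec).
have REST s2 new : rely t s1 s2 -> invariant s2 -> size (hp s1) <= new ->
    mk s2 new = Own t -> ~~ is_rebuild (hp s2) new ->
    (if kc < T then full_at (hp s2) new else sized s2 new (sqrt_floor kc)) ->
    wp t (bind (publish_ideal op kc new) g) Q s2.
  move=> R2 I2 len o2 nr2 sh2.
  have ln2 : new < size (hp s2) by apply: inv_allocated I2 _; rewrite o2.
  apply: wp_bindA; apply: wp_cas => s3 R3 I3.
  have R13 := rely_trans R2 R3.
  have [nto3 e3 _] := heap_le_rebuild R13 e1.
  exists nto3; first by rewrite /= e3.
  split=> [ne|E].
    apply: wp_bindA; apply: wp_read_ptr => s4 R4 I4.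
    case: nto3 e3 ne => // nt e3 _.
    have [nto4 e4 /(_ _ erefl) E] := heap_le_rebuild R4 e3.
    subst nto4; exists nt; first by rewrite /= e4.
    by apply: READY => //; exact: rely_trans R4.
  subst nto3.
  have sh3 : ideal_shape (hp s3) u new.
    exists kc; split.
    - exact: frozen_le R13 fr1.
    - by rewrite (heap_le_is_rebuild R3 ln2).
    - by apply: leq_trans ln2 _; exact: mono_size R3.
    - case: ifP sh2 => _ sh2; first exact: full_at_mono R3 ln2 sh2.
      exact: sized_mono R3 sh2.
  have [s4 [e4 G4 R4]] := step_newTarget I1 R13 len I3 e3
    (mono_at R13 m1) (rely_own R3 o2) sh3.
  exists s4; split=> // I4; apply: READY => //.
  by rewrite e4 /= e3 onth_set_nth ?eqxx // (onth_ltn e3).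
apply: wp_bindA.
case: ltnP => [lt|ge].
  apply: (wp_create_ideal I1 fr1) => // s2 new R2 I2 len o2 fl2 nr2.
  by apply: REST => //; rewrite lt.
apply: wp_alloc => s2 R2 I2.
have t0 : 0 < sqrt_floor kc by apply: sqrt_floor_gt0; exact: leq_trans ge.
set new := new_inner V _ _ _ _.
have ok : alloc_ok t s2 new [::].
  split=> //; split=> //; split=> //.
    split; [by rewrite size_nseq | by rewrite !size_nseq | by [] |].
    by move=> j c; rewrite [i_children _]/= onth_nseq; case: ifP.
  by right; split=> // j c; rewrite onth_nseq; case: ifP.
have [s3 [e3 G3 R3 o3]] := step_alloc I2 ok.
exists s3; split=> // I3; apply: REST => //.
- exact: rely_trans R3.
- exact: mono_size R2.
- by rewrite /is_rebuild e3 onth_rcons eqxx.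
- rewrite ltnNge ge /=; eexists; first by rewrite e3 inner_at_rcons eqxx.
  by rewrite /= size_nseq.
Qed.

Lemma wp_help_rebuild t A op (g : unit -> prog A) Q s :
  invariant s -> att s op -> is_rebuild (hp s) op ->
  (forall s', rely t s s' -> invariant s' -> wp t (g tt) Q s') ->
  wp t (bind (help_rebuild T op) g) Q s.
Proof.
move=> I [q0 [i0 m0]] /is_rebuildP [u [nto [q [i e0]]]] H.
have [_ _ /(_ _ _ m0) [? ? pu _] _] := inv_rebuild I e0; subst q0 i0.
apply: wp_bindA; apply: wp_deref => s1 R1 I1.
have [nto1 e1 _] := heap_le_rebuild R1 e0.
eexists; first exact: e1.
apply: wp_bindA; apply: wp_call => s2 R2 I2.
have R02 := rely_trans R1 R2.
split; first by apply: dead_past; exact: (mono_past R02).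
move=> s3 kc I3 [R3 f3]; have R03 := rely_trans R02 R3.
have [nto3 e3 _] := heap_le_rebuild R03 e0.
have m3 := mono_at R03 m0.
apply: wp_bindA; apply: (wp_create_collaborative I3 e3 m3 f3) => s4 r R4 I4 e4 fl4.
apply: wp_bindA; apply: wp_dcss => s5 R5 I5.
have R05 := rely_trans R03 (rely_trans R4 R5).
have m5 := mono_at R05 m0.
have [c' sl _] := inv_cur I5 m5; move/slotP: sl => [n5 e5 ec5].
have lr4 : r < size (hp s4).
  by have [_ _ _ /(_ _ erefl) [[kc' []] ]] := inv_rebuild I4 e4.
exists n5, (Some c'); split=> //; split=> [_|_|[E] st]; try exact: H.
subst c'.
have [nto5 e5' /(_ _ erefl) E5] := heap_le_rebuild R5 e4.
subst nto5.
have [s6 [e6 G6 R6]] := step_complete t I5 e5 ec5 st e5'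
  (full_at_mono R5 lr4 fl4).
by exists s6; split=> // I6; apply: H => //; exact: rely_trans R6.
Qed.

Lemma wp_bump t A path (g : unit -> prog A) Q s :
  invariant s ->
  (forall x, x \in unzip1 path -> exists n, inner_at (hp s) x = Some n) ->
  (forall x, x != 0 -> wins s t x <= bumps s t x + (x \in unzip1 path)) ->
  (forall s', mono s s' -> invariant s' -> (forall x, wins s' t x = wins s t x) ->
     (forall x, inst s' t x = inst s t x) ->
     (forall x, x != 0 -> wins s' t x <= bumps s' t x) -> wp t (g tt) Q s') ->
  wp t (bind (bump_counts path) g) Q s.
Proof.
elim: path s => [|[m j] path IH] s I hi hw H.
  by apply: H => // [|x /hw]; [exact: mono_refl | rewrite addn0].
apply: wp_bindA; apply: wp_faa => s1 R1 I1.
have [n0 e0] := hi m (mem_head _ _).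
have [n1 e1 _] := heap_le_inner R1 e0.
exists (i_count n1); first by rewrite /= e1.
have [s2 [e2 G2 m2 [p2 w2 i2 f2 b2]]] := step_count t I1 e1.
have M2 := gsteps_mono I1 G2.
have M02 := mono_trans R1 M2.
exists s2; split=> // I2; apply: IH => //.
- move=> x xp; have [|n e] := hi x; first by rewrite inE xp orbT.
  by have [n' e' _] := heap_le_inner M02 e; exists n'.
- move=> x x0; rewrite b2 w2 (rely_wins R1) (rely_bumps R1).
  apply: leq_trans (hw x x0) _; rewrite inE -addnA leq_add2l.
  by case: eqP => // _; rewrite leq_addr.
- move=> s' M' I' w' i' b'; apply: H => //; first exact: mono_trans M'.
    by move=> x; rewrite w' w2 (rely_wins R1).
  by move=> x; rewrite i' i2 (rely_inst R1).
Qed.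

(* The situation of a thread that has counted its update at all nodes of the *)
(* path and examines the nodes rest that come after parent.                  *)
Definition settling t s (parent : ptr) (rest : seq (ptr * nat)) :=
  exists walked, [/\ chain (mk s) 0 walked parent,
    exists n, chain (mk s) parent rest n,
    forall x, x \in unzip1 rest -> exists n, inner_at (hp s) x = Some n,
    forall x, x \in 0 :: unzip1 walked -> inst s t x < wins s t x &
  [/\ forall x, x \in unzip1 rest -> inst s t x < wins s t x,
      forall x, x != 0 -> wins s t x <= bumps s t x &
      forall x n, x != 0 -> x \notin unzip1 rest ->
        inner_at (hp s) x = Some n -> 0 < wins s t x ->
        (rR * (i_initSize n)%:R <= (wins s t x)%:R)%R -> dead s x]].

Lemma settling_rely t s s' parent rest : invariant s -> rely t s s' ->
  settling t s parent rest -> settling t s' parent rest.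
Proof.
move=> I R [w [ch [n ch'] hi hb [hb' hw hd]]]; exists w.
have M := rely_mono R; split.
- by apply: chain_le ch => y q i; exact: mono_at.
- by exists n; apply: chain_le ch' => y q i; exact: mono_at.
- move=> x /hi [m e]; have [m' e' _] := heap_le_inner M e.
  by exists m'.
- by move=> x xw; rewrite (rely_wins R) (rely_inst R); exact: hb.
split=> [x xr|x x0|x m x0 xr e w0].
- by rewrite (rely_wins R) (rely_inst R); exact: hb'.
- by rewrite (rely_wins R) (rely_bumps R); exact: hw.
- have [n0 e0 <-] := wins_inner I R w0 e; rewrite (rely_wins R) in w0 *.
  by move=> le; apply: (mono_dead M); exact: hd e0 w0 le.
Qed.

(** The rest of the path hangs below [m], so the death of [m] settles all nodes not yet examined. *)
Lemma settling_dead t s parent m j rest : invariant s ->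
  settling t s parent ((m, j) :: rest) -> dead s m -> ready t s.
Proof.
move=> I [w [ch [n [mm ch']] hi hb [hb' hw hd]]] dm; split=> // x nx x0 e w0 le.
case: (boolP (x \in unzip1 ((m, j) :: rest))) => xr; last exact: hd e w0 le.
apply: dead_below dm; exact: chain_head_below ch' xr.
Qed.

(** Every outcome of the DCSS leaves [m] dead: it was replaced by another thread, or its parent is
    marked and therefore dead, or this thread replaces it. *)
Lemma wp_rebuild_first t parent rest s : invariant s ->
  settling t s parent rest ->
  wp t (rebuild_first rR T parent rest) (fun s' _ => ready t s') s.
Proof.
elim: rest parent s => [|[m j] rest IH] parent s I st.
  have [w [_ _ _ _ [_ hw hd]]] := st; split=> // x n x0; exact: hd.
have mm s' : settling t s' parent ((m, j) :: rest) -> mk s' m = At parent j.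
  by move=> [w [_ [n []]]].
have mi s' : settling t s' parent ((m, j) :: rest) ->
    exists n, inner_at (hp s') m = Some n.
  by move=> [w [_ _ hi _ _]]; apply: hi; exact: mem_head.
apply: wp_deref => s1 R1 I1.
have st1 := settling_rely I R1 st; have [n1 e1] := mi _ st1.
exists (Inner n1); first exact/inner_atP.
apply: wp_read => s2 R2 I2.
have st2 := settling_rely I1 R2 st1.
have [n2 e2 [in2 _ _ _ _]] := heap_le_inner R2 e1.
exists (i_count n2); first by rewrite /= e2.
have m0 s' : invariant s' -> settling t s' parent ((m, j) :: rest) -> m != 0.
  move=> I' /mm E; apply/eqP => m0; move: E; rewrite m0; exact: (root_not_at I').
case: ifP => le; last first.
  apply: IH => //; have [w [ch [n [mm' ch']] hi hb [hb' hw hd]]] := st2.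
  exists (rcons w (m, j)); split.
  - by apply/chain_rcons; exists parent.
  - by exists n.
  - by move=> x xr; apply: hi; rewrite inE xr orbT.
  - move=> x; rewrite /unzip1 map_rcons -rcons_cons mem_rcons inE => /orP [/eqP ->|xw].
      by apply: hb'; exact: mem_head.
    exact: hb.
  split=> // [x xr|x nx x0 xr e w0 le'].
    by apply: hb'; rewrite inE xr orbT.
  have [E|ne] := eqVneq x m; last first.
    by apply: hd e w0 le' => //; rewrite inE negb_or ne.
  (* By [wins <= bumps <= count], a count below the threshold leaves the wins below it as well. *)
  subst x; move: e; rewrite e2 => -[E]; subst nx.
  have h1 := hw _ x0; have h2 := inv_count I2 t e2.
  have : (rR * (i_initSize n1)%:R <= (i_count n2)%:R)%R.
    by rewrite -in2; apply: le_trans le' _; rewrite ler_nat; exact: leq_trans h2.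
  by rewrite le.
have DONE s3 : rely t s2 s3 -> invariant s3 -> dead s3 m -> ready t s3.
  by move=> R3 I3; apply: settling_dead I3 (settling_rely I2 R3 st2).
apply: wp_alloc => s3 R3 I3.
have st3 := settling_rely I2 R3 st2; have [n3 e3] := mi _ st3.
have ok : alloc_ok t s3 (Rebuild m None parent j) [::].
  by split=> //; split=> //; split=> //; [exact: mm | exists n3].
have [s4 [e4 G4 R4 o4]] := step_alloc I3 ok.
exists s4; split=> // I4.
have R24 := rely_trans R3 R4.
set op := size (hp s3) in o4 *.
have eop : onth (hp s4) op = Some (Rebuild m None parent j).
  by rewrite e4 onth_rcons eqxx.
apply: wp_dcss => s5 R5 I5.
have R25 := rely_trans R24 R5; have st5 := settling_rely I2 R25 st2.
have m5 := mm _ st5.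
have [c sl pc] := inv_cur I5 m5; have [n5 e5 ec5] := iffLR (slotP _ _ _ _) sl.
exists n5, (Some c); split=> //; split.
- move=> ne; apply: DONE => //; apply: dead_past.
  by case: pc => // E; case: ne; rewrite E.
- move=> stt; apply: DONE => //; apply: dead_step m5 _.
  exact (inv_status I5 e5 stt).
- move=> [E] stt; subst c.
  have [nt5 eop5 _] := heap_le_rebuild R5 eop.
  have [w [ch [n [_ ch']] hi hb [hb' hw hd]]] := st5.
  have [s6 [e6 G6 M6 p6 [o6 w6 b6]]] :=
    step_install I5 e5 ec5 stt eop5 (rely_own R5 o4) ch hb.
  exists s6; split=> // I6.
  have rd6 : ready t s6.
    have st6 : dead s6 m by exact: dead_past.
    split=> [x nx x0 ex w0 le'|x x0]; last by rewrite w6 b6; exact: hw.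
    have lx : x < size (hp s5).
      rewrite ltnNge; apply/negP => lx; case: (inv_alloc I5 lx) => _ /(_ t) [E _].
      by move: w0; rewrite w6 E.
    have [nx5 ex5 [in5 _ _ _ _]] := heap_le_inner_inv M6 lx ex.
    rewrite w6 in5 in w0 le'.
    case: (boolP (x \in unzip1 ((m, j) :: rest))) => xr; last first.
      by apply: (mono_dead M6); exact: hd ex5 w0 le'.
    apply: dead_below st6; apply: mono_below M6 _.
    exact: chain_head_below ch' xr.
  have le6 := mono_heap M6.
  rewrite -[help_rebuild _ _]bind_ret; apply: (wp_help_rebuild I6) => [||s' R' I'].
  + by exists parent, j.
  + by rewrite (heap_le_is_rebuild le6) ?/is_rebuild ?eop5 // (onth_ltn eop5).
  + exact: ready_rely I6 R' rd6.
Qed.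

Lemma wp_replacement t A (u : update_op) cur (g : option ptr -> prog A) Q s :
  invariant s ->
  (forall s' r, rely t s s' -> invariant s' ->
     (if r is Some r' then
        [/\ mk s' r' = Own t, full_at (hp s') r' & ~~ is_rebuild (hp s') r']
      else True) -> wp t (g r) Q s') ->
  wp t (bind (replacement u cur) g) Q s.
Proof.
move=> I H.
have LEAF (nd : node) (h : ptr -> prog A) s0 :
    (if nd is Empty then True else if nd is Single _ _ then True else False) ->
    (forall s1 s', rely t s0 s1 -> rely t s1 s' -> invariant s' ->
       [/\ size (hp s1) < size (hp s'), mk s' (size (hp s1)) = Own t,
         full_at (hp s') (size (hp s1)) & ~~ is_rebuild (hp s') (size (hp s1))] ->
       wp t (h (size (hp s1))) Q s') ->
    wp t (bind (alloc nd) h) Q s0.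
  move=> nl H'; apply: wp_alloc => s1 R1 I1.
  have ok : alloc_ok t s1 nd [::] by split=> //; split=> //; case: nd nl.
  have [s2 [e2 G2 R2 o2]] := step_alloc I1 ok.
  exists s2; split=> // I2; apply: H' => //; split=> //.
  - by rewrite e2 size_rcons.
  - by move=> n; rewrite e2 inner_at_rcons eqxx; case: nd nl {e2 ok}.
  - by rewrite /is_rebuild e2 onth_rcons eqxx; case: nd nl {e2 ok}.
case: u cur => [k v|k] [[k' v']|] /=.
- case: eqP => [_|_].
    apply: wp_bindA; apply: (LEAF) => // s1 s2 R1 R2 I2 [_ o f n].
    by apply: (H s2 (Some _)) => //; exact: rely_trans R2.
  set ab := if _ then _ else _; case: ab => a b.
  apply: wp_bindA; apply: (LEAF) => // s1 s2 R1 R2 I2 [l2 o2 f2 r2].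
  apply: wp_bindA; apply: (LEAF) => // s3 s4 R3 R4 I4 [l4 o4 f4 r4].
  apply: wp_bindA; apply: wp_alloc => s5 R5 I5.
  set x := size (hp s1) in l2 o2 f2 r2 *; set y := size (hp s3) in l4 o4 f4 r4 *.
  have R25 := rely_trans R3 (rely_trans R4 R5).
  have xy : x < y by apply: leq_trans l2 _; exact: mono_size R3.
  pose n := MkInner 2 2 [:: Some b.1] [:: Some x; Some y] clean 0 0 : inner.
  have wf : wf_inner n by split=> // -[|[|i]] //= c _; exists b.1.
  have uq : uniq [:: x; y] by rewrite /= inE andbT neq_ltn xy.
  have hc c : c \in [:: x; y] -> [/\ mk s5 c = Own t, full_at (hp s5) c &
                                     ~~ is_rebuild (hp s5) c].
    rewrite !inE => /orP [] /eqP ->; split.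
    - exact (rely_own R25 o2).
    - exact: full_at_mono R25 l2 f2.
    - by rewrite (heap_le_is_rebuild R25 l2).
    - exact (rely_own R5 o4).
    - exact: full_at_mono R5 l4 f4.
    - by rewrite (heap_le_is_rebuild R5 l4).
  have [s6 [e6 G6 M6 o6 [ow6 w6 b6 i6 f6]]] :=
    step_alloc_children I5 uq hc wf erefl erefl.
  exists s6; split=> // I6; apply: (H s6 (Some _)) => //.
    have R05 := rely_trans R1 (rely_trans R2 R25).
    have [Ma Mb Mc Md Me Mf] := R05; split.
    + exact: mono_trans M6.
    + move=> z mz; apply: ow6; last exact: Mb.
      have lz : z < size (hp s) by apply: inv_allocated I _; rewrite mz.
      have lx : size (hp s) <= x := mono_size R1.
      have lzx := leq_trans lz lx.
      by rewrite !inE negb_or !neq_ltn lzx (ltn_trans lzx xy).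
    + by move=> z; rewrite w6.
    + by move=> z; rewrite b6.
    + by move=> z; rewrite i6.
    + by rewrite f6.
  split=> //; last by rewrite /is_rebuild e6 onth_rcons eqxx.
  by move=> n'; rewrite e6 inner_at_rcons eqxx => -[<-].
- apply: wp_bindA; apply: (LEAF) => // s1 s2 R1 R2 I2 [_ o f n].
  by apply: (H s2 (Some _)) => //; exact: rely_trans R2.
- case: eqP => [_|_]; last by apply: (H s None) => //; exact: rely_refl.
  apply: wp_bindA; apply: (LEAF) => // s1 s2 R1 R2 I2 [_ o f n].
  by apply: (H s2 (Some _)) => //; exact: rely_trans R2.
- by apply: (H s None) => //; exact: rely_refl.
Qed.

Lemma walking_ready t s n path : walking t s n path ->
  ready t s /\ fin s t = false.
Proof.
move=> [_ _ _ hf [wb [D [h0 h1 _ _]]]]; split=> //; split=> // x nx x0 e w0 le.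
by apply: h0; exact: h1 e w0 le.
Qed.

Lemma wp_restart t (u : update_op) s :
  ready t s -> fin s t = false -> invariant s ->
  wp t (call (PUpdate u ist_root [::])) (fun s' _ => ready t s') s.
Proof.
move=> rd f0 I; apply: wp_tailcall => s1 R1 I1; split; last by move=> ? ? ? [].
by apply: (ready_walking I1); [exact (ready_rely I R1 rd) | rewrite (rely_fin R1)].
Qed.

Lemma wp_replace_child t (u : update_op) n path i c cur s :
  invariant s -> walking t s n path ->
  mk s c = At n i ->
  wp t (replace_child rR T u n path i c cur) (fun s' _ => ready t s') s.
Proof.
move=> I wk mc; apply: wp_replacement => // s1 r R1 I1 hr.
have wk1 := walking_rely I R1 wk.
case: r hr => [r|_]; last by case: (walking_ready wk1).
move=> [o1 f1 r1].
have l1 : r < size (hp s1) by apply: inv_allocated I1 _; rewrite o1.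
apply: wp_dcss => s2 R2 I2.
have wk2 := walking_rely I1 R2 wk1.
have m2 := mono_at (rely_trans R1 R2) mc.
have [c' sl _] := inv_cur I2 m2; have [n2 e2 ec2] := iffLR (slotP _ _ _ _) sl.
exists n2, (Some c'); split=> //; split.
- move=> _; apply: wp_tailcall => s3 R3 I3; split; first exact (walking_rely I2 R3 wk2).
  by move=> ? ? ? [].
- by move=> _; have [rd hf] := walking_ready wk2; exact: wp_restart.
- move=> [E] st; subst c'.
  have [ch [nn en] hi hf [wb [D [h0 h1 h2 h3]]]] := wk2.
  have r2 : ~~ is_rebuild (hp s2) r.
    by rewrite (heap_le_is_rebuild R2 l1).
  have xn0 x : x \in unzip1 path -> x != 0.
    move=> /(chain_mem_at ch) [q [j mx]]; apply/eqP => E; move: mx; rewrite E.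
    exact: (root_not_at I2).
  (* At the threshold, [x] would have been dead when the walk started, hence in [D], which the path
     avoids. *)
  have hw x m : x \in unzip1 path -> inner_at (hp s2) x = Some m ->
      0 < wins s2 t x -> ((wins s2 t x)%:R < rR * (i_initSize m)%:R)%R.
    move=> xp ex w0; rewrite ltNge; apply/negP => le.
    apply: (h3 x); first by rewrite inE xp orbT.
    by apply: h1 ex w0 le; exact: xn0.
  have [s3 [e3 G3 M3 b3 [i3 w3]]] :=
    step_update I2 e2 ec2 st (full_at_mono R2 l1 f1) r2
      (rely_own R2 o1) ch hw hf.
  exists s3; split=> // I3; apply: wp_bump => //.
  + by move=> x /hi [m em]; have [m' em' _] := heap_le_inner M3 em; exists m'.
  + by move=> x x0; rewrite b3 w3 inE (negbTE x0) leq_add2r; exact: wb.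
  move=> s4 M4 I4 w4 i4 b4; apply: wp_rebuild_first => //.
  have M24 := mono_trans M3 M4.
  exists [::]; split=> //.
  + by exists n; apply: chain_le ch => y q j; exact: mono_at.
  + by move=> x /hi [m em]; have [m' em' _] := heap_le_inner M24 em; exists m'.
  (* The win just recorded makes [inst <= wins] strict, which pays for one installation. *)
  + move=> x; rewrite w4 w3 i4 i3 !inE => /eqP ->; rewrite eqxx addn1 ltnS.
    exact (inv_inst I2 _ _).
  split=> // [x xp|x m x0 xp em].
    rewrite w4 w3 i4 i3 inE xp orbT addn1 ltnS; exact (inv_inst I2 _ _).
  rewrite w4 w3 inE (negbTE x0) (negbTE xp) addn0 => w0 le.
  apply: (mono_dead M24).
  have lx : x < size (hp s2).
    rewrite ltnNge; apply/negP => lx; case: (inv_alloc I2 lx) => _ /(_ t) [E _].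
    by move: w0; rewrite E.
  have [m2' em2 [im _ _ _ _]] := heap_le_inner_inv M24 lx em.
  by apply: h0; apply: h1 em2 w0 _; rewrite // -im.
Qed.

Lemma wp_update t (u : update_op) n path s : invariant s -> walking t s n path ->
  wp t (update_body rR T u n path) (fun s' _ => ready t s') s.
Proof.
move=> I wk.
have vis s' : invariant s' -> walking t s' n path -> n = 0 \/ att s' n.
  move=> I' [ch _ _ _ _]; move: (chain_bel ch) => B.
  by case: B => [|k q i x e _]; [left | right; exists q, i].
have [ch [nn en] _ _ _] := wk.
have sz : sized s n (size (i_children nn)) by exists nn.
apply: (wp_search _ (vis _ I wk) sz) => s1 i R1 I1 lt.
apply: wp_read_ptr => s2 R2 I2.
have R02 := rely_trans R1 R2; have wk2 := walking_rely I R02 wk.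
have [n2 e2 sz2] := sized_mono R02 sz.
have [|c sl mc] := full_child_slot (i := i) I2 (vis _ I2 wk2) e2; first by rewrite sz2.
exists c => //; apply: wp_deref => s3 R3 I3.
have wk3 := walking_rely I2 R3 wk2.
have m3 := mono_at R3 mc.
have [nd e3] := att_node I3 (or_intror (ex_intro _ n (ex_intro _ i m3))).
exists nd => //.
case: nd e3 => [|k v|nc|u' nt q j] e3.
- exact: wp_replace_child.
- exact: wp_replace_child.
- apply: wp_tailcall => s4 R4 I4; split; last by move=> ? ? ? [].
  have [nc2 ec2 _] := heap_le_inner_inv R3
    (at_allocated I2 mc) (iffRL (inner_atP _ _ _) e3).
  apply: (walking_rely I2 _ (walking_step I2 wk2 sl ec2)).
  exact: rely_trans R4.
- apply: (wp_help_rebuild I3) => [||s4 R4 I4].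
  + by exists n, i.
  + by rewrite /is_rebuild e3.
  + have [rd hf] := walking_ready (walking_rely I3 R4 wk3).
    exact: wp_restart.
Qed.

(** Calls inside a body are judged by their contracts alone, so this is partial correctness;
    termination is the subject of [term]. *)
Lemma wp_body t (f : proc) s : invariant s -> pre t f s ->
  wp t (body f) (fun s' r => @post t f s s' r) s.
Proof.
case: f => [u n path|k n|u|u deg|op kc nt|u] I pr /=.
- by apply: wp_weaken (wp_update u I pr) => // s' a I' M rd.
- exact: wp_lookup.
- exact: wp_mcc.
- exact: wp_mark.
- exact: wp_fill.
- exact: wp_collect.
Qed.

(** * Annotated executions *)

(** By the second clause the return of a lookup leaves [fin] unchanged, so [fin] drops only when an
    update completes. *)
Definition result_ok t (o : operation) s :=
  ready t s /\ (is_lookup o -> fin s t = false).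

Definition thread_ok t s (x : thread) : Prop :=
  match x with
  | Idle => ready t s /\ fin s t = false
  | Running o m => wp t m (fun s' _ => result_ok t o s') s
  end.

Definition config_ok (c : config) s :=
  [/\ hp s = Defs.mem c, invariant s & forall t, thread_ok t s (thr c t)].

Definition reset t s : state :=
  St (hp s) (mk s) (past s) (wins s) (bumps s) (inst s)
     (fun t' => if t' == t then false else fin s t').

Definition gtrans t s s' := gsteps t s s' \/ s' = reset t s.

Lemma reset_invariant t s : invariant s -> invariant (reset t s).
Proof. by case=> *; split. Qed.

Lemma reset_mono t s : mono s (reset t s).
Proof. by split=> //= *; [exact: heap_le_refl | exact: mark_le_refl]. Qed.

Lemma reset_rely t t' s : t' != t -> rely t' s (reset t s).
Proof. by move=> ne; split=> //=; [exact: reset_mono | rewrite (negbTE ne)]. Qed.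

Lemma gtrans_invariant t s s' : invariant s -> gtrans t s s' -> invariant s'.
Proof.
by move=> I [G|->]; [exact: gsteps_invariant _ _ _ I G | exact: reset_invariant].
Qed.

Lemma gtrans_mono t s s' : invariant s -> gtrans t s s' -> mono s s'.
Proof.
by move=> I [G|->]; [exact: gsteps_mono _ _ _ I G | exact: reset_mono].
Qed.

Lemma gtrans_rely t t' s s' : invariant s -> gtrans t s s' -> t' != t ->
  rely t' s s'.
Proof.
move=> I [G|->] ne; first exact: gsteps_rely _ _ _ _ I G ne.
exact: reset_rely.
Qed.

Lemma result_ok_rely t o s s' : invariant s -> rely t s s' ->
  result_ok t o s -> result_ok t o s'.
Proof.
by move=> I R [rd hf]; split; [exact (ready_rely I R rd) | rewrite (rely_fin R)].
Qed.

Lemma thread_ok_rely t s s' x : invariant s -> rely t s s' ->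
  thread_ok t s x -> thread_ok t s' x.
Proof.
move=> I R; case: x => [|o m] /=.
  by move=> [rd hf]; split; [exact (ready_rely I R rd) | rewrite (rely_fin R)].
apply: wp_rely => // a; exact (result_ok_rely I R).
Qed.

(** Soundness of [wp]: a call is unfolded by [wp_body] and [wp_bind], an action consumes one layer
    of [wp], and an invalid access contradicts the existence of an outcome. *)
Lemma thread_step_ok t s h x h' x' :
  thread_step rR T h x h' x' -> hp s = h -> invariant s -> thread_ok t s x ->
  exists s', [/\ hp s' = h', gtrans t s s', thread_ok t s' x' &
    fin s t -> ~~ fin s' t -> running (@is_update d K V) x /\ x' = Idle].
Proof.
have same : gtrans t s s by left; exact: GRefl.
have fs (P : Prop) : fin s t -> ~~ fin s t -> P by move=> ->.
case=> [o|o a|o f k|o c k r h1 st|o c k inv|o] eh I ok; try by case: ok.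
- case: ok => rd f0; exists s; split=> //=; last exact: fs.
  case: o => [k v|k|k].
  + apply: (wp_weaken I _ (wp_restart (Ins k v) rd f0 I)).
    by move=> s' a I' M rd'; split.
  + apply: (wp_weaken I _ (wp_restart (Del k) rd f0 I)).
    by move=> s' a I' M rd'; split.
  + apply: wp_tailcall => s1 R1 I1; split; first by left.
    move=> s2 r I2 R2; have R := rely_trans R1 R2.
    by split; [exact (ready_rely I R rd) | rewrite (rely_fin R)].
- exists (reset t s); split=> //=; first by right.
    by case: ok => rd hf; split=> //=; rewrite eqxx.
  move=> f1 _; split=> //; move: ok => [_]; rewrite /is_lookup.
  by case: (is_update o) => // /(_ isT); rewrite f1.
- exists s; split=> //=; last exact: fs.
  move: ok => /= ok; have [pr H] := ok s (rely_refl _ _) I.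
  apply: wp_bind; apply: (wp_weaken I _ (wp_body I pr)).
  by move=> s' a I' M po; exact: H.
- rewrite -eh in st; move: ok => /= ok; have [_ H] := ok s (rely_refl _ _) I.
  have [s' [e G w]] := H _ _ st; exists s'; split=> //; first by left.
  have : fin s t -> fin s' t; last by move=> hf f1; rewrite hf.
  elim: G {st H e w ok same fs I eh} => // a b c' G _ IH fa; apply: IH.
  case: G fa => //= q i c0 r0 n w' i' f' _ _ _ _ sk; case: sk => //=.
  by rewrite eqxx.
- exfalso; rewrite -eh in inv; move: ok => /= ok.
  by have [[r [h2 st]] _] := ok s (rely_refl _ _) I; exact: inv st.
Qed.

Lemma step_ok (c c' : config) t s : config_ok c s -> step rR T t c c' ->
  exists s', config_ok c' s' /\ gtrans t s s' /\
    forall t', fin s t' -> ~~ fin s' t' ->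
      [/\ t' = t, running (@is_update d K V) (thr c t) & thr c' t = Idle].
Proof.
move=> [eh I ok] [st same].
have [s' [e G tok hf]] := thread_step_ok st eh I (ok t).
have I' := gtrans_invariant I G.
exists s'; split; [split=> // t'|split=> // t' f1 f2].
  have [->//|ne] := eqVneq t' t; rewrite same //.
  exact: thread_ok_rely I (gtrans_rely I G ne) (ok t').
have [E|ne] := eqVneq t' t; first by subst t'; case: (hf f1 f2).
by move: f2; rewrite (rely_fin (gtrans_rely I G ne)) f1.
Qed.

Lemma initial_ok (c : config) : initial c -> exists s, config_ok c s.
Proof.
move=> [em idle].
pose m x : mark p := if x == 0 then Root else if x == 1 then At 0 0 else Free.
pose s := @St (Defs.mem c) m (fun _ => false) (fun _ _ => 0) (fun _ _ => 0)
  (fun _ _ => 0) (fun _ => false).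
have inn x n : inner_at (hp s) x = Some n ->
    x = 0 /\ n = MkInner 0 1 [::] [:: Some 1] clean 0 0.
  by rewrite /inner_at /= em; case: x => [[<-]|[|x]] //=; rewrite onth0n.
exists s; split=> //; last by move=> t; rewrite idle; split=> //; split.
split=> /=.
- by split=> //; rewrite /inner_at em /=; eexists.
- by move=> x; rewrite /m; case: eqP => // _; case: eqP.
- by move=> x; rewrite em /=; case: x => [|[|x]].
- by [].
- move=> q i x /slotP [n /inn [-> ->]].
  by case: i => [[<-]|i] //=; rewrite onth0n.
- move=> q i x; rewrite /m; case: eqP => // _; case: eqP => // -> [<- <-].
  by exists 1; [rewrite /slot /inner_at em | right].
- by move=> x n /inn [_ ->]; split=> // -[|i] c' //=.
- by move=> x q i _ n /inn [_ ->].
- by move=> x n /inn [_ ->].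
- by move=> x n /inn [_ ->].
- by move=> x u nt q i; rewrite em; case: x => [|[|x]] //=; rewrite onth0n.
- by [].
- by move=> t x n x0 /inn [E]; rewrite E in x0.
- by [].
Qed.

Lemma dependent_choice (A : Type) (P : nat -> A -> Prop)
    (Q : nat -> A -> A -> Prop) :
  (exists a, P 0 a) ->
  (forall n a, P n a -> exists a', P n.+1 a' /\ Q n a a') ->
  exists f : nat -> A, forall n, P n (f n) /\ Q n (f n) (f n.+1).
Proof.
move=> H0 HS; have [a0 h0] := cid H0.
pose next n (x : {a | P n a}) : {a | P n.+1 a} :=
  let y := cid (HS n (sval x) (svalP x)) in exist _ (sval y) (svalP y).1.
pose f := fix f n : {a | P n a} :=
  if n is n'.+1 then next n' (f n') else exist _ a0 h0.
exists (fun n => sval (f n)) => n; split; first exact: svalP.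
exact: (svalP (cid (HS n (sval (f n)) (svalP (f n))))).2.
Qed.

Lemma ghost_trace (sch : nat -> 'I_p) (e : nat -> config) :
  execution rR T sch e ->
  exists g : nat -> state, forall n, config_ok (e n) (g n) /\
    gtrans (sch n) (g n) (g n.+1) /\
    forall t, fin (g n) t -> ~~ fin (g n.+1) t ->
      [/\ t = sch n, running (@is_update d K V) (thr (e n) (sch n)) &
          thr (e n.+1) (sch n) = Idle].
Proof.
move=> [i0 st]; apply: (dependent_choice (P := fun n s => config_ok (e n) s)
  (Q := fun n s s' => gtrans (sch n) s s' /\ forall t, fin s t -> ~~ fin s' t ->
      [/\ t = sch n, running (@is_update d K V) (thr (e n) (sch n)) &
          thr (e n.+1) (sch n) = Idle])).
  exact: initial_ok.
by move=> n s ok; exact: step_ok ok (st n).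
Qed.

(** * Boundedness of subtrees *)

Lemma root_unattached s : invariant s -> forall q i, mk s 0 <> At q i.
Proof. by move=> I q i; exact: (root_not_at I). Qed.

Lemma below_root s a : invariant s -> below (mk s) a 0 -> a = 0.
Proof.
move=> I [k b].
have H x : bel (mk s) a k x -> x = 0 -> a = 0; last exact: H b erefl.
by case=> [//|k' q i y e _ E]; move: e; rewrite E => /(root_not_at I).
Qed.

(** A node that already hangs from the root has all its ancestors marked [At], and these marks
    persist, so it can acquire no new ancestor. *)
Lemma mono_below_root s s' a x : mono s s' -> invariant s' ->
  below (mk s) 0 x -> below (mk s') a x -> below (mk s) a x.
Proof.
move=> M I [k b]; elim: b => {k x} [|k q i x e _ IH] b.
  by rewrite (below_root I b); exact: below_refl.
case: (below_inv (mono_at M e) b) => [->|/IH]; first exact: below_refl.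
exact: below_step e.
Qed.

Lemma below_between s y x : invariant s -> below (mk s) 0 x ->
  below (mk s) y x -> below (mk s) 0 y.
Proof.
move=> I [k b]; elim: b => {k x} [/(below_root I) ->|k q i x e b IH by_].
  exact: below_refl.
by case: (below_inv e by_) => [<-|/IH //]; apply: below_step e _; exists k.
Qed.

Lemma below_unchanged (m m' : ptr -> mark p) a x :
  (forall y, below m' a y -> y <> a -> m' y = m y) ->
  below m' a x -> below m a x.
Proof.
move=> H [k b]; elim: b => {k x} [|k q i x e b IH]; first exact: below_refl.
have [->|/eqP ne] := eqVneq x a; first exact: below_refl.
have bx : below m' a x by apply: below_step e _; exists k.
by rewrite (H x bx ne) in e; exact: below_step e IH.
Qed.

Lemma below_at (m : ptr -> mark p) a x : below m a x ->
  x = a \/ exists q i, m x = At q i.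
Proof.
by move=> [k [|k' q i y e _]]; [left | right; exists q, i].
Qed.

Lemma below_visible s a x : a = 0 \/ att s a -> below (mk s) a x ->
  x = 0 \/ att s x.
Proof.
move=> va [k b]; case: b => [//|k' q i y e _]; by right; exists q, i.
Qed.

Definition counted s s' a :=
  exists t, wins s t a < wins s' t a \/ inst s t a < inst s' t a.

(** A completion is not charged to any counter; instead it uses up a Rebuild node present below
    [a]. *)
Definition completed s s' a := exists op,
  [/\ is_rebuild (hp s) op, below (mk s) a op, ~~ past s op & past s' op].

(** Only a swap below [a] can enlarge the subtree of [a]. The path of an update or installation
    leads from the root through [a] and raises a counter there; the remaining case is a
    completion. *)
Lemma gstep_below t s s' a : invariant s -> gstep t s s' ->
  a = 0 \/ att s a ->
  (forall x, below (mk s') a x -> below (mk s) a x) \/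
  counted s s' a \/ completed s s' a.
Proof.
move=> I G va; have M := gstep_mono I G; have I' := gstep_invariant I G.
case: G M I' => [x n n' b _ _ _ _|nd cs ok|q i c r n w' i' f' e ec st fl sk|
    op u q i r e m mr sh|q i n r x e ec st fl nr mr mq hk] M I' //.
- by left.
- left=> x; apply: below_unchanged => y by_ ya /=.
  have na : a != size (hp s).
    apply/eqP => E; have [f _] := inv_alloc I (leqnn (size (hp s))).
    case: va => [E0|[q [i e]]]; first by move: (inv_root I).1; rewrite -E0 E f.
    by move: e; rewrite E f.
  have nnew z : below (mk (push_node t s nd cs)) a z -> z <> size (hp s).
    move=> /below_at [->|[q [i e']]]; first exact/eqP.
    by move=> E; move: e'; rewrite /= E eqxx.
  have := nnew y by_; case: eqP => // _ _; case: ifP => // yc.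
  case: (below_inv (q := size (hp s)) (i := index y cs) _ by_) => /=.
  + case: eqP => [E|_]; last by rewrite yc.
    by case: (nnew y by_).
  + by move=> E; case: ya.
  + by move=> /nnew.
- have sl : slot (hp s) q i = Some (Some c) by apply/slotP; exists n.
  have [mc npc] := inv_slot I sl.
  have BACK : below (mk s) 0 q -> ~ below (mk s) a q ->
      forall x, below (upd1 (mk s) r (At q i)) a x -> below (mk s) a x.
    move=> b0 nb x; apply: below_unchanged => y by_ ya.
    rewrite /upd1; case: eqP => // E; subst y; case: nb.
    apply: (mono_below_root M I') => //=.
    case: (below_inv (q := q) (i := i) _ by_) => //.
    by rewrite /upd1 eqxx.
  case: sk M I' BACK => [path ch _ _ _ _|path nt j ch _ er mr _|u j eop] M I' BACK.
  + have b0 : below (mk s) 0 q by exists (size path); exact: chain_bel.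
    have [bq|nb] := pselect (below (mk s) a q); last by left; exact: BACK.
    right; left; exists t; left=> /=.
    by rewrite /incr eqxx (chain_below_mem (root_unattached I) ch bq) addn1.
  + have b0 : below (mk s) 0 q by exists (size path); exact: chain_bel.
    have [bq|nb] := pselect (below (mk s) a q); last by left; exact: BACK.
    right; left; exists t; right=> /=.
    by rewrite /incr eqxx (chain_below_mem (root_unattached I) ch bq) addn1.
  + have [_ _ /(_ _ _ mc) [_ _ _ b0c] _] := inv_rebuild I eop.
    have b0 : below (mk s) 0 q.
      case: (below_inv mc b0c) => // E.
      by move: mc; rewrite E => /(root_not_at I).
    have [bq|nb] := pselect (below (mk s) a q); last by left; exact: BACK.
    right; right; exists c; split=> //=.
    * by rewrite /is_rebuild eop.
    * exact: below_step mc bq.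
    * by rewrite /upd1 eqxx.
- left=> x; apply: below_unchanged => y /below_at [//|[q' [i' my]]] _.
  by move: my; rewrite /= /upd1; case: eqP.
- left=> y; apply: below_unchanged => z bz za; rewrite /= /upd1.
  case: eqP => // E; subst z.
  case: (below_inv (q := q) (i := i) _ bz) => [|E|[k b]]; first by rewrite /= /upd1 eqxx.
    by case: za.
  (* A node under construction is reserved, hence neither attached nor the root, and so not below
     [a]. *)
  have mq' : upd1 (mk s) r (At q i) q = Res x.
    by rewrite /upd1; case: eqP => // E; move: mq; rewrite E mr.
  case: (below_at (ex_intro _ k b)) => [E|[q' [i' /= e']]]; last by rewrite mq' in e'.
  case: va => [E'|[q' [i' e']]]; last by rewrite -E mq in e'.
  by move: (inv_root I).1; rewrite -E' -E mq.
Qed.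

(** Rebuild nodes become attached by installations only, and these raise [inst] along their path. *)
Lemma gstep_rebuild t s s' a op : invariant s -> gstep t s s' ->
  a = 0 \/ att s a -> is_rebuild (hp s') op -> below (mk s') a op ->
  below (mk s) a op \/ counted s s' a.
Proof.
move=> I G va ro bo; have M := gstep_mono I G; have I' := gstep_invariant I G.
have [E|nE] := eqVneq op a; first by left; rewrite E; exact: below_refl.
have [q [i m]] : att s' op.
  by case: (below_at bo) nE => [->|//]; rewrite eqxx.
have OLD q' i' : mk s op = At q' i' -> below (mk s) a op.
  move=> m0; apply: (mono_below_root M I') => //.
  have lt := at_allocated I m0.
  rewrite (heap_le_is_rebuild M lt) in ro.
  have [u [nt [q0 [i0 e0]]]] := is_rebuildP _ _ ro.
  by have [_ _ /(_ _ _ m0) [_ _ _ ?] _] := inv_rebuild I e0.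
have lt0 : (exists t, mk s op = Own t) \/ (exists x, mk s op = Res x) -> op < size (hp s).
  by move=> h; apply: inv_allocated I _; case: h => [[? ->]|[? ->]].
case: G M I' ro bo m OLD => [x n n' b _ _ _ _|nd cs ok|q0 i0 c r n w' i' f' e ec st fl sk|
    op0 u q0 i0 r e m mr sh|q0 i0 n r x e ec st fl nr mr mq hk] M I' ro bo mo OLD.
- by left; exact: OLD mo.
- left; move: mo => /=; case: eqP => // ne; case: ifP => [oc|_ mo]; last exact: OLD mo.
  case: ok => _ ow [nr _]; have [om _] := ow _ oc.
  have := nr _ oc; rewrite -(heap_le_is_rebuild M) ?ro //.
  by apply: lt0; left; exists t.
- move: (mo); rewrite /= /upd1; case: eqP => [E _|_ mo']; last by left; exact: OLD mo'.
  subst op.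
  case: sk M I' ro bo OLD mo => [path ch _ _ nr mr|path nt j ch _ er mr _|u j eop] M I' ro bo OLD mo.
  + move: ro; rewrite (heap_le_is_rebuild M) ?(negbTE nr) //.
    by apply: lt0; left; exists t.
  + right; exists t; right=> /=.
    have bq : below (mk s) a q0.
      apply: (mono_below_root M I'); first by exists (size path); exact: chain_bel.
      case: (below_inv (q := q0) (i := i0) _ bo) => [|E|//]; first by rewrite /= /upd1 eqxx.
      by rewrite E eqxx in nE.
    by rewrite /incr eqxx (chain_below_mem (root_unattached I) ch bq) addn1.
  + have [_ _ _ /(_ _ erefl) [[kc [_ nr _ _]] _]] := inv_rebuild I eop.
    move: ro; rewrite (heap_le_is_rebuild M) ?(negbTE nr) //.
    have sl : slot (hp s) q0 i0 = Some (Some c) by apply/slotP; exists n.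
    have [mc npc] := inv_slot I sl.
    have [_ _ _ /(_ _ erefl) [_ [mr|[_ pc]]]] := inv_rebuild I eop.
      by apply: lt0; right; exists c.
    by rewrite pc in npc.
- by move: (mo); rewrite /= /upd1; case: eqP => // _ mo'; left; exact: OLD mo'.
- move: (mo); rewrite /= /upd1; case: eqP => [E _|_ mo']; last by left; exact: OLD mo'.
  subst op; move: ro; rewrite (heap_le_is_rebuild M) ?(negbTE nr) //.
  by apply: lt0; left; exists t.
Qed.

Lemma gstep_counters t s s' t' x : gstep t s s' ->
  wins s t' x <= wins s' t' x /\ inst s t' x <= inst s' t' x.
Proof.
case=> // q i c r n w' i' f' _ _ _ _ sk.
by case: sk => *; rewrite /= /incr ?leq_addr.
Qed.

Lemma gsteps_counters t s s' t' x : gsteps t s s' ->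
  wins s t' x <= wins s' t' x /\ inst s t' x <= inst s' t' x.
Proof.
elim=> // s1 s2 s3 G _ [h1 h2]; have [h3 h4] := gstep_counters t' x G.
by split; [exact: leq_trans h1 | exact: leq_trans h2].
Qed.

Lemma gsteps_events t s s' a : invariant s -> gsteps t s s' ->
  a = 0 \/ att s a ->
  [\/ counted s s' a, completed s s' a |
     (forall x, below (mk s') a x -> below (mk s) a x)] /\
  (counted s s' a \/
     forall op, is_rebuild (hp s') op -> below (mk s') a op -> below (mk s) a op).
Proof.
move=> I G; elim: G I => [s0 _ _|s1 s2 s3 G G' IH I va].
  by split; [constructor 3 | right].
have M := gstep_mono I G; have I2 := gstep_invariant I G.
have va2 : a = 0 \/ att s2 a.
  by case: va => [->|h]; [left | right; exact: att_mono M h].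
have [h3 h4] := IH I2 va2.
have M' := gsteps_mono I2 G'.
have CL : counted s1 s2 a -> counted s1 s3 a.
  move=> [t' h]; exists t'; have [k1 k2] := gsteps_counters t' a G'.
  by case: h => h; [left; exact: leq_trans k1 | right; exact: leq_trans k2].
have CR : counted s2 s3 a -> counted s1 s3 a.
  move=> [t' h]; exists t'; have [k1 k2] := gstep_counters t' a G.
  by case: h => h; [left; exact: leq_ltn_trans h | right; exact: leq_ltn_trans h].
split.
- case: (gstep_below I G va) => [b|[c|[op [ro bo np po]]]].
  + case: h3 => [c|[op [ro bo np po]]|b'].
    * by constructor 1; exact: CR.
    * constructor 2; exists op; split=> //; last first.
      - by apply: contra np => /(mono_past M).
      - exact: b.
      - have vo := below_visible va (b _ bo).
        have [nd e] := att_node I vo.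
        by rewrite -(heap_le_is_rebuild M (onth_ltn e)).
    * by constructor 3=> x /b' /b.
  + by constructor 1; exact: CL.
  + by constructor 2; exists op; split=> //; exact: (mono_past M').
- case: h4 => [c|h4]; first by left; exact: CR.
  have [c|nc] := pselect (counted s1 s2 a); first by left; exact: CL.
  right=> op ro bo; have bo2 := h4 op ro bo.
  have vo := below_visible va2 bo2; have [nd e] := att_node I2 vo.
  rewrite (heap_le_is_rebuild M' (onth_ltn e)) in ro.
  by case: (gstep_rebuild I G va ro bo2).
Qed.

Lemma gtrans_events t s s' a : invariant s -> gtrans t s s' ->
  a = 0 \/ att s a -> ~ counted s s' a ->
  (completed s s' a \/ forall x, below (mk s') a x -> below (mk s) a x) /\
  (forall op, is_rebuild (hp s') op -> below (mk s') a op -> below (mk s) a op).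
Proof.
move=> I [G|->] va nc; last by split=> //; right.
have [h1 h2] := gsteps_events I G va.
by split; [case: h1 => // h; [left | right] | case: h2].
Qed.

Lemma gtrans_counters t s s' t' x : gtrans t s s' ->
  wins s t' x <= wins s' t' x /\ inst s t' x <= inst s' t' x.
Proof. by move=> [/gsteps_counters|-> //]; apply. Qed.

Lemma nondecreasing_constant (f : nat -> nat) B :
  (forall n, f n <= f n.+1) -> (forall n, f n <= B) ->
  exists N, forall n, N <= n -> f n = f N.
Proof.
move=> mf hf.
have lef : {homo f : m n / m <= n} := homo_leq leqnn leq_trans mf.
have [b] : exists b, forall N, exists2 n, N <= n & B - f n <= b.
  by exists B => N; exists N => //; exact: leq_subr.
elim: b => [|b IH] hb.
  have [n0 _ h0] := hb 0; exists n0 => n le.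
  by have := lef _ _ le; have := hf n; lia.
have [h|h] := pselect (forall N, exists2 n, N <= n & B - f n <= b).
  exact: IH.
have [N hN] : exists N, forall n, N <= n -> b < B - f n.
  apply: contrapT => h'; apply: h => N; apply: contrapT => h2; apply: h'.
  exists N => n le; rewrite ltnNge; apply/negP => le2; apply: h2.
  by exists n.
have [n0 le0 h0] := hb N; exists n0 => n le.
have := lef _ _ le; have := hN n (leq_trans le0 le); lia.
Qed.

Lemma nondecreasing_family_constant (I : finType) (f : nat -> I -> nat) B :
  (forall n i, f n i <= f n.+1 i) -> (forall n i, f n i <= B) ->
  exists N, forall n, N <= n -> forall i, f n i = f N i.
Proof.
move=> mf hf.
have H i : exists N, forall n, N <= n -> f n i = f N i.
  by apply: (@nondecreasing_constant (fun n => f n i) B).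
have [N hN] := fin_all_exists H.
exists (\max_i N i) => n le i.
have li : N i <= \max_i N i by exact: leq_bigmax.
by rewrite (hN i n (leq_trans li le)) (hN i _ li).
Qed.

(** * Finite growth from bounded counters *)

Section Stabilization.

Variables (sch : nat -> 'I_p) (g : nat -> state).
Hypothesis gI : forall n, invariant (g n).
Hypothesis gT : forall n, gtrans (sch n) (g n) (g n.+1).

Lemma trace_mono m n : m <= n -> mono (g m) (g n).
Proof.
elim: n => [|n IH]; first by rewrite leqn0 => /eqP ->; exact: mono_refl.
rewrite leq_eqVlt => /orP [/eqP ->|/IH h]; first exact: mono_refl.
exact: mono_trans h (gtrans_mono (gI n) (gT n)).
Qed.

Lemma trace_wins m n t x : m <= n -> wins (g m) t x <= wins (g n) t x.
Proof.
apply: (homo_leq (f := fun n => wins (g n) t x) leqnn leq_trans) => {}n.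
by case: (gtrans_counters t x (gT n)).
Qed.

Lemma past_constant M : exists N, forall n x, N <= n -> x < M ->
  past (g n) x = past (g N) x.
Proof.
have [|n x|N hN] :=
  @nondecreasing_family_constant _ (fun n (x : 'I_M) => past (g n) x : nat) 1.
- move=> n x; have := mono_past (trace_mono (leqnSn n)) (x := x).
  by case: (past (g n) x) => // ->.
- by case: (past _ _).
exists N => n x le lt; have := hN n le (Ordinal lt).
by rewrite /=; do 2!case: (past _ _).
Qed.

(* The counters wins and inst at a are bounded, hence eventually constant.    *)
(* From then on no Rebuild node enters the tree below a, so that only the     *)
(* finitely many present ones can be completed; afterwards nothing is added.  *)
Lemma below_bounded n0 a B : a = 0 \/ att (g n0) a ->
  (forall n t, wins (g n) t a <= B) ->
  exists M, forall n x, below (mk (g n)) a x -> x < M.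
Proof.
move=> va hB.
have vis n : n0 <= n -> a = 0 \/ att (g n) a.
  by move=> le; case: va => [->|h]; [left | right; exact: att_mono (trace_mono le) h].
have [Nw hw] : exists N, forall n, N <= n -> forall t, wins (g n) t a = wins (g N) t a.
  apply: (@nondecreasing_family_constant _ (fun n t => wins (g n) t a) B) => //.
  by move=> n t; case: (gtrans_counters t a (gT n)).
have [Ni hi] : exists N, forall n, N <= n -> forall t, inst (g n) t a = inst (g N) t a.
  apply: (@nondecreasing_family_constant _ (fun n t => inst (g n) t a) B).
    by move=> n t; case: (gtrans_counters t a (gT n)).
  by move=> n t; apply: leq_trans (hB n t); exact (inv_inst (gI n) t a).
pose N1 := maxn n0 (maxn Nw Ni).
have nc n : N1 <= n -> ~ counted (g n) (g n.+1) a.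
  rewrite !geq_max => /and3P [_ l1 l2] [t].
  by rewrite hw // (hw n.+1) ?leqW // hi // (hi n.+1) ?leqW // !ltnn => -[].
have le1 : n0 <= N1 by rewrite leq_maxl.
pose M1 := size (hp (g N1)).
have rb n op : N1 <= n -> is_rebuild (hp (g n)) op -> below (mk (g n)) a op ->
    below (mk (g N1)) a op.
  elim: n => [|n IH]; first by rewrite leqn0 => /eqP <-.
  rewrite leq_eqVlt => /orP [/eqP <-//|le] ro bo.
  have vn := vis n (leq_trans le1 le).
  have [_ h] := gtrans_events (gI n) (gT n) vn (nc n le).
  have bo' := h op ro bo; apply: IH => //.
  have [nd e] := att_node (gI n) (below_visible vn bo').
  by rewrite -(heap_le_is_rebuild (trace_mono (leqnSn n)) (onth_ltn e)).
have rbM n op : N1 <= n -> is_rebuild (hp (g n)) op -> below (mk (g n)) a op -> op < M1.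
  move=> le ro bo; have b1 := rb n op le ro bo.
  have [nd e] := att_node (gI N1) (below_visible (vis _ le1) b1).
  exact: onth_ltn e.
have [N2 h2] := past_constant M1.
pose N := maxn N1 N2.
(* A completion turns a node below [M1] into a past one, but [past] is constant on these nodes after
   [N2]. *)
have ncp n : N <= n -> ~ completed (g n) (g n.+1) a.
  rewrite geq_max => /andP [l1 l2] [op [ro bo np po]].
  have lt := rbM n op l1 ro bo.
  by have := h2 n op l2 lt; rewrite -(h2 n.+1 op (leqW l2) lt) (negbTE np) po.
have stay n x : N <= n -> below (mk (g n)) a x -> below (mk (g N)) a x.
  elim: n => [|n IH]; first by rewrite leqn0 => /eqP <-.
  rewrite leq_eqVlt => /orP [/eqP <-//|le] bx.
  rewrite ltnS in le.
  have le' : N1 <= n by apply: leq_trans le; exact: leq_maxl.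
  have [[c|h] _] := gtrans_events (gI n) (gT n) (vis n (leq_trans le1 le')) (nc n le').
    by case: (ncp n le).
  exact: IH le (h x bx).
have leN : n0 <= N by apply: leq_trans le1 _; exact: leq_maxl.
exists (size (hp (g N))) => n x bx.
have bx' : below (mk (g N)) a x.
  case: (leqP N n) => [le|lt]; first exact: stay le bx.
  exact: mono_below (trace_mono (ltnW lt)) bx.
have [nd e] := att_node (gI N) (below_visible (vis _ leN) bx').
exact: onth_ltn e.
Qed.

End Stabilization.

(* Distinct nodes on a path have distinct distances from the root.           *)
Lemma depth_bound s e a k x M : invariant s ->
  bel (mk s) 0 e a -> bel (mk s) a k x ->
  (forall y, below (mk s) a y -> y < M) -> k < M.
Proof.
move=> I ra ax hM.
have [l [sz ul hl]] : exists l : seq ptr, [/\ size l = k.+1, uniq l &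
    forall y, y \in l -> below (mk s) a y /\
      exists2 j, j <= k & bel (mk s) 0 (j + e) y].
  elim: {x} ax => [|k' q i x ex bq [l [sz ul hl]]].
    exists [:: a]; split=> // y; rewrite inE => /eqP ->.
    by split; [exact: below_refl | exists 0].
  exists (x :: l); split=> /=; first by rewrite sz.
    rewrite ul andbT; apply/negP => /hl [_ [j lj bj]].
    have bx := BelS ex (bel_trans ra bq).
    have := bel_root_fun (root_unattached I) bj bx; lia.
  move=> y; rewrite inE => /orP [/eqP ->|/hl [by_ [j lj bj]]].
    split; first by apply: below_step ex _; exists k'.
    exists k'.+1 => //; rewrite addSn; exact: BelS ex (bel_trans ra bq).
  by split=> //; exists j => //; exact: leqW.
have sub : {subset l <= iota 0 M} by move=> y /hl [/hM]; rewrite mem_iota.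
by have := uniq_leq_size ul sub; rewrite size_iota sz.
Qed.

(** * Termination of the procedures *)

Section Termination.

Variables (sch : nat -> 'I_p) (g : nat -> state) (t : 'I_p).
Hypothesis gI : forall n, invariant (g n).
Hypothesis gT : forall n, gtrans (sch n) (g n) (g n.+1).

(* Started at time n or later, m ends in finitely many steps of thread t, and *)
(* then Q holds; a crash counts as an end.                                    *)
Inductive term A (Q : nat -> A -> Prop) : nat -> prog A -> Prop :=
| TRet n a : Q n a -> term Q n (Ret a)
| TCrash n : term Q n Crash
| TAct n c k :
    (forall n' r, n <= n' -> sch n' = t ->
       @prim_step d K V (hp (g n')) c r (hp (g n'.+1)) -> term Q n'.+1 (k r)) ->
    term Q n (Act k)
| TCall n f k :
    (forall n', n <= n' -> term Q n'.+1 (bind (body f) k)) -> term Q n (Call k).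

Definition any {A} : nat -> A -> Prop := fun _ _ => True.

Lemma term_bind A B (m : prog A) (k : A -> prog B) Q Q' n :
  term Q n m -> (forall n' a, n <= n' -> Q n' a -> term Q' n' (k a)) ->
  term Q' n (bind m k).
Proof.
elim=> {n m} [n a q|n|n c h _ IH|n f h _ IH] H.
- exact: H q.
- exact: TCrash.
- apply: TAct => n' r le sc st; apply: IH => // n'' a le'; apply: H.
  exact: leq_trans le (ltnW le').
- apply: TCall => n' le; rewrite -bind_assoc.
  apply: IH => // n'' a le'; apply: H; exact: leq_trans le (ltnW le').
Qed.

Lemma term_call A (f : proc) (k : proc_result f -> prog A) Q n :
  (forall n', n < n' -> term any n' (body f)) ->
  (forall n' a, n < n' -> term Q n' (k a)) -> term Q n (bind (call f) k).
Proof.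
move=> Hf Hk; apply: TCall => n' le; apply: term_bind (Hf n'.+1 _) _ => //.
by move=> n'' a le' _; apply: Hk; exact: leq_ltn_trans le'.
Qed.

Lemma term_tailcall (f : proc) n :
  (forall n', n < n' -> term any n' (body f)) -> term any n (call f).
Proof.
move=> H; apply: (TCall (k := @Ret d K V _)) => n' le.
by apply: term_bind (H _ _) _ => // *; exact: TRet.
Qed.

Lemma term_act A (c : prim) (k : response c -> prog A) Q n :
  (forall n' r, n <= n' -> @prim_step d K V (hp (g n')) c r (hp (g n'.+1)) ->
     term Q n'.+1 (k r)) -> term Q n (bind (act c) k).
Proof. by move=> H; apply: TAct => n' r le _; exact: H. Qed.

Lemma term_bindA A B C (m : prog A) (f : A -> prog B) (h : B -> prog C) Q n :
  term Q n (bind m (fun a => bind (f a) h)) -> term Q n (bind (bind m f) h).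
Proof. by rewrite bind_assoc. Qed.

Lemma term_read A w (l : loc w) (k : word w -> prog A) Q n :
  (forall n' v, n <= n' -> load (hp (g n')) l = Some v -> term Q n'.+1 (k v)) ->
  term Q n (bind (read l) k).
Proof. by move=> H; apply: term_act => n' r le [e _]; exact: H. Qed.

Lemma term_read_ptr A (l : loc WPtr) (k : ptr -> prog A) Q n :
  (forall n' c, n <= n' -> load (hp (g n')) l = Some (Some c) ->
     term Q n'.+1 (k c)) ->
  term Q n (bind (read_ptr l) k).
Proof.
move=> H; apply: term_bindA; apply: term_read => n' [c|] le e.
  exact: H.
exact: TCrash.
Qed.

Lemma term_deref A x (k : view K V -> prog A) Q n :
  (forall n' nd, n <= n' -> onth (hp (g n')) x = Some nd ->
     term Q n'.+1 (k (view_of nd))) ->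
  term Q n (bind (deref x) k).
Proof.
move=> H; apply: term_act => n' r le [+ _].
by case e: (onth _ x) => [nd|] //= [<-]; exact: H.
Qed.

Lemma gmono m n : m <= n -> mono (g m) (g n).
Proof. exact: (trace_mono gI gT). Qed.

Lemma term_search k x n : term any n (interpolation_search k x).
Proof.
apply: term_read => n' deg _ _.
elim: deg.-1 0 n'.+1 => [|m IH] i n1; first exact: TRet.
apply: term_read => n2 [ki|] _ _; last exact: TCrash.
by case: ifP => _; [exact: TRet | exact: IH].
Qed.

Definition collects n u := forall n', n <= n' -> term any n' (collect_body u).
Definition marks n u := forall n', n <= n' -> term any n' (mcc_body T u).

(** All later times are covered, since an entry may change before it is read. *)
Definition children (P : nat -> ptr -> Prop) n u := forall n' i c,
  n <= n' -> slot (hp (g n')) u i = Some (Some c) -> P n' c.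

Lemma children_le P n n' u : n <= n' -> children P n u -> children P n' u.
Proof. by move=> le H n'' i c le'; apply: H; exact: leq_trans le'. Qed.

Lemma term_collect_children u acc l n : children collects n u ->
  term any n (collect_children u acc l).
Proof.
elim: l acc n => [|i l IH] acc n H; first exact: TRet.
apply: term_read_ptr => n1 c le1 sl; apply: term_call => [n2 lt2|n2 s lt2].
  by apply: (H n1 i c) => //; exact: ltnW (ltnW lt2).
by apply: IH; apply: children_le H; exact: leq_trans le1 (ltnW (ltnW lt2)).
Qed.

(** Each round includes an increment of [nextMark] by the thread itself, so [deg - nextMark] falls
    whatever the others do. *)
Lemma term_mark u deg n : children marks n u -> term any n (mark_body u deg).
Proof.
move=> H; have [mu] : exists mu, forall n' nn, n <= n' ->
    inner_at (hp (g n')) u = Some nn -> deg - i_nextMark nn <= mu.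
  by exists deg => *; exact: leq_subr.
elim: mu n H => [|mu IH] n H hmu; apply: term_act => n1 ix le1 [e1 e2];
  move: e1 e2; rewrite /=; case e0: (inner_at _ u) => [nn|] //= [<-] e2;
  case: (leqP deg (i_nextMark nn)) => [_|lt]; try exact: TRet;
  have hle := hmu n1 nn le1 e0; first by lia.
apply: term_read_ptr => n2 c le2 sl.
have l12 : n <= n2 by exact: leq_trans le1 (ltnW le2).
apply: term_call => [n3 lt3|n3 _ lt3].
  by apply: (H n2 _ c l12 sl); exact: ltnW (ltnW lt3).
have l03 : n <= n3 by exact: leq_trans l12 (ltnW (ltnW lt3)).
apply: (term_tailcall (f := PMark u deg)) => n4 lt4; apply: IH.
  by apply: children_le H; exact: leq_trans l03 (ltnW lt4).
move=> n5 nn5 le5 e5.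
have e1 : inner_at (hp (g n1.+1)) u = Some (MkInner (i_initSize nn) (i_degree nn)
    (i_keys nn) (i_children nn) (i_status nn) (i_count nn) (i_nextMark nn + 1)).
  by rewrite e2 /update e0 (inner_at_set _ _ e0) eqxx.
have l15 : n1.+1 <= n5 by lia.
have [nn' e' [_ _ _ _ [_ _ nm _ _]]] := heap_le_inner (gmono l15) e1.
by move: e'; rewrite e5 => -[E]; subst nn'; move: nm => /=; lia.
Qed.

Lemma term_count_children u acc l n : children marks n u ->
  term any n (count_children u acc l).
Proof.
elim: l acc n => [|i l IH] acc n H; first exact: TRet.
apply: term_read_ptr => n1 c le1 sl.
have NEXT n2 m : n1 < n2 -> term any n2 (count_children u (acc + m) l).
  by move=> lt; apply: IH; apply: children_le H; exact: leq_trans le1 (ltnW lt).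
have CALL n2 : n1 < n2 -> term any n2 (bind (call (PMCC c))
    (fun m => count_children u (acc + m) l)).
  move=> lt2; apply: term_call => [n3 lt3|n3 m lt3].
    by apply: (H n1 i c le1 sl); exact: ltnW (ltn_trans lt2 lt3).
  by apply: NEXT; exact: ltn_trans lt2 lt3.
apply: term_bindA; apply: term_deref => n2 nd le2 e2.
have lt2 : n1 < n2.+1 by exact: ltnW.
case: nd e2 => [|k v|nn|u' nt q j] e2; try exact: NEXT; try exact: CALL.
apply: term_bindA; apply: term_read => n3 st le3 _.
have lt3 : n1 < n3.+1 by exact: ltn_trans lt2 _.
by case: ifP => _; [exact: NEXT | exact: CALL].
Qed.

(** * Descent in a bounded subtree *)

Section Descent.

(* All nodes that are ever below the Inner node a lie in a bounded part of   *)
(* the heap, so descending from a ends.                                      *)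
Variables (n0 a M : nat).
Hypothesis a_inner : exists n, inner_at (hp (g n0)) a = Some n.
Hypothesis a_root : exists k, bel (mk (g n0)) 0 k a.
Hypothesis a_bound : forall n x, below (mk (g n)) a x -> x < M.

(* The target of a Rebuild node has the depth of that node, but is an Inner  *)
(* node; a child has greater depth than its parent.                          *)
Definition near n x mu := exists2 k, bel (mk (g n)) a k x &
  2 * (M - k) + is_rebuild (hp (g n)) x <= mu.

Lemma bel_bound n k x : n0 <= n -> bel (mk (g n)) a k x -> k < M.
Proof.
move=> le b; have [e0 r] := a_root.
have r' : bel (mk (g n)) 0 e0 a.
  by apply: bel_le r => y q i; exact: mono_at (gmono le).
exact: (depth_bound (gI n) r' b (@a_bound n)).
Qed.

Lemma a_inner_later n : n0 <= n -> exists nn, inner_at (hp (g n)) a = Some nn.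
Proof.
move=> le; have [nn e] := a_inner.
by have [n' e' _] := heap_le_inner (gmono le) e; exists n'.
Qed.

Lemma near_allocated n x mu : n0 <= n -> near n x mu -> x < size (hp (g n)).
Proof.
move=> le [k b _]; case: b => [|k' q i y e _]; last exact: at_allocated (gI n) e.
by have [nn /inner_lt] := a_inner_later le.
Qed.

Lemma near_later n n' x mu : n0 <= n -> n <= n' -> near n x mu -> near n' x mu.
Proof.
move=> le0 le nr; have lt := near_allocated le0 nr; case: nr => k b lk.
have Mo := gmono le; exists k.
  by apply: bel_le b => y q i; exact: mono_at Mo.
by rewrite (heap_le_is_rebuild Mo lt).
Qed.

Lemma near_child n x i c mu : n0 <= n -> near n x mu ->
  slot (hp (g n)) x i = Some (Some c) -> exists2 mu', mu' < mu & near n c mu'.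
Proof.
move=> le [k b lk] sl; have [mc _] := inv_slot (gI n) sl.
(* [k < M] is needed for the truncated difference [M - k] to drop properly; the resulting loss of 2
   outweighs a flag of 1. *)
have lt := bel_bound le b.
exists (2 * (M - k.+1) + is_rebuild (hp (g n)) c); last first.
  by exists k.+1 => //; exact: BelS mc b.
apply: leq_trans lk; case: (is_rebuild _ c); lia.
Qed.

Lemma near_target n x u nt q i mu : n0 <= n -> near n x mu ->
  onth (hp (g n)) x = Some (Rebuild u nt q i) ->
  exists2 mu', mu' < mu & near n u mu'.
Proof.
move=> le [k b lk] e; have [[nu eu] mu_ at_ _] := inv_rebuild (gI n) e.
exists (2 * (M - k)).
  by apply: leq_trans lk; rewrite /is_rebuild e addn1.
exists k; last by rewrite /is_rebuild (iffLR (inner_atP _ _ _) eu) addn0.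
(* Distance zero would make the Inner node [a] a Rebuild node. *)
case: b e at_ mu_ => [|k' q' i' y ey b] e at_ mu_.
  have [nn /inner_atP ea] := a_inner_later le.
  by rewrite ea in e.
by have [? ? _ _] := at_ _ _ ey; subst q' i'; exact: BelS mu_ b.
Qed.

Lemma near_max n k x : bel (mk (g n)) a k x -> near n x (2 * M).+1.
Proof. by move=> b; exists k => //; case: is_rebuild; lia. Qed.

Lemma term_lookup key mu n x : n0 <= n -> near n x mu ->
  term any n (lookup_body key x).
Proof.
elim/ltn_ind: mu n x => mu IH n x le nr.
apply: term_deref => n1 nd le1 e1.
have l01 := leq_trans le le1; have nr1 := near_later le le1 nr.
case: nd e1 => [|k v|nn|u nt q i] e1; try exact: TRet.
- apply: term_bind (term_search _ _ _) _ => n2 j le2 _.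
  apply: term_read_ptr => n3 c le3 sl.
  have l13 : n1 <= n3 by exact: leq_trans (ltnW le2) le3.
  have [mu' lt nr3] := near_child (leq_trans l01 l13) (near_later l01 l13 nr1) sl.
  apply: (term_tailcall (f := PLookup key c)) => n4 lt4.
  have l34 := ltnW (ltnW lt4); have l03 := leq_trans l01 l13.
  exact: IH lt _ _ (leq_trans l03 l34) (near_later l03 l34 nr3).
- have [mu' lt nr2] := near_target l01 nr1 e1.
  apply: (term_tailcall (f := PLookup key u)) => n4 lt4; have l14 := ltnW (ltnW lt4).
  exact: IH lt _ _ (leq_trans l01 l14) (near_later l01 l14 nr2).
Qed.

Lemma term_collect mu n x : n0 <= n -> near n x mu -> collects n x.
Proof.
elim/ltn_ind: mu n x => mu IH n x le nr n' le'.
have {le le'}[le {}nr] : n0 <= n' /\ near n' x mu.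
  by split; [exact: leq_trans le' | exact: near_later le le' nr].
apply: term_deref => n1 nd le1 e1.
have l01 := leq_trans le le1; have nr1 := near_later le le1 nr.
case: nd e1 => [|k v|nn|u nt q i] e1; try exact: TRet.
- apply: term_read => n2 deg le2 _; apply: term_collect_children.
  move=> n3 j c le3 sl; have l13 : n1 <= n3 by exact: leq_trans (ltnW le2) (ltnW le3).
  have [mu' lt nr3] := near_child (leq_trans l01 l13) (near_later l01 l13 nr1) sl.
  exact: IH lt _ _ (leq_trans l01 l13) nr3.
- have [mu' lt nr2] := near_target l01 nr1 e1.
  apply: (term_tailcall (f := PCollect u)) => n4 lt4; have l14 := ltnW (ltnW lt4).
  exact: IH lt _ _ l01 nr2 _ l14.
Qed.

Lemma term_mcc mu n x : n0 <= n -> near n x mu -> marks n x.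
Proof.
elim/ltn_ind: mu n x => mu IH n x le nr n' le'.
have {le le'}[le {}nr] : n0 <= n' /\ near n' x mu.
  by split; [exact: leq_trans le' | exact: near_later le le' nr].
apply: term_deref => n1 nd le1 e1.
have l01 := leq_trans le le1; have nr1 := near_later le le1 nr.
have CH n2 : n1 <= n2 -> children marks n2 x.
  move=> le2 n3 j c le3 sl; have l13 : n1 <= n3 by exact: leq_trans le3.
  have [mu' lt nr3] := near_child (leq_trans l01 l13) (near_later l01 l13 nr1) sl.
  exact: IH lt _ _ (leq_trans l01 l13) nr3.
case: nd e1 => [|k v|nn|u nt q i] e1; try exact: TRet.
- apply: term_act => n2 _ le2 _; apply: term_read => n3 deg le3 _.
  have l13 : n1 <= n3 by exact: leq_trans (ltnW le2) (ltnW le3).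
  have REST n4 : n3 < n4 -> term any n4 (bind (count_children x 0 (iota 0 deg))
      (fun keyCount => bind (@cas d K V WStatus (LStatus x) started
        (finished keyCount)) (fun _ => Ret keyCount))).
    move=> lt4; have h := CH n4 (leq_trans l13 (ltnW lt4)).
    apply: term_bind (term_count_children _ _ h) _ => n5 kc le5 _.
    by apply: term_act => n6 b le6 _; exact: TRet.
  case: ifP => _; last exact: REST.
  apply: term_call => [n4 lt4|n4 r lt4]; last by apply: REST; exact: ltnW.
  by apply: term_mark; apply: CH; exact: leq_trans l13 (ltnW (ltnW lt4)).
- have [mu' lt nr2] := near_target l01 nr1 e1.
  apply: (term_tailcall (f := PMCC u)) => n4 lt4; have l14 := ltnW (ltnW lt4).
  exact: IH lt _ _ l01 nr2 _ l14.
Qed.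

End Descent.

Lemma term_sorted_pairs A u (k : seq (K * V) -> prog A) Q n : collects n u ->
  (forall n' l, n <= n' -> term Q n' (k l)) ->
  term Q n (bind (sorted_pairs u) k).
Proof.
move=> H Hk; apply: term_bindA; apply: term_call => [n1 lt1|n1 l lt1].
  by apply: H; lia.
by apply: Hk; lia.
Qed.

Lemma term_create_ideal A u from cnt (k : ptr -> prog A) Q n : collects n u ->
  (forall n' r, n <= n' -> term Q n' (k r)) ->
  term Q n (bind (create_ideal u from cnt) k).
Proof.
move=> H Hk; apply: term_bindA; apply: term_sorted_pairs => // n1 l le1.
cbv zeta; case: ifP => _; last exact: TCrash.
by apply: term_act => n2 r le2 _; apply: Hk; lia.
Qed.

Definition traversable n op := forall n' u nt q i, n <= n' ->
  onth (hp (g n')) op = Some (Rebuild u nt q i) -> collects n' u /\ marks n' u.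

Lemma traversable_le n n' op : n <= n' -> traversable n op -> traversable n' op.
Proof. by move=> le H n'' u nt q i le'; apply: H; lia. Qed.

Lemma term_set_child A op kc index (k : bool -> prog A) Q n : traversable n op ->
  (forall n' b, n <= n' -> term Q n' (k b)) ->
  term Q n (bind (rebuild_and_set_child op kc index) k).
Proof.
move=> H Hk; apply: term_bindA; apply: term_deref => n1 nd le1 e1.
case: nd e1 => [|x v|nn|u nt q i] e1; try exact: TCrash.
have [Hc _] := H n1 u nt q i le1 e1.
have Hc' n2 : n1 <= n2 -> collects n2 u.
  by move=> le2 n3 le3; apply: Hc; lia.
apply: term_bindA; apply: term_create_ideal; first exact: Hc'.
move=> n2 r le2; apply: term_bindA; apply: term_read_ptr => n3 nt' le3 _.
have l13 : n1 <= n3 by lia.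
have FIN n4 : n1 <= n4 -> term Q n4 (bind (bind (dcss_child nt' index None (Some r))
    (fun res => Ret (if res is FailedAuxAddress then false else true))) k).
  move=> le4; apply: term_bindA; apply: term_act => n5 res le5 _.
  by apply: Hk; lia.
apply: term_bindA; case: ifP => _; last by apply: FIN; lia.
apply: term_bindA; apply: term_bindA.
apply: term_sorted_pairs; first by apply: Hc'; lia.
move=> n4 l le4; case: (onth l _) => [[x v]|]; last exact: TCrash.
apply: term_act => n5 _ le5 _; apply: FIN.
lia.
Qed.

(** The degree grows in every round: a failed CAS shows that another thread has increased it. *)
Lemma term_fill op kc nt n : traversable n op -> term any n (fill_body op kc nt).
Proof.
move=> H; have [mu] : exists mu, forall n' nn, n <= n' ->
    inner_at (hp (g n')) nt = Some nn -> size (i_children nn) - i_degree nn <= mu.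
  (* The length of the children array never changes, so any time at which [nt] is an Inner node
     supplies the bound. *)
  have [[n1 [n2 e2]]|ne] := pselect (exists n1 nn, inner_at (hp (g n1)) nt = Some nn);
    last by exists 0 => n' nn _ e'; case: ne; exists n', nn.
  exists (size (i_children n2)) => n' nn _ e'.
  have [m1 f1 [_ sz1 _ _ _]] := heap_le_inner (gmono (leq_maxl n' n1)) e'.
  have [m2 f2 [_ sz2 _ _ _]] := heap_le_inner (gmono (leq_maxr n' n1)) e2.
  by move: f2; rewrite f1 => -[E]; subst m2; rewrite -sz2 sz1 leq_subr.
elim: mu n H => [|mu IH] n H hmu; apply: term_read => n1 ix le1;
  rewrite /=; case e1: (inner_at _ nt) => [nn|] //= [<-];
  have h1 := hmu n1 nn le1 e1; have [_ _ dg _] := inv_wf (gI n1) e1;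
  apply: term_deref => n2 nd le2 e2; case: nd e2 => [|x v|nn2|? ? ? ?] e2;
  try exact: TCrash; move/inner_atP: e2 => e2;
  have [nn' e3 [_ sz2 _ _ _]] := heap_le_inner (gmono (ltnW le2)) e1;
  move: e3; rewrite e2 => -[E]; subst nn'; rewrite /=;
  case: eqP => ne; try exact: TRet; rewrite sz2 in ne; first by lia.
have LOOP n3 n4 nn3 : n1 <= n3 -> n3 <= n4 -> inner_at (hp (g n3)) nt = Some nn3 ->
    i_degree nn < i_degree nn3 -> term any n4 (call (PFill op kc nt)).
  move=> l13 l34 e3 lt; apply: (term_tailcall (f := PFill op kc nt)) => n5 lt5.
  have l35 := leq_trans l34 (ltnW lt5).
  apply: IH.
    by apply: traversable_le H; lia.
  move=> n6 nn6 l56 e6; have l36 := leq_trans l35 l56.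
  have [m6 e6' [_ _ _ _ [_ _ _ dg6 _]]] := heap_le_inner (gmono l36) e3.
  move: e6'; rewrite e6 => -[E]; subst m6.
  have [m6 e6' [_ sz6 _ _ _]] := heap_le_inner (gmono (leq_trans l13 l36)) e1.
  by move: e6'; rewrite e6 => -[E]; subst m6; rewrite sz6; lia.
apply: term_act => n3 ok le3 [y]; rewrite /=.
case e3: (inner_at _ nt) => [nn3|] //= [<-] [-> hh].
have l13 : n1 <= n3 by lia.
have [m3 e3' [_ _ _ _ [_ _ _ dg3 _]]] := heap_le_inner (gmono l13) e1.
move: e3'; rewrite e3 => -[E]; subst m3.
case: eqP hh => [eqd hh|neq _]; last by apply: (LOOP n3 n3.+1 nn3) => //; lia.
have e4 : exists2 nn4, inner_at (hp (g n3.+1)) nt = Some nn4 & i_degree nn < i_degree nn4.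
  by rewrite hh /update e3 (inner_at_set _ _ e3) eqxx; eexists.
have [nn4 e4' lt4] := e4.
apply: term_set_child.
  by apply: traversable_le H; lia.
move=> n5 b le5; case: b; last exact: TRet.
by apply: (LOOP n3.+1 n5 nn4) => //; lia.
Qed.

Lemma term_fill_null op kc nt l n : traversable n op ->
  term any n (fill_null op kc nt l).
Proof.
elim: l n => [|i l IH] n H; first exact: TRet.
apply: term_read => n1 c le1 _.
have H1 := traversable_le (leq_trans le1 (leqnSn _)) H.
case: c => [c|]; first exact: IH.
apply: term_set_child => // n2 b le2; case: b; last exact: TRet.
by apply: IH; exact: traversable_le H1.
Qed.

Lemma term_create_collaborative A op kc (k : ptr -> prog A) Q n :
  traversable n op ->
  (forall n' r u q i, n <= n' ->
     onth (hp (g n')) op = Some (Rebuild u (Some r) q i) -> term Q n' (k r)) ->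
  term Q n (bind (create_ideal_collaborative T op kc) k).
Proof.
rewrite create_ideal_collaborativeE => H Hk.
apply: term_bindA; apply: term_deref => n1 nd le1 e1.
case: nd e1 => [|x v|nn|u nt q i] e1; try exact: TCrash.
have [Hc _] := H n1 u nt q i le1 e1; rewrite [view_of _]/=.
have l01 : n <= n1.+1 by lia.
have READY n2 r u' q' i' : n1 < n2 ->
    onth (hp (g n2)) op = Some (Rebuild u' (Some r) q' i') ->
    forall n3, n2 <= n3 ->
    term Q n3 (bind (fill_ideal op kc r) k).
  rewrite /fill_ideal => lt2 e2 n3 le3.
  have l02 := leq_trans l01 lt2.
  have RET n4 : n2 <= n4 -> term Q n4 (k r).
    move=> le4; have [nt4 e4 /(_ _ erefl) E] :=
      heap_le_rebuild (gmono le4) e2.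
    by subst nt4; apply: Hk e4; lia.
  have H4 n4 : n2 <= n4 -> traversable n4 op.
    by move=> le4; apply: traversable_le H; lia.
  case: ifP => _; first exact: RET.
  apply: term_bindA; apply: term_call => [n4 lt4|n4 go lt4].
    by apply: term_fill; apply: H4; lia.
  have l24 := leq_trans le3 (ltnW lt4).
  apply: term_bindA; case: go; last exact: RET.
  apply: term_bindA; apply: term_deref => n5 nd le5 _.
  have l25 := leq_trans l24 (leq_trans le5 (leqnSn _)).
  case: nd => [|? ?|nn|? ? ? ?]; try exact: TCrash.
  apply: term_bind (term_fill_null _ _ _ (H4 _ l25)) _ => n6 _ le6 _.
  by apply: RET; lia.
have REST n2 new : n1 < n2 -> term Q n2 (bind (publish_ideal op kc new) k).
  move=> lt2; apply: term_bindA; apply: term_act => n3 ok le3 [y].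
  rewrite [load _ _]/=; case e3: (onth _ op) => [[| | |u' nt' q' i']|] //= [<-] [-> hh].
  have lt3 : n1 < n3 by lia.
  case: eqP hh => [E hh|ne _]; last first.
    apply: term_bindA; apply: term_read_ptr => n4 r le4 e4.
    move: e4; rewrite /=; case e4: (onth _ op) => [[| | |u4 nt4 q4 i4]|] //= [E].
    by apply: (READY n4 r u4 q4 i4) => //; [lia | rewrite e4 E].
  apply: (READY n3.+1 new u' q' i') => //; first lia.
  by rewrite hh e3 onth_set_nth ?eqxx // (onth_ltn e3).
apply: term_bindA.
case: ifP => _.
  apply: term_create_ideal => [n2 le2|n2 r le2]; last exact: REST.
  by apply: Hc; lia.
by apply: term_act => n2 r le2 _; apply: REST; lia.
Qed.

(** The final DCSS is exposed with its heaps, so that [Q] may be taken to be [False] when that step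
    is impossible. *)
Lemma term_help_rebuild op Q n : traversable n op ->
  (forall n' r res u q i, n <= n' ->
     onth (hp (g n')) op = Some (Rebuild u (Some r) q i) ->
     @prim_step d K V (hp (g n'))
       (@Dcss _ _ V WPtr (LChild q i) (Some op) (Some r) WStatus (LStatus q) clean)
       res (hp (g n'.+1)) -> Q n'.+1 tt) ->
  term Q n (help_rebuild T op).
Proof.
move=> H HQ; apply: term_deref => n1 nd le1 e1.
case: nd e1 => [|x v|nn|u nt q i] e1; try exact: TCrash.
have [_ Hm] := H n1 u nt q i le1 e1; rewrite [view_of _]/=.
apply: term_call => [n2 lt2|n2 kc lt2]; first by apply: Hm; lia.
have l12 := ltnW (ltnW lt2).
apply: term_create_collaborative.
  by apply: traversable_le H; lia.
move=> n3 r u3 q3 i3 le3 e3; have l13 := leq_trans l12 le3.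
apply: term_act => n4 res le4 st; apply: TRet.
have [nt4 e4 _] := heap_le_rebuild (gmono (leq_trans l13 le4)) e1.
have [nt4' e4' /(_ _ erefl) E] := heap_le_rebuild (gmono le4) e3.
subst nt4'; apply: (HQ n4 r res u q i); last exact: st.
  lia.
by move: e4; rewrite e4' => -[-> _ -> ->].
Qed.

End Termination.

(** * Termination of updates in a bounded tree *)

Section Updates.

Variables (sch : nat -> 'I_p) (g : nat -> state) (t : 'I_p).
Hypothesis gI : forall n, invariant (g n).
Hypothesis gT : forall n, gtrans (sch n) (g n) (g n.+1).

Local Notation term := (@term sch g t).
Local Notation gmono := (gmono gI gT).

Lemma term_bump path n : term any n (bump_counts path).
Proof.
elim: path n => [|[m j] path IH] n; first exact: TRet.
by apply: term_act => n1 r le1 _; exact: IH.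
Qed.

Lemma term_replacement (u : update_op) cur n : term any n (replacement u cur).
Proof.
have LEAF (x : node) m : term any m (bind (alloc x) (fun r => Ret (Some r))).
  by apply: term_act => n1 r _ _; exact: TRet.
case: u cur => [k v|k] [[k' v']|] /=; try exact: TRet; try exact: LEAF.
- case: eqP => _; first exact: LEAF.
  set ab := if _ then _ else _; case: ab => a b.
  by do 2!(apply: term_act => ? ? _ _); exact: LEAF.
- by case: eqP => _; [exact: LEAF | exact: TRet].
Qed.

Variable M : nat.
Hypothesis bounded : forall n x, below (mk (g n)) 0 x -> x < M.

Lemma root_inner n : exists nn, inner_at (hp (g n)) 0 = Some nn.
Proof. by case: (inv_root (gI n)). Qed.

Lemma root_below_itself n : exists k, bel (mk (g n)) 0 k 0.
Proof. by exists 0; exact: Bel0. Qed.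

(** An attached Rebuild node shares its position with its target, which therefore lies in the
    bounded tree below the root. *)
Lemma traversable_att n op : att (g n) op ->
  traversable sch g t n op.
Proof.
move=> a0 n' u nt q i le e.
have [q' [i' m]] := att_mono (gmono le) a0.
have [_ mu at_ _] := inv_rebuild (gI n') e.
have [? ? _ b] := at_ _ _ m; subst q' i'.
have [k bq] : below (mk (g n')) 0 q.
  case: (below_inv m b) => // E; move: m; rewrite E.
  by move=> /(root_not_at (gI n')).
have nr := near_max M (BelS mu bq).
split.
- exact: (term_collect t gI gT (root_inner n') (root_below_itself n') bounded
    (leqnn n') nr).
- exact: (term_mcc t gI gT (root_inner n') (root_below_itself n') bounded
    (leqnn n') nr).
Qed.

Lemma term_rebuild m parent j n : term any n (rebuild T m parent j).
Proof.
apply: term_act => n1 op le1 _; apply: term_act => n2 res le2 st.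
case: res st => [|_|_]; try exact: TRet.
move=> [y [y' [ly ly' [ey ey' eh]]]].
apply: (term_help_rebuild gI gT) => //; apply: traversable_att.
exists parent, j; apply: (proj1 (inv_slot (gI n2.+1) _)).
move: ly; rewrite eh /=; case e0: (inner_at _ parent) => [nn|] //= ec.
by apply/slotP; rewrite /update e0 (inner_at_set _ _ e0) eqxx; eexists;
  rewrite //= onth_set_nth ?eqxx // (onth_ltn ec).
Qed.

Lemma term_rebuild_first parent path n : term any n (rebuild_first rR T parent path).
Proof.
elim: path parent n => [|[m j] path IH] parent n; first exact: TRet.
apply: term_deref => n1 nd le1 _; case: nd => [|? ?|nn|? ? ? ?]; try exact: TCrash.
apply: term_read => n2 c le2 _; case: ifP => _; last exact: IH.
exact: term_rebuild.
Qed.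

(** The hypotheses are the continuations of one round, each with the observation that leads to it:
    descending, helping a rebuild, restarting because [x] is marked, and retrying because the entry
    has changed. *)
Lemma term_update_with (u : update_op) x path n :
  (forall n1 n2 i c path', n <= n1 -> n1 < n2 ->
     slot (hp (g n1)) x i = Some (Some c) -> ~~ is_rebuild (hp (g n1)) c ->
     term any n2 (call (PUpdate u c path'))) ->
  (forall n1 n2 i c, n <= n1 -> n1 < n2 ->
     slot (hp (g n1)) x i = Some (Some c) ->
     is_rebuild (hp (g n1)) c ->
     term any n2 (bind (help_rebuild T c) (fun _ => call (PUpdate u ist_root [::])))) ->
  (forall n1 n2 nx, n <= n1 -> n1 < n2 -> inner_at (hp (g n1)) x = Some nx ->
     i_status nx <> clean -> term any n2 (call (PUpdate u ist_root [::]))) ->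
  (forall n1 n2 n3 i c, n <= n1 -> n1 <= n2 -> n2 < n3 ->
     slot (hp (g n1)) x i = Some (Some c) ->
     slot (hp (g n2)) x i <> Some (Some c) ->
     term any n3 (call (PUpdate u x path))) ->
  term any n (update_body rR T u x path).
Proof.
move=> Hd Hh Ha Hm; apply: term_bind (term_search sch g t _ _ _) _ => n1 i le1 _.
apply: term_read_ptr => n2 c le2 sl; apply: term_deref => n3 nd le3 e3.
have l02 := leq_trans le1 le2.
have lt23 : n2 < n3.+1 by lia.
have lc : c < size (hp (g n2)).
  have [mc _] := inv_slot (gI n2) sl; exact: at_allocated (gI n2) mc.
have RB : is_rebuild (hp (g n3)) c = is_rebuild (hp (g n2)) c.
  by apply: heap_le_is_rebuild => //; apply: mono_heap; apply: gmono; lia.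
have REPL cur : term any n3.+1 (replace_child rR T u x path i c cur).
  apply: term_bind (term_replacement _ _ _) _ => n4 r le4 _.
  case: r => [r|]; last exact: TRet.
  apply: term_act => n5 res le5 st.
  case: res st => [_|st|st].
  - apply: term_bind (term_bump _ _) _ => n6 _ _ _; exact: term_rebuild_first.
  - move: st => [y [y' [ly _ [ne _]]]].
    apply: (Hm n2 n5 _ i c) => //; first by lia.
    by move: ly; rewrite /slot /= => -> [].
  - move: st => [y [y' [_ ly [ne _]]]]; move: ly; rewrite /=.
    case e0: (inner_at _ x) => [nx|] //= [E]; subst y'.
    by apply: (Ha n5 _ nx) => //; lia.
case: nd e3 => [|k v|nc|u' nt q j] e3; try exact: REPL.
- by apply: (Hd n2 _ i) => //; rewrite -RB /is_rebuild e3.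
- by apply: (Hh n2 _ i) => //; rewrite -RB /is_rebuild e3.
Qed.

Variable N : nat.
Hypothesis frozen_past : forall n x, N <= n -> x < M ->
  past (g n) x = past (g N) x.

(** A change of the entry would make [c] past, but after [N] no node of the tree becomes past. *)
Lemma slot_stable n n' x i c : N <= n -> n <= n' -> below (mk (g n)) 0 x ->
  slot (hp (g n)) x i = Some (Some c) -> slot (hp (g n')) x i = Some (Some c).
Proof.
move=> leN le bx sl; have [mc np] := inv_slot (gI n) sl.
have lt := bounded (below_step mc bx).
have [c' sl' [pc|E]] := inv_cur (gI n') (mono_at (gmono le) mc); last by subst c'.
by move: np; rewrite frozen_past // -(frozen_past (leq_trans leN le) lt) pc.
Qed.

Lemma not_dead_later n n' x : N <= n -> n <= n' -> below (mk (g n)) 0 x ->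
  ~ dead (g n) x -> ~ dead (g n') x.
Proof.
move=> leN le b nd [y py by_]; apply: nd.
have {}by_ := mono_below_root (gmono le) (gI n') b by_.
exists y => //; have lt := bounded (below_between (gI n) b by_).
by rewrite frozen_past // -(frozen_past (leq_trans leN le) lt).
Qed.

Local Notation near := (near g 0 M).

Lemma near_root n : near n 0 (2 * M).+1.
Proof. exact: (near_max M (Bel0 _ _)). Qed.

(* Once the tree no longer changes, an update that walks from the root only  *)
(* meets unmarked nodes, and both its own DCSS and that of a helped rebuild  *)
(* would succeed.                                                            *)
Lemma term_update_live (u : update_op) mu n x path :
  N <= n -> near n x mu -> ~ dead (g n) x -> term any n (update_body rR T u x path).
Proof.
elim/ltn_ind: mu n x path => mu IH n x path leN nr nd.
have NR n' : n <= n' -> near n' x mu.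
  by move=> le; exact: (near_later gI gT (root_inner n) (leqnn n) le nr).
have BX n' : n <= n' -> below (mk (g n')) 0 x by move=> /NR [k b _]; exists k.
have ND n' : n <= n' -> ~ dead (g n') x.
  by move=> le; apply: not_dead_later nd => //; exact: BX.
apply: term_update_with.
- move=> n1 n2 i c path' le1 lt2 sl _.
  have [mu' lt' nr'] := near_child gI gT (root_below_itself n) bounded le1 (NR _ le1) sl.
  have [mc np] := inv_slot (gI n1) sl.
  apply: (term_tailcall (f := PUpdate u c path')) => n3 lt3; apply: (IH _ lt').
  + lia.
  + apply: (near_later gI gT (root_inner n1) (leqnn n1) _ nr'); lia.
  + case: (nr') => k b _; apply: (not_dead_later (n := n1)); [lia|lia|by exists k|].
    move=> dc; case: (dead_inv mc dc) => [pc|]; last exact: ND.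
    by rewrite pc in np.
- move=> n1 n2 i c le1 lt2 sl rc.
  have [mc np] := inv_slot (gI n1) sl.
  have ac : att (g n2) c by exists x, i; apply: mono_at mc; apply: gmono; lia.
  (* The DCSS of the helper would replace [c], or meet a changed entry, or a marked live parent.
     None of these can happen, so the continuation is never reached. *)
  apply: (term_bind (Q := fun _ _ => False)) => //.
  apply: (term_help_rebuild gI gT); first exact: traversable_att.
  move=> n3 r res u' q j le3 e3 st.
  have l13 : n1 <= n3 by lia.
  have m3 := mono_at (gmono l13) mc.
  have [_ _ /(_ _ _ m3) [? ? _ _] /(_ _ erefl) [[kc [_ nr' _ _]] _]] :=
    inv_rebuild (gI n3) e3.
  subst q j.
  have s3 : slot (hp (g n3)) x i = Some (Some c).
    by apply: slot_stable sl => //; [exact: leq_trans le1 | exact: BX].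
  have s4 : slot (hp (g n3.+1)) x i = Some (Some c).
    by apply: slot_stable s3 => //; [lia | apply: BX; lia].
  case/slotP: (s3) => nx ex ec.
  move: st => [y [y' [ly ly']]]; move: ly ly'; rewrite /= ex /= ec => -[<-] [<-].
  case: res => [[_ _ eh]|[//]|[ne _]].
  + move: s4; rewrite eh /update ex slot_set_child // ?(onth_ltn ec) // !eqxx.
    by move=> [E]; subst r; rewrite /is_rebuild e3 in nr'.
  + by apply: (ND n3); [lia | exact (inv_status (gI n3) ex ne)].
- move=> n1 n2 nx le1 lt2 ex ne; case: (ND n1 le1).
  exact (inv_status (gI n1) ex ne).
- move=> n1 n2 n3 i c le1 le2 lt3 sl ns; case: ns.
  by apply: slot_stable sl => //; [exact: leq_trans le1 | exact: BX].
Qed.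

Lemma term_restart (u : update_op) n : N <= n ->
  term any n (call (PUpdate u ist_root [::])).
Proof.
move=> leN; apply: (term_tailcall (f := PUpdate u ist_root [::])) => n1 lt1.
exact (term_update_live u [::] (leq_trans leN (ltnW lt1)) (near_root n1)
  (root_not_dead (gI n1))).
Qed.

Lemma term_help_any op n : att (g n) op -> term any n (help_rebuild T op).
Proof.
by move=> a0; apply: (term_help_rebuild gI gT) => //; exact: traversable_att.
Qed.

(** From a possibly dead node the walk descends the bounded tree until it ends or restarts at the
    root, where [term_update_live] takes over. *)
Lemma term_update_stable (u : update_op) mu n x path :
  N <= n -> near n x mu -> term any n (update_body rR T u x path).
Proof.
elim/ltn_ind: mu n x path => mu IH n x path leN nr.
have NR n' : n <= n' -> near n' x mu.
  by move=> le; exact: (near_later gI gT (root_inner n) (leqnn n) le nr).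
have BX n' : n <= n' -> below (mk (g n')) 0 x by move=> /NR [k b _]; exists k.
apply: term_update_with.
- move=> n1 n2 i c path' le1 lt2 sl _.
  have [mu' lt' nr'] := near_child gI gT (root_below_itself n) bounded le1 (NR _ le1) sl.
  apply: (term_tailcall (f := PUpdate u c path')) => n3 lt3; apply: (IH _ lt').
  + lia.
  + apply: (near_later gI gT (root_inner n1) (leqnn n1) _ nr'); lia.
- move=> n1 n2 i c le1 lt2 sl rc.
  have [mc np] := inv_slot (gI n1) sl.
  have ac : att (g n2) c by exists x, i; apply: mono_at mc; apply: gmono; lia.
  apply: term_bind (term_help_any ac) _ => n3 _ le3 _; apply: term_restart; lia.
- by move=> n1 n2 nx le1 lt2 ex ne; apply: term_restart; lia.
- move=> n1 n2 n3 i c le1 le2 lt3 sl ns; case: ns.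
  by apply: slot_stable sl => //; [exact: leq_trans le1 | exact: BX].
Qed.

(** Induction on the time left until [N]: every continuation is a call that starts strictly
    later. *)
Lemma term_update (u : update_op) n x path k :
  bel (mk (g n)) 0 k x -> term any n (update_body rR T u x path).
Proof.
have [m] : exists m, N - n <= m by exists (N - n).
elim: m n x path k => [|m IH] n x path k le b.
  by apply: term_update_stable (near_max M b); lia.
have CALL n1 n2 y path' : n <= n1 -> n1 < n2 -> below (mk (g n1)) 0 y ->
    term any n2 (call (PUpdate u y path')).
  move=> le1 lt2 b1; apply: (term_tailcall (f := PUpdate u y path')) => n3 lt3.
  have le13 : n1 <= n3 by lia.
  have [k' b3] := mono_below (gmono le13) b1.
  by apply: IH b3; lia.
have bx n1 : n <= n1 -> below (mk (g n1)) 0 x.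
  by move=> le1; apply: mono_below (gmono le1) _; exists k.
apply: term_update_with.
- move=> n1 n2 i c path' le1 lt2 sl _; apply: (CALL n1) => //.
  by have [mc _] := inv_slot (gI n1) sl; exact: below_step mc (bx n1 le1).
- move=> n1 n2 i c le1 lt2 sl rc.
  have [mc np] := inv_slot (gI n1) sl.
  have ac : att (g n2) c by exists x, i; apply: mono_at mc; apply: gmono; lia.
  apply: term_bind (term_help_any ac) _ => n3 _ le3 _.
  by apply: (CALL n1) => //; [lia | exact: below_refl].
- by move=> n1 n2 nx le1 lt2 ex ne; apply: (CALL n1) => //; exact: below_refl.
- by move=> n1 n2 n3 i c le1 le2 lt3 sl ns; apply: (CALL n1) => //; [lia | exact: bx].
Qed.

End Updates.

(** * Progress *)

Lemma thread_step_inv h (x : thread) h' x' : thread_step rR T h x h' x' ->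
  match x with
  | Idle => exists o, x' = Running (call (op_proc o))
  | Running o m =>
      match m with
      | Ret _ => x' = Idle
      | Call f k => x' = Running (bind (body f) k)
      | Act c k => (exists2 r, @prim_step d K V h c r h' & x' = Running (k r)) \/
                   x' = @Running d K V o Crash
      | Crash => x' = @Running d K V o Crash
      end
  end.
Proof.
case=> [o|o a|o f k|o c k r h1 st|o c k ne|o] //; first by exists o.
  by left; exists r.
by right.
Qed.

Definition op_of (x : thread) := if x is Running o _ then Some o else None.

Lemma thread_step_op h (x : thread) h' x' : thread_step rR T h x h' x' ->
  [\/ x = Idle /\ exists o, x' = Running (call (op_proc o)), x' = Idle |
      op_of x' = op_of x].
Proof.
case=> [o|o a|o f k|o c k r h1 st|o c k ne|o].
1: by constructor 1; split=> //; exists o.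
all: by [constructor 2 | constructor 3].
Qed.

Lemma runningP (P : pred operation) (x : thread) :
  running P x <-> exists2 o, op_of x = Some o & P o.
Proof.
case: x => [|o m] /=; first by split=> // -[].
by split=> [Po|[o' [<-]]]; first by exists o.
Qed.

(** * From terminating programs to completed operations *)

Section Execution.

Variables (sch : nat -> 'I_p) (e : nat -> config) (g : nat -> state).
Hypothesis ge : forall n, config_ok (e n) (g n).
Hypothesis gT : forall n, gtrans (sch n) (g n) (g n.+1).
Hypothesis est : forall n, step rR T (sch n) (e n) (e n.+1).
Hypothesis e0 : initial (e 0).

Lemma thread_waits t n n' : n <= n' ->
  (forall j, n <= j < n' -> sch j != t) -> thr (e n') t = thr (e n) t.
Proof.
elim: n' => [|n' IH]; first by rewrite leqn0 => /eqP ->.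
rewrite leq_eqVlt => /orP [/eqP -> //|]; rewrite ltnS => le H.
rewrite -IH //; last by move=> j hj; apply: H; lia.
have [_ -> //] := est n'; rewrite eq_sym; apply: H; lia.
Qed.

Lemma next_step t n : infinitely_often (fun n => sch n = t) ->
  exists n', [/\ n <= n', sch n' = t & thr (e n') t = thr (e n) t].
Proof.
move=> inf; have ex : exists n', (n <= n') && (sch n' == t).
  by have [n' le E] := inf n; exists n'; rewrite le E eqxx.
case: (ex_minnP ex) => n' /andP [le /eqP E] hm; exists n'; split=> //.
apply: thread_waits => // j /andP [l1 l2]; apply/negP => h.
by have := hm j; rewrite l1 h => /(_ isT); lia.
Qed.

(** Although [term] accepts a crash as an end, [thread_ok] rules it out along the annotated
    execution. *)
Lemma term_completes t o (m : prog (proc_result (op_proc o))) n :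
  infinitely_often (fun n => sch n = t) ->
  @term sch g t _ any n m -> thr (e n) t = Running m ->
  exists2 j, n < j & thr (e j) t = Idle.
Proof.
move=> inf H; elim: H => {n m} [n a _|n|n c k _ IH|n f k _ IH] E.
all: have [n' [le sn tn]] := next_step n inf; rewrite E in tn.
all: have [st _] := est n'; rewrite sn tn in st; have := thread_step_inv st.
- by move=> E'; exists n'.+1.
- have [_ _ /(_ t)] := ge n; by rewrite E.
- case=> [[r pr E']|E'].
    have [h1 _ _] := ge n'; have [h2 _ _] := ge n'.+1; rewrite -h1 -h2 in pr.
    have [j lt Ej] := IH n' r le sn pr E'; exists j => //; lia.
  by have [_ _ /(_ t)] := ge n'.+1; rewrite E'.
- by move=> E'; have [j lt Ej] := IH n' le E'; exists j => //; lia.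
Qed.

(** Termination is known for the initial program of an operation, so a running thread is traced back
    to its invocation. *)
Lemma thread_invoked t o n : op_of (thr (e n) t) = Some o ->
  exists n0, [/\ n0 < n, thr (e n0.+1) t = Running (call (op_proc o)) &
    forall j, n0 < j <= n -> op_of (thr (e j) t) = Some o].
Proof.
elim: n => [|n IH] E; first by rewrite e0.2 in E.
have [Eo|ne] := pselect (op_of (thr (e n) t) = Some o).
  have [n0 [lt E0 H0]] := IH Eo; exists n0; split=> //; first exact: ltnW.
  move=> j /andP [lt0]; rewrite leq_eqVlt => /orP [/eqP -> //|le].
  by apply: H0; rewrite lt0.
exists n; split=> //; last by move=> j ?; have -> : j = n.+1 by lia.
have [st same] := est n; have [sn|nt] := eqVneq (sch n) t; last first.
  by case: ne; rewrite -same // eq_sym.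
rewrite sn in st; case: (thread_step_op st).
- by move=> [_ [o' Eq]]; move: E; rewrite Eq => -[Eo]; subst o'.
- by move=> Eq; rewrite Eq in E.
- by move=> Eq; case: ne; rewrite -Eq.
Qed.

Lemma operation_completes t o i :
  infinitely_often (fun n => sch n = t) ->
  (forall n, @term sch g t _ any n (call (op_proc o))) ->
  op_of (thr (e i) t) = Some o ->
  exists j, [/\ i <= j, sch j = t, op_of (thr (e j) t) = Some o &
    thr (e j.+1) t = Idle].
Proof.
move=> inf tm Ei.
have [n0 [lt0 E0 H0]] := thread_invoked Ei.
have [j lt1 E1] := term_completes inf (tm n0.+1) E0.
have lti : i < j.
  rewrite ltnNge; apply/negP => le; have := H0 j; rewrite le E1 ltnW //.
  by move=> /(_ isT).
have exj : exists j, (i < j) && ~~ op_of (thr (e j) t).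
  by exists j; rewrite lti E1.
(* The first time after [i] at which [t] is idle comes right after the step that returns from
   [o]. *)
case: (ex_minnP exj) => -[|k] // /andP [lek Ek] min {j lt1 E1 lti exj}.
have before j : i <= j -> j <= k -> op_of (thr (e j) t) = Some o.
  elim: j => [|j IH]; first by rewrite leqn0 => /eqP <-.
  rewrite leq_eqVlt => /orP [/eqP <- //|lt] le.
  have Ej := IH lt (ltnW le); have [st same] := est j.
  have [sj|ne] := eqVneq (sch j) t; last by rewrite same // eq_sym.
  rewrite sj in st; case: (thread_step_op st).
  - by move=> [E _]; rewrite E in Ej.
  - move=> E; have := min j.+1; rewrite E (leq_trans lt) // => /(_ isT); lia.
  - by move=> ->.
have Ek' := before k lek (leqnn k); have [st same] := est k.
have [sk|ne] := eqVneq (sch k) t; last first.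
  by move: Ek; rewrite same 1?eq_sym // Ek'.
exists k; split=> //; rewrite sk in st; case: (thread_step_op st) => //.
- by move=> [E _]; rewrite E in Ek'.
- by move=> E; rewrite E Ek' in Ek.
Qed.

End Execution.

(** The root is on the path of every update, so a win at the root occurs in the same step as the
    change of [fin] from false to true. *)
Lemma gstep_root_wins t s s' t' : gstep t s s' ->
  wins s' t' 0 + fin s t' <= wins s t' 0 + fin s' t'.
Proof.
case=> // q i c r n w' i' f' _ _ _ _ sk; case: sk => //= path _ _ f0 _ _.
rewrite /incr mem_head andbT; case: eqP => [->|_] /=; last by rewrite addn0.
by rewrite f0 addn0.
Qed.

Lemma gsteps_root_wins t s s' t' : gsteps t s s' ->
  wins s' t' 0 + fin s t' <= wins s t' 0 + fin s' t'.
Proof.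
by elim=> // s1 s2 s3 G _ IH; have := gstep_root_wins t' G; lia.
Qed.

Lemma updates_lock_free : @lock_free d K V F rR T p (@is_update d K V).
Proof.
move=> sch e ex inf; apply: contrapT => h.
have [N0 hN0] : exists N0, forall n, N0 <= n ->
    ~ (running (@is_update d K V) (thr (e n) (sch n)) /\
       thr (e n.+1) (sch n) = Idle).
  apply: contrapT => h'; apply: h => N; apply: contrapT => h2; apply: h'.
  by exists N => n le q; apply: h2; exists n.
have [[e0 est] [g gh]] := (ex, ghost_trace ex).
have ge n : config_ok (e n) (g n) by case: (gh n).
have gT n : gtrans (sch n) (g n) (g n.+1) by case: (gh n) => _ [].
have gI n : invariant (g n) by case: (ge n).
have gf n t' : N0 <= n -> fin (g n) t' -> fin (g n.+1) t'.
  move=> le f1; apply: contrapT => /negP f2; have [_ [_ H]] := gh n.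
  by have [_ r i] := H t' f1 f2; case: (hN0 n le).
have W n t' : N0 <= n ->
    wins (g n) t' 0 + fin (g N0) t' <= wins (g N0) t' 0 + fin (g n) t'.
  elim: n => [|n IH]; first by rewrite leqn0 => /eqP <-.
  rewrite leq_eqVlt => /orP [/eqP <- //|le]; have := IH le.
  have := gf n t' le; case: (gT n) => [G _|-> /=].
    by have := gsteps_root_wins t' G; lia.
  by case: (t' == sch n); case: (fin (g n) t') => // /(_ isT).
(* As no update completes after [N0], [fin] is never lowered again, so each thread wins at the root
   at most once more. *)
pose B := (\max_t' wins (g N0) t' 0).+1.
have hB n t' : wins (g n) t' 0 <= B.
  have hb : wins (g N0) t' 0 <= \max_t' wins (g N0) t' 0.
    exact: (leq_bigmax (F := fun t' => wins (g N0) t' 0)).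
  have [le|lt] := leqP N0 n.
    by have := W n t' le; rewrite /B; case: (fin (g n) t'); lia.
  by have := trace_wins gT t' 0 (ltnW lt); rewrite /B; lia.
have [M bounded] :=
  below_bounded (n0 := 0) (a := 0) gI gT (or_introl erefl) hB.
have [N frozen_past] := past_constant gI gT M.
(* Among finitely many threads, one takes infinitely many of these steps. *)
have [t it] : exists t, infinitely_often
    (fun n => sch n = t /\ running (@is_update d K V) (thr (e n) t)).
  apply: contrapT => h'.
  have HN t : exists N1, forall n, N1 <= n ->
      ~ (sch n = t /\ running (@is_update d K V) (thr (e n) t)).
    apply: contrapT => h1; apply: h'; exists t => N1; apply: contrapT => h2.
    by apply: h1; exists N1 => n le q; apply: h2; exists n.
  have [N1 hN1] := fin_all_exists HN.
  have [n le r] := inf (\max_t N1 t).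
  by apply: (hN1 (sch n) n) => //; apply: leq_trans le; exact: leq_bigmax.
have [n1 le1 [_ r1]] := it N0.
have /runningP [o Eo uo] := r1.
have [|n|j [lej sj Ej Ij]] := operation_completes ge est e0 (t := t) (o := o) _ _ Eo.
- by move=> n; have [n' le' [E _]] := it n; exists n'.
- have U (u : update_op) : @term sch g t _ any n
      (call (PUpdate u ist_root [::])).
    apply: (term_tailcall (f := PUpdate u ist_root [::])) => n' _.
    exact: (term_update t gI gT bounded frozen_past u _ (Bel0 _ _)).
  by case: (o) uo => [k v|k|k] // _; exact: U.
- apply: (hN0 j (leq_trans le1 lej)); rewrite sj; split=> //.
  by apply/runningP; exists o.
Qed.

(** * Termination of lookups *)

Section Lookups.

Variables (sch : nat -> 'I_p) (g : nat -> state) (t : 'I_p).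
Hypothesis gI : forall n, invariant (g n).
Hypothesis gT : forall n, gtrans (sch n) (g n) (g n.+1).

Local Notation term := (@term sch g t _).

(** [inv_wins] and the constancy of [initSize] bound the wins at [a] for all times, so the subtree
    of [a] is bounded whatever happens at the root. *)
Lemma term_lookup_inner n a key : (exists nn, inner_at (hp (g n)) a = Some nn) ->
    (exists l, bel (mk (g n)) 0 l a) -> a != 0 -> att (g n) a ->
    forall n', n <= n' -> term any n' (lookup_body key a).
Proof.
move=> ai a_root a0 va; have [nn ea] := ai.
have hB n' t' : wins (g n') t' a <= Num.bound (rR * (i_initSize nn)%:R + 1)%R.
  apply: leq_trans (trace_wins gT t' a (leq_maxr n n')) _.
  have M := trace_mono gI gT (leq_maxl n n').
  have [nn' ea' [E _ _ _ _]] := heap_le_inner M ea.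
  have := inv_wins (gI (maxn n n')) t' a0 ea'; rewrite E => hw.
  rewrite -(ler_nat F); apply: le_trans hw (ltW _); apply: archi_boundP.
  by rewrite addr_ge0 // mulr_ge0 // ltW.
have [M bounded] := below_bounded gI gT (or_intror va) hB.
move=> n' le; have nr := near_max M (Bel0 (mk (g n)) a).
have := near_later gI gT ai (leqnn n) le nr.
exact: (term_lookup t gI gT ai a_root bounded key le).
Qed.

(** Updates through the root may go on for ever, but one child is read there and the search
    continues in that child. If it is a Rebuild node, its target is an Inner node directly below the
    root. *)
Lemma term_lookup_root n0 key : term any n0 (lookup_body key 0).
Proof.
have CALL n a :
    (forall n', n <= n' -> term any n' (lookup_body key a)) ->
    term any n (call (PLookup key a)).
  by move=> H; apply: (term_tailcall (f := PLookup key a)) => n' /ltnW; exact: H.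
apply: term_deref => n1 nd _ e1.
have [nr /inner_atP e1'] : exists nr, inner_at (hp (g n1)) 0 = Some nr.
  by case: (inv_root (gI n1)).
move: e1'; rewrite e1 => -[E]; subst nd.
apply: term_bind (term_search sch g t _ _ _) _ => n2 j _ _.
apply: term_read_ptr => n3 c _ sl; have [mc _] := inv_slot (gI n3) sl.
have vc : att (g n3) c by exists 0, j.
have not0 q i' x : mk (g n3) x = At q i' -> x != 0.
  by move=> e'; apply/eqP => x0; case: (root_not_at (q := q) (i := i') (gI n3)); rewrite -x0.
have [nd ec] := att_node (gI n3) (or_intror vc).
have later n4 : n3 < n4 -> exists2 nd', onth (hp (g n4)) c = Some nd' &
    view_of nd' = view_of nd.
  by move=> lt; apply: heap_le_view ec; exact: mono_heap (trace_mono gI gT (ltnW lt)).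
apply: (CALL) => n4 lt4.
case: nd ec later => [|k' v'|nc|u nt q i'] ec later.
- apply: term_deref => n5 nd' le5 e5; have [|nd2] := later n5; first exact: leq_trans le5.
  by rewrite e5 => -[<-] ->; exact: TRet.
- apply: term_deref => n5 nd' le5 e5; have [|nd2] := later n5; first exact: leq_trans le5.
  by rewrite e5 => -[<-] ->; exact: TRet.
- have ci : exists n, inner_at (hp (g n3)) c = Some n by exists nc; apply/inner_atP.
  have c1 : exists l, bel (mk (g n3)) 0 l c by exists 1; exact: BelS mc (Bel0 _ _).
  exact (term_lookup_inner key ci c1 (not0 _ _ _ mc) vc (ltnW lt4)).
- have [ui mu at_ _] := inv_rebuild (gI n3) ec.
  have [q0 _ _ _] := at_ _ _ mc; subst q.
  apply: term_deref => n5 nd' le5 e5; have [|nd2] := later n5; first exact: leq_trans le5.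
  rewrite e5 => -[<-] ->; apply: (CALL) => n6 lt6.
  have u1 : exists l, bel (mk (g n3)) 0 l u by exists 1; exact: BelS mu (Bel0 _ _).
  have vu : att (g n3) u by exists 0, i'.
  apply: (term_lookup_inner key ui u1 (not0 _ _ _ mu) vu).
  exact: leq_trans (ltnW (leq_trans lt4 le5)) (ltnW lt6).
Qed.

End Lookups.

Lemma lookups_wait_free : @wait_free d K V F rR T p (@is_lookup d K V).
Proof.
move=> sch e ex t i run inf.
have [[e0 est] [g gh]] := (ex, ghost_trace ex).
have ge n : config_ok (e n) (g n) by case: (gh n).
have gT n : gtrans (sch n) (g n) (g n.+1) by case: (gh n) => _ [].
have gI n : invariant (g n) by case: (ge n).
have /runningP [o Eo lo] := run.
have [n|j [le _ _ Ij]] := operation_completes ge est e0 inf _ Eo; last by exists j.+1.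
case: o lo {Eo} => // k _.
apply: (term_tailcall (f := PLookup k ist_root)) => n0 _.
exact: (term_lookup_root t gI gT).
Qed.

End Progress.

Theorem corollary3p15 (d : Order.disp_t) (K : orderType d) (V : Type)
    (F : realType) (R : F) (T p : nat)
    (hR : (0 < R)%R) (hT : (0 < T)%N) :
  @lock_free d K V F R T p (@is_update d K V) /\
  @wait_free d K V F R T p (@is_lookup d K V).
Proof.
by split; [exact: updates_lock_free hR hT | exact: lookups_wait_free hR hT].
Qed.
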